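(* Every graph $G$ has a tree of tree-decompositions that is canonical with respect to the set of profiles $\{P_\omega : \omega \text{ an end of } G\}$ and that distinguishes every two distinct profiles $P_\omega, P_{\omega'}$ of this set efficiently.
   Context: Graphs may be infinite. A separation of a graph $G$ is an ordered pair $(A,B)$ of subsets of $V(G)$ with $A\cup B=V(G)$ such that no edge joins $A\setminus B$ to $B\setminus A$; its order is $|A\cap B|$. A profile is a set of separations $P$ with: (P1) if $(C,D)\le(A,B)$ (i.e. $C\subseteq A$, $B\subseteq D$) and $(A,B)\in P$ then $(D,C)\notin P$; (P2) if $(A,B),(C,D)\in P$ then $(B\cap D,A\cup C)\notin P$. A separation $(A,B)$ distinguishes profiles $P,P'$ if $(A,B)\in P,(B,A)\in P'$ or vice versa, and efficiently if no separation of smaller order distinguishes them. A ray is a one-way infinite path; two rays are equivalent if for every finite $S\subseteq V(G)$ some component of $G-S$ contains all but finitely many vertices of both; ends are the equivalence classes. An end $\omega$ lies in the component of $G-S$ containing tails of its rays. $P_\omega$ is the set of separations $(A,B)$ of finite order such that the component of $G-(A\cap B)$ in which $\omega$ lies is contained in $B$. Tree-decompositions $(T,(V_t)_{t\in V(T)})$ are standard; an edge $e$ of $T$ with components $T_1,T_2$ of $T-e$ induces the separations $(\bigcup_{s\in T_1}V_s,\bigcup_{s\in T_2}V_s)$ and its reverse. The torso of a part $V_t$ is $G[V_t]$ together with all edges $xy$ for distinct $x,y$ lying in a common adhesion set $V_t\cap V_s$, $s$ a neighbour of $t$. For a torso $H$ of $V_t$ and a profile $P$ of $G$, the induced set is $P_H=\{(A\cap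 V_t,B\cap V_t):(A,B)\in P\text{ and }(A\cap V_t,B\cap V_t)\text{ is a separation of }H\}$. A tree of tree-decompositions of $G$ is a triple $((T,r),(G_t)_{t\in V(T)},(T_t,\mathcal V_t)_{t\in V(T)})$ where $(T,r)$ is a rooted tree (level of $t$ is $d(t,r)+1$), $G_r=G$, each $(T_t,\mathcal V_t)$ is a tree-decomposition of $G_t$, and for each node $t$ the graphs assigned to its neighbours on the next level are distinct torsos of $(T_t,\mathcal V_t)$. Profiles of $G$ induce (iteratively, along the path from $r$) sets of separations on each $G_t$. The tree of tree-decompositions distinguishes two profiles $P,Q$ of $G$ (efficiently) if there is a node $t$ and a separation of $G_t$ induced by an edge of $T_t$ that distinguishes the induced sets of $P$ and $Q$ on $G_t$ (efficiently) and is induced (i.e. of the form $(A\cap V(G_t),B\cap V(G_t))$) by a separation $(A,B)$ of $G$ that distinguishes $P$ and $Q$ (efficiently). A construction from a graph $G$ and a set $\mathcal P$ of profiles is canonical with respect to $\mathcal P$ if it commutes with all isomorphisms: whenever $\varphi:G\to G'$ is an isomorphism mapping $\mathcal P$ onto a set $\mathcal P'$ of profiles of $G'$, $\varphi$ maps the object constructed for $(G,\mathcal P)$ onto the object constructed for $(G',\mathcal P')$. *)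

(* Defs.v *)
(* everything is stated with Prop-valued predicates, so that
   graphs may be infinite. *)
From Stdlib Require Import List Arith Relations.
Import ListNotations.
Set Implicit Arguments.
Unset Strict Implicit.

Record Graph := {
  vert : Type;
  adj : vert -> vert -> Prop;
  adj_sym : forall x y, adj x y -> adj y x;
  adj_irrefl : forall x, ~ adj x x }.
Arguments adj g x y : clear implicits.
Arguments vert g : clear implicits.

Definition has_card {V : Type} (X : V -> Prop) (n : nat) : Prop :=
  exists l : list V, NoDup l /\ length l = n /\ forall x, X x <-> In x l.

Definition finite_set {V : Type} (X : V -> Prop) : Prop := exists n, has_card X n.

Definition setI {V : Type} (A B : V -> Prop) : V -> Prop := fun x => A x /\ B x.

(** * Separations.
   A separation of the graph with vertex set [W] and adjacency [a]
   (vertices and sets live in an ambient type [V]). *)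
Definition is_sep {V : Type} (W : V -> Prop) (a : V -> V -> Prop)
  (A B : V -> Prop) : Prop :=
  (forall x, W x <-> A x \/ B x) /\
  (forall x y, A x -> ~ B x -> B y -> ~ A y -> ~ a x y).

Definition sepset (V : Type) := (V -> Prop) -> (V -> Prop) -> Prop.

Definition distinguishes {V : Type} (P Q : sepset V) (A B : V -> Prop) : Prop :=
  (P A B /\ Q B A) \/ (Q A B /\ P B A).

Definition eff_dist {V : Type} (W : V -> Prop) (a : V -> V -> Prop)
  (P Q : sepset V) (A B : V -> Prop) : Prop :=
  is_sep W a A B /\ distinguishes P Q A B /\
  exists n, has_card (setI A B) n /\
    forall C D m, is_sep W a C D -> distinguishes P Q C D ->
      has_card (setI C D) m -> n <= m.

Definition full {V : Type} : V -> Prop := fun _ => True.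

Record ray (G : Graph) := {
  rv : nat -> vert G;
  rv_inj : forall m n, rv m = rv n -> m = n;
  rv_adj : forall n, adj G (rv n) (rv (S n)) }.

Definition reach (G : Graph) (S : vert G -> Prop) (x y : vert G) : Prop :=
  ~ S x /\ clos_refl_trans (vert G)
              (fun a b => adj G a b /\ ~ S a /\ ~ S b) x y.
Arguments reach G S x y : clear implicits.

Definition ray_equiv (G : Graph) (r1 r2 : ray G) : Prop :=
  forall S : vert G -> Prop, finite_set S ->
    exists v, ~ S v /\ exists N, forall n, N <= n ->
      reach G S v (rv r1 n) /\ reach G S v (rv r2 n).

Definition is_end (G : Graph) (w : ray G -> Prop) : Prop :=
  exists r, forall r', w r' <-> ray_equiv r r'.

Definition P_end (G : Graph) (w : ray G -> Prop) : sepset (vert G) :=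
  fun A B =>
    is_sep full (adj G) A B /\ finite_set (setI A B) /\
    forall v, ~ setI A B v ->
      (forall r, w r -> exists N, forall n, N <= n -> reach G (setI A B) v (rv r n)) ->
      forall x, reach G (setI A B) v x -> B x.

Definition end_profiles (G : Graph) : sepset (vert G) -> Prop :=
  fun P => exists w, is_end w /\ forall A B, P A B <-> P_end w A B.
Arguments end_profiles G _ : clear implicits.

Fixpoint chain {T : Type} (a : T -> T -> Prop) (p : list T) : Prop :=
  match p with
  | x :: ((y :: _) as q) => a x y /\ chain a q
  | _ => True
  end.

Definition is_path {T : Type} (a : T -> T -> Prop) (x y : T) (p : list T) : Prop :=
  hd_error p = Some x /\ last p x = y /\ chain a p /\ NoDup p.

Definition is_cycle {T : Type} (a : T -> T -> Prop) (p : list T) : Prop :=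
  3 <= length p /\ NoDup p /\ chain a p /\
  exists x, hd_error p = Some x /\ a (last p x) x.

Definition is_tree (T : Type) (a : T -> T -> Prop) : Prop :=
  inhabited T /\
  (forall x y, a x y -> a y x) /\ (forall x, ~ a x x) /\
  (forall x y, exists p, is_path a x y p) /\
  (forall p, ~ is_cycle a p).

Definition on_path {T : Type} (a : T -> T -> Prop) (x z y : T) : Prop :=
  exists p, is_path a x y p /\ In z p.

Record TD (V : Type) (W : V -> Prop) (ag : V -> V -> Prop) := {
  tnode : Type;
  tadj : tnode -> tnode -> Prop;
  t_tree : is_tree tadj;
  part : tnode -> V -> Prop;
  part_sub : forall t x, part t x -> W x;
  td_cover : forall x, W x -> exists t, part t x;
  td_edge : forall x y, W x -> W y -> ag x y -> exists t, part t x /\ part t y;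
  td_T3 : forall t1 t2 t3, on_path tadj t1 t2 t3 ->
            forall x, part t1 x -> part t3 x -> part t2 x }.

Definition tside {V W ag} (D : @TD V W ag) (s u : tnode D) : tnode D -> Prop :=
  clos_refl_trans (tnode D)
    (fun a b => tadj a b /\ ~ ((a = s /\ b = u) \/ (a = u /\ b = s))) s.

Definition edge_sepA {V W ag} (D : @TD V W ag) (s u : tnode D) : V -> Prop :=
  fun x => exists t, tside s u t /\ part t x.
Definition edge_sepB {V W ag} (D : @TD V W ag) (s u : tnode D) : V -> Prop :=
  fun x => exists t, tside u s t /\ part t x.

Definition torso_adj {V W ag} (D : @TD V W ag) (u : tnode D) (x y : V) : Prop :=
  part u x /\ part u y /\ x <> y /\
  (ag x y \/ exists s, tadj u s /\ part s x /\ part s y).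

(** * Trees of tree-decompositions.
   Every graph [G_t] is represented by its vertex set [gW t] (a subset of
   [V(G)]) and its adjacency [gadj t]. *)
Definition child {T : Type} (a : T -> T -> Prop) (r t c : T) : Prop :=
  a t c /\ on_path a r t c.

Record ToTD (G : Graph) := {
  node : Type;
  nadj : node -> node -> Prop;
  n_tree : is_tree nadj;
  root : node;
  gW : node -> vert G -> Prop;
  gadj : node -> vert G -> vert G -> Prop;
  gW_root : forall x, gW root x;
  gadj_root : forall x y, gadj root x y <-> adj G x y;
  td : forall t, TD (gW t) (gadj t);
  child_torso : forall t, exists f : node -> tnode (td t),
    (forall c, child nadj root t c ->
       (forall x, gW c x <-> part (f c) x) /\
       (forall x y, gadj c x y <-> torso_adj (f c) x y)) /\
    (forall c1 c2, child nadj root t c1 -> child nadj root t c2 ->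
       f c1 = f c2 -> c1 = c2) }.

Definition restrict_sep {G : Graph} (X : ToTD G) (Q : sepset (vert G)) (c : node X)
  : sepset (vert G) :=
  fun C D => is_sep (gW c) (gadj c) C D /\
    exists A B, Q A B /\ (forall x, C x <-> A x /\ gW c x) /\
                         (forall x, D x <-> B x /\ gW c x).

Definition indP {G : Graph} (X : ToTD G) (P : sepset (vert G)) (t : node X)
  : sepset (vert G) :=
  fun A B => exists p, is_path (@nadj G X) (root X) t p /\
     fold_left (fun Q c => restrict_sep Q c) (tl p) P A B.

Definition totd_dist_eff {G : Graph} (X : ToTD G) (P Q : sepset (vert G)) : Prop :=
  exists (t : node X) (s u : tnode (td t)), tadj s u /\
    eff_dist (gW t) (gadj t) (indP P t) (indP Q t) (edge_sepA s u) (edge_sepB s u) /\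
    exists A B, eff_dist full (adj G) P Q A B /\
      (forall x, edge_sepA s u x <-> A x /\ gW t x) /\
      (forall x, edge_sepB s u x <-> B x /\ gW t x).

Definition img {V V' : Type} (f : V -> V') (A : V -> Prop) : V' -> Prop :=
  fun y => exists x, A x /\ f x = y.

Definition is_graph_iso {G G' : Graph} (f : vert G -> vert G') : Prop :=
  (exists g : vert G' -> vert G, (forall x, g (f x) = x) /\ (forall y, f (g y) = y)) /\
  (forall x y, adj G x y <-> adj G' (f x) (f y)).

Definition maps_profiles {V V' : Type} (f : V -> V')
  (Ps : sepset V -> Prop) (Ps' : sepset V' -> Prop) : Prop :=
  forall P', Ps' P' <-> exists P, Ps P /\
    forall A' B', P' A' B' <-> exists A B, P A B /\
      (forall y, A' y <-> img f A y) /\ (forall y, B' y <-> img f B y).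

Definition maps_totd {G G' : Graph} (f : vert G -> vert G') (X : ToTD G) (Y : ToTD G')
  : Prop :=
  exists h : node X -> node Y,
    (exists hi : node Y -> node X, (forall a, hi (h a) = a) /\ (forall b, h (hi b) = b)) /\
    (forall a b, nadj a b <-> nadj (h a) (h b)) /\
    h (root X) = root Y /\
    (forall t y, gW (h t) y <-> img f (gW t) y) /\
    (forall t x y, gadj t x y <-> gadj (h t) (f x) (f y)) /\
    forall t, exists k : tnode (td t) -> tnode (td (h t)),
      (exists ki : tnode (td (h t)) -> tnode (td t),
          (forall a, ki (k a) = a) /\ (forall b, k (ki b) = b)) /\
      (forall a b, tadj a b <-> tadj (k a) (k b)) /\
      (forall u y, part (k u) y <-> img f (part u) y).

Definition canonical_end_construction (F : forall G : Graph, ToTD G) : Prop :=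
  forall (G G' : Graph) (f : vert G -> vert G'),
    is_graph_iso f ->
    maps_profiles f (end_profiles G) (end_profiles G') ->
    maps_totd f (F G) (F G').

(* Main.v *)
(** Two ends separated by [k] but no fewer vertices are separated by some [k]-set [S]; the
   components of [G - S] containing them are full, that is, every vertex of [S] has a neighbour in
   them.  Halin's lemma (only finitely many tight [x]-[y] separators of a given size) shows that
   such an [S] crosses only finitely many others.  Recursively in [k], choose for each pair of ends
   all the [k]-sets separating it that are nested with everything chosen before and cross the least
   number of such sets.  Submodularity of corners shows that they exist and are pairwise nested.

   The tree of tree-decompositions treats the orders [k] one after the other.  In a torso whose
   ends are not separated by fewer than [k] vertices, first a star cuts off the components of the
   chosen [k]-separators in which no end of the torso lives.  Then these separators, together with
   the regions between them, form a tree: by Halin's lemma again, only finitely many of them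
   lie between two given ones.  Two ends that converge to the same end of this tree are equal, so
   inequivalent ends which no chosen [k]-set separates live in a common region, and the next order
   is treated in the torso of that region. *)

From Stdlib Require Import List FinFun Arith Lia Relations Classical ClassicalEpsilon.
From Stdlib Require Import FunctionalExtensionality PropExtensionality ProofIrrelevance.
Require Import Defs.
Import ListNotations.
Set Implicit Arguments.
Unset Strict Implicit.

(** * Finite sets *)

(** Halin's lemma controls separators of one size only; chosen separators of all orders together
    could accumulate between two of them, and then no single tree could carry them. This is why
    every order gets its own tree. The directions of that tree are the components in which a living
    end lies. Efficiency makes them full, so a separator between two places is tight for two fixed
    vertices and Halin's lemma applies. A vertex in a component without a living end would point
    into a possibly non-full component, where this argument fails; such components are therefore cut
    off before the tree is built. Torsos are described by walks of [G] outside a vertex set, not by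
    the decomposition they come from. Iterated torsos are then determined by one vertex set, and two
    facts about it ([inv]) are carried from step to step. Nothing is ever selected: all optimal
    separators, all components to be cut off and all regions are kept, including regions in which no
    end lives. Canonicity thus reduces to the invariance of each definition under isomorphism. *)

Lemma pred_ext (V : Type) (A B : V -> Prop) : (forall x, A x <-> B x) -> A = B.
Proof.
  intro H. apply functional_extensionality. intro x.
  apply propositional_extensionality. apply H.
Qed.

Definition dec (P : Prop) : {P} + {~ P} := excluded_middle_informative P.

Section Card.
Variable V : Type.
Implicit Types (A B X Y : V -> Prop).

Lemma card_ext A B n : (forall x, A x <-> B x) -> has_card A n -> has_card B n.
Proof. intros H. rewrite (pred_ext H). auto. Qed.

Lemma card_unique A n m : has_card A n -> has_card A m -> n = m.
Proof.
  intros (l & Hl & El & Il) (l' & Hl' & El' & Il').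
  assert (length l <= length l').
  { apply NoDup_incl_length; auto. intros x Hx. apply Il', Il, Hx. }
  assert (length l' <= length l).
  { apply NoDup_incl_length; auto. intros x Hx. apply Il, Il', Hx. }
  lia.
Qed.

Lemma card_disj A B a b : has_card A a -> has_card B b ->
  (forall x, A x -> ~ B x) -> has_card (fun x => A x \/ B x) (a + b).
Proof.
  intros (l & Hl & El & Il) (l' & Hl' & El' & Il') D.
  exists (l ++ l'). split; [| split].
  - apply NoDup_app; auto. intros x Hx Hx'. apply (D x); [apply Il | apply Il']; auto.
  - rewrite length_app. lia.
  - intro x. rewrite in_app_iff, Il, Il'. tauto.
Qed.

Lemma card_split A (P : V -> Prop) n : has_card A n ->
  exists a b, has_card (fun x => A x /\ P x) a /\
              has_card (fun x => A x /\ ~ P x) b /\ a + b = n.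
Proof.
  intros (l & Hl & El & Il).
  set (f := fun x => if dec (P x) then true else false).
  assert (Hf : forall x, f x = true <-> P x).
  { intro x. unfold f. destruct (dec (P x)); split; intros; auto; try discriminate; tauto. }
  exists (length (filter f l)), (length (filter (fun x => negb (f x)) l)).
  split; [| split].
  - exists (filter f l). split; [apply NoDup_filter; auto | split; auto].
    intro x. rewrite filter_In, Il, Hf. tauto.
  - exists (filter (fun x => negb (f x)) l). split; [apply NoDup_filter; auto | split; auto].
    intro x. rewrite filter_In, Il.
    rewrite <- Hf. destruct (f x); simpl; intuition discriminate.
  - rewrite filter_length. exact El.
Qed.

Lemma card_sub A B n : has_card A n -> (forall x, B x -> A x) ->
  exists m, has_card B m /\ m <= n /\ (m = n -> forall x, A x -> B x).
Proof.
  intros HA HB. destruct (card_split B HA) as (a & b & Ha & Hb & E).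
  exists a. split; [| split].
  - revert Ha. apply card_ext. firstorder.
  - lia.
  - intros -> x Ax. assert (b = 0) by lia. subst b.
    destruct Hb as ([|y l] & _ & L & I); [| discriminate].
    apply NNPP. intro N. apply (proj1 (I x)). auto.
Qed.

Lemma card_le A B n m : has_card A n -> has_card B m -> (forall x, B x -> A x) -> m <= n.
Proof.
  intros HA HB S. destruct (card_sub HA S) as (m' & Hm & L & _).
  rewrite (card_unique HB Hm). auto.
Qed.

Lemma card_eq_sub A B n : has_card A n -> has_card B n -> (forall x, B x -> A x) -> A = B.
Proof.
  intros HA HB S. apply pred_ext. intro x. split; auto.
  destruct (card_sub HA S) as (m' & Hm & _ & E). apply E. apply (card_unique Hm HB).
Qed.

Lemma card_lt A B n m a : has_card A n -> has_card B m -> (forall x, B x -> A x) ->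
  A a -> ~ B a -> m < n.
Proof.
  intros HA HB S Aa Ba. pose proof (card_le HA HB S).
  assert (m <> n); [| lia]. intros ->. rewrite (card_eq_sub HA HB S) in Aa. auto.
Qed.

Lemma card_union_inter A B a b : has_card A a -> has_card B b ->
  exists u i, has_card (fun x => A x \/ B x) u /\ has_card (fun x => A x /\ B x) i /\
    u + i = a + b.
Proof.
  intros HA HB. destruct (card_split A HB) as (i & d & Hi & Hd & E).
  exists (a + d), i. split; [| split].
  - assert (D : forall x, A x -> ~ (B x /\ ~ A x)) by tauto.
    generalize (card_disj HA Hd D). apply card_ext. intro x. destruct (classic (A x)); tauto.
  - revert Hi. apply card_ext. tauto.
  - lia.
Qed.

Lemma card_remove A n v : has_card A (S n) -> A v -> has_card (fun x => A x /\ x <> v) n.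
Proof.
  intros HA Av. destruct (card_split (fun x => x = v) HA) as (a & b & Ha & Hb & E).
  assert (H1 : has_card (fun x => A x /\ x = v) 1).
  { exists [v]. split; [repeat constructor; simpl; tauto | split; auto].
    intro x. simpl. split; intros; intuition subst; auto. }
  pose proof (card_unique Ha H1). replace n with b by lia. exact Hb.
Qed.

Lemma card0 A x : has_card A 0 -> ~ A x.
Proof. intros ([|y l] & _ & L & I) H; [apply (I x), H | discriminate]. Qed.

Lemma card_pos A n : has_card A (S n) -> exists x, A x.
Proof.
  intros ([|y l] & _ & L & I); [discriminate |]. exists y. apply I. simpl; auto.
Qed.

Lemma finite_list A (l : list V) : (forall x, A x -> In x l) -> finite_set A.
Proof.
  revert A. induction l as [|y l IH]; intros A H.
  - exists 0, []. split; [constructor | split; [auto |]]. firstorder.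
  - destruct (IH (fun x => A x /\ x <> y)) as (n & Hn).
    { intros x (Ax & N). destruct (H x Ax); [congruence | auto]. }
    destruct (classic (A y)) as [Ay | Ny].
    + exists (1 + n).
      assert (H1 : has_card (fun x => x = y) 1).
      { exists [y]. split; [repeat constructor; simpl; tauto | split; auto].
        intro x. simpl. intuition congruence. }
      generalize (card_disj H1 Hn (fun x e (h : A x /\ x <> y) => proj2 h e)).
      apply card_ext. intro x. split.
      * intros [-> | []]; auto.
      * intro Ax. destruct (classic (x = y)); auto.
    + exists n. revert Hn. apply card_ext. intro x. split; [tauto|].
      intro Ax. split; auto. congruence.
Qed.

Lemma list_finite A : finite_set A -> exists l, forall x, A x <-> In x l.
Proof. intros (n & l & _ & _ & I). exists l. auto. Qed.

Lemma finite_sub A B : finite_set A -> (forall x, B x -> A x) -> finite_set B.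
Proof. intros (n & HA) S. destruct (card_sub HA S) as (m & Hm & _). exists m. auto. Qed.

Lemma finite_union A B : finite_set A -> finite_set B -> finite_set (fun x => A x \/ B x).
Proof.
  intros (n & HA) (m & HB). destruct (card_union_inter HA HB) as (u & i & Hu & _). exists u; auto.
Qed.

Lemma finite_card A n : has_card A n -> finite_set A.
Proof. exists n; auto. Qed.

Lemma finite_single (v : V) : finite_set (fun x => x = v).
Proof. apply finite_list with [v]. simpl. auto. Qed.
End Card.

Lemma finite_sig (T : Type) (P Q : T -> Prop) : finite_set (fun x => P x /\ Q x) ->
  finite_set (fun s : {x | P x} => Q (proj1_sig s)).
Proof.
  intros F. destruct (list_finite F) as (l & Hl).
  apply finite_list with (flat_map (fun x => match dec (P x) with
    | left H => [exist P x H] | right _ => [] end) l).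
  intros (x & Px) Qx. simpl in Qx. apply in_flat_map. exists x. split; [apply Hl; auto |].
  destruct (dec (P x)) as [H|]; [| tauto]. left. f_equal. apply proof_irrelevance.
Qed.

Lemma finite_min (P : nat -> Prop) : (exists n, P n) -> exists n, P n /\ forall m, P m -> n <= m.
Proof.
  intros (n & H). revert H. induction n as [n IH] using lt_wf_ind. intro H.
  destruct (classic (exists m, P m /\ m < n)) as [(m & Pm & L) | N].
  - apply (IH m); auto.
  - exists n. split; auto. intros m Pm.
    destruct (le_lt_dec n m) as [|l]; auto. exfalso. apply N. exists m. auto.
Qed.

Lemma list_choice (I T : Type) (Q : I -> T -> Prop) :
  (forall i, exists L, forall t, Q i t -> In t L) ->
  forall l, exists L, forall i t, In i l -> Q i t -> In t L.
Proof.
  intros H. induction l as [|i l (L & HL)].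
  - exists []. simpl. tauto.
  - destruct (H i) as (L' & HL'). exists (L' ++ L). intros j t [-> | J] Hq;
      apply in_or_app; eauto.
Qed.

(** * Components *)

Section Reach.
Variable G : Graph.
Notation V := (vert G).
Implicit Types (S T C A B W : V -> Prop) (x y z : V).

Lemma reach_notin_l S x y : reach G S x y -> ~ S x.
Proof. intros (H & _); auto. Qed.

Lemma reach_refl S x : ~ S x -> reach G S x x.
Proof. intro H. split; auto. apply rt_refl. Qed.

Lemma reach_step S x y z : reach G S x y -> ~ S y -> adj G y z -> ~ S z -> reach G S x z.
Proof. intros (H & R) N A N'. split; auto. eapply rt_trans; [exact R |]. apply rt_step; auto. Qed.

Lemma reach_ind S x (P : V -> Prop) : P x ->
  (forall y z, reach G S x y -> ~ S y -> P y -> adj G y z -> ~ S z -> P z) ->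
  forall y, reach G S x y -> P y.
Proof.
  intros P0 Ps y (N & R). apply clos_rt_rtn1 in R. induction R as [|y z (A & N1 & N2) R IH]; auto.
  apply (Ps y z); auto. split; auto. apply clos_rtn1_rt; auto.
Qed.

Lemma reach_notin_r S x y : reach G S x y -> ~ S y.
Proof.
  intro H. pattern y. apply (reach_ind (S := S) (x := x)); auto. apply (reach_notin_l H).
Qed.

Lemma reach_trans S x y z : reach G S x y -> reach G S y z -> reach G S x z.
Proof. intros (H & R) (H' & R'). split; auto. eapply rt_trans; eauto. Qed.

Lemma reach_sym S x y : reach G S x y -> reach G S y x.
Proof.
  intro H. pattern y. apply (reach_ind (S := S) (x := x)); auto.
  - apply reach_refl, (reach_notin_l H).
  - intros u v _ Nu R A Nv. apply reach_trans with u; auto.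
    apply reach_step with v; auto. apply reach_refl; auto. apply adj_sym; auto.
Qed.

Lemma reach_next S x y z : reach G S x y -> adj G y z -> ~ S z -> reach G S x z.
Proof. intros H. apply reach_step; auto. apply (reach_notin_r H). Qed.

Lemma reach_shift S T x y : reach G S x y -> (forall z, reach G S x z -> ~ T z) -> reach G T x y.
Proof.
  intros H N. assert (Nx : ~ S x) by apply (reach_notin_l H).
  assert (E : reach G S x y /\ reach G T x y); [| tauto].
  pattern y. apply (reach_ind (S := S) (x := x)); auto.
  - split; [apply reach_refl; auto |]. apply reach_refl, N, reach_refl; auto.
  - intros u v Ru Nu (_ & R) A Nv. assert (reach G S x v) by (eapply reach_next; eauto).
    split; auto. eapply reach_next; eauto.
Qed.

Lemma reach_mono S T x y : (forall z, T z -> S z) -> reach G S x y -> reach G T x y.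
Proof.
  intros H R. apply (reach_shift R). intros z Rz Tz. apply (reach_notin_r Rz); auto.
Qed.

Lemma reach_eq S x y : reach G S x y -> reach G S x = reach G S y.
Proof.
  intro R. apply pred_ext. intro z. split; intro H; eapply reach_trans; eauto using reach_sym.
Qed.

Definition side S C :=
  (forall x, C x -> ~ S x) /\ (forall x y, C x -> adj G x y -> ~ S y -> C y).

Lemma side_reach S C x y : side S C -> C x -> reach G S x y -> C y.
Proof. intros (H1 & H2) Cx. apply reach_ind; auto. intros; eauto. Qed.

Lemma side_comp S v : side S (reach G S v).
Proof. split; [apply reach_notin_r |]. intros; eapply reach_next; eauto. Qed.

Lemma side_compl S C : side S C -> side S (fun x => ~ C x /\ ~ S x).
Proof.
  intros (H1 & H2). split; [tauto |]. intros x y (NC & NS) A Ny. split; auto.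
  intro Cy. apply NC. apply (H2 y); auto. apply adj_sym; auto.
Qed.

(** * Ends *)

Definition tail (r : nat -> V) C := exists N, forall n, N <= n -> C (r n).

Lemma tail_and r A B : tail r A -> tail r B -> tail r (fun x => A x /\ B x).
Proof.
  intros (n & Hn) (m & Hm). exists (n + m). intros i L. split; [apply Hn | apply Hm]; lia.
Qed.

Lemma tail_mono r A B : (forall x, A x -> B x) -> tail r A -> tail r B.
Proof. intros H (n & Hn). exists n. auto. Qed.

Lemma tail_ex r A : tail r A -> exists x, A x.
Proof. intros (n & Hn). exists (r n). auto. Qed.

Lemma tail_ex2 r A B : tail r A -> tail r B -> exists x, A x /\ B x.
Proof. intros HA HB. apply (tail_ex (tail_and HA HB)). Qed.

(* Ends are represented by the sequences below, among which are all rays. *)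
Definition isend (r : nat -> V) := forall S, finite_set S -> exists v, tail r (reach G S v).

Lemma tail_comp r S v x : tail r (reach G S v) -> reach G S v x -> tail r (reach G S x).
Proof. intros H R. rewrite <- (reach_eq R). auto. Qed.

Lemma tail_same r S v w : tail r (reach G S v) -> tail r (reach G S w) -> reach G S v w.
Proof.
  intros H H'. destruct (tail_ex2 H H') as (x & R & R'). apply reach_trans with x; auto.
  apply reach_sym; auto.
Qed.

Lemma tail_reach_side r S C v : side S C -> tail r C -> tail r (reach G S v) -> C v.
Proof.
  intros Sd H H'. destruct (tail_ex2 H H') as (x & R & R').
  apply (side_reach Sd R). apply reach_sym; auto.
Qed.

Lemma tail_side r S C : isend r -> finite_set S -> side S C ->
  tail r C \/ tail r (fun x => ~ C x /\ ~ S x).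
Proof.
  intros E F Sd. destruct (E S F) as (v & T). destruct (classic (C v)) as [Cv | Nv].
  - left. revert T. apply tail_mono. intros x. apply (side_reach Sd Cv).
  - right. revert T. apply tail_mono. intros x R.
    apply (side_reach (side_compl Sd) (x := v)); auto. split; auto. apply (reach_notin_l R).
Qed.

Lemma tail_avoid r S : isend r -> finite_set S -> tail r (fun x => ~ S x).
Proof.
  intros E F. destruct (E S F) as (v & T). revert T. apply tail_mono. apply reach_notin_r.
Qed.

Definition sep S (r r' : nat -> V) :=
  exists v v', tail r (reach G S v) /\ tail r' (reach G S v') /\ ~ reach G S v v'.

Lemma sep_sym S r r' : sep S r r' -> sep S r' r.
Proof.
  intros (v & v' & H & H' & N). exists v', v. split; auto. split; auto.
  intro R. apply N, reach_sym; auto.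
Qed.

Lemma sep_side S C r r' : isend r -> isend r' -> finite_set S -> side S C ->
  tail r C -> tail r' (fun x => ~ C x) -> sep S r r'.
Proof.
  intros E E' F Sd T T'. destruct (E S F) as (v & Hv), (E' S F) as (v' & Hv').
  exists v, v'. split; auto. split; auto. intro R.
  pose proof (tail_reach_side Sd T Hv) as Cv.
  destruct (tail_ex2 T' Hv') as (x & Nx & Rx). apply Nx.
  apply (side_reach Sd Cv). eapply reach_trans; eauto.
Qed.

Lemma nsep_same S r r' v : isend r' -> finite_set S -> ~ sep S r r' ->
  tail r (reach G S v) -> tail r' (reach G S v).
Proof.
  intros E F N H. destruct (E S F) as (v' & H'). apply (tail_comp H').
  apply NNPP. intro Nr. apply N. exists v, v'. split; auto. split; auto.
  intro R. apply Nr, reach_sym; auto.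
Qed.

Lemma sep_not_same S r r' v : sep S r r' -> tail r (reach G S v) -> ~ tail r' (reach G S v).
Proof.
  intros (a & b & Ha & Hb & N) H H'. apply N. apply reach_trans with v.
  - apply (tail_same Ha H).
  - apply (tail_same H' Hb).
Qed.

Lemma sep_tail S r r' v : sep S r r' -> tail r (reach G S v) ->
  tail r' (fun x => ~ reach G S v x).
Proof.
  intros (a & b & Ha & Hb & N) T. revert Hb. apply tail_mono. intros x R Rv. apply N.
  apply reach_trans with v; [apply (tail_same Ha T) |].
  apply reach_trans with x; auto. apply reach_sym; auto.
Qed.

(** * Separators of least order *)

Definition eff k (r r' : nat -> V) :=
  isend r /\ isend r' /\ (exists S, has_card S k /\ sep S r r') /\
  forall S j, has_card S j -> sep S r r' -> k <= j.

Lemma eff_sym k r r' : eff k r r' -> eff k r' r.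
Proof.
  intros (E & E' & (S & H & P) & M). split; auto. split; auto. split.
  - exists S. split; auto. apply sep_sym; auto.
  - intros T j HT P'. apply (M T j HT). apply sep_sym; auto.
Qed.

Lemma eff_exists S r r' : isend r -> isend r' -> finite_set S -> sep S r r' ->
  exists k, eff k r r'.
Proof.
  intros E E' (n & Hn) P.
  destruct (@finite_min (fun k => exists S, has_card S k /\ sep S r r')) as (k & (T & HT & PT) & M).
  { exists n, S. auto. }
  exists k. split; auto. split; auto. split; [exists T; auto |].
  intros U j HU PU. apply M. exists U; auto.
Qed.

Lemma eff_unique k k' r r' : eff k r r' -> eff k' r r' -> k = k'.
Proof.
  intros (_ & _ & (S & H & P) & M) (_ & _ & (S' & H' & P') & M').
  pose proof (M _ _ H' P'). pose proof (M' _ _ H P). lia.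
Qed.

Definition isfull S C := forall s, S s -> exists c, C c /\ adj G s c.

(** If [s] had no neighbour in the component of [r], that component would still be a side of
    [S - s], and the smaller set [S - s] would separate the two ends. *)
Lemma full_of_eff k S r r' v : eff k r r' -> has_card S k -> sep S r r' ->
  tail r (reach G S v) -> isfull S (reach G S v).
Proof.
  intros (E & E' & _ & M) H P T s Ss. apply NNPP. intro N.
  destruct k as [|k]; [apply (card0 H Ss) |].
  set (S' := fun x => S x /\ x <> s).
  assert (H' : has_card S' k) by apply (card_remove H Ss).
  assert (Sd : side S' (reach G S v)).
  { split; [intros x R (Sx & _); apply (reach_notin_r R Sx) |].
    intros x y R A Ny. apply (reach_next R A). intro Sy.
    apply Ny. split; auto. intros ->. apply N. exists x. split; auto. apply adj_sym; auto. }
  assert (P' : sep S' r r').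
  { apply (sep_side E E' (finite_card H') Sd T).
    destruct P as (a & b & Ha & Hb & Nr). revert Hb. apply tail_mono. intros x Rb Rv.
    apply Nr. apply reach_trans with v; [apply (tail_same Ha T) |].
    apply reach_trans with x; auto. apply reach_sym; auto. }
  pose proof (M _ _ H' P'). lia.
Qed.

(** * Finitely many tight separators *)

(** The list holds the vertices of one walk; only sets meeting this list can destroy the
    connection. *)
Lemma reach_path F x y : reach G F x y ->
  exists l, forall T, (forall v, In v l -> ~ T v) -> reach G (fun z => F z \/ T z) x y.
Proof.
  intro R. pattern y. apply (reach_ind (S := F) (x := x)); auto.
  - exists [x]. intros T N. apply reach_refl. intros [Fx | Tx].
    + apply (reach_notin_l R Fx).
    + apply (N x); simpl; auto.
  - intros u v _ Nu (l & Hl) A Nv. exists (v :: l). intros T N.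
    apply reach_next with u; auto.
    + apply Hl. intros w Hw. apply N; simpl; auto.
    + intros [Fv | Tv]; auto. apply (N v); simpl; auto.
Qed.

(** [F] holds the vertices of the separator guessed so far. If [F] does not yet separate [x] from
    [y], then [T] contains a vertex [v] of a fixed walk; [v] moves to [F] and the induction
    hypothesis lists the possible [T - v]. If [F] already separates them, no vertex can remain in
    [T], since its neighbours on both sides would give a connection avoiding [F]. *)
Lemma tight_finite_aux m : forall F x y, exists L, forall T, has_card T m ->
  (forall t, T t -> ~ F t) -> ~ reach G (fun z => F z \/ T z) x y ->
  (forall t, T t -> (exists a, adj G t a /\ reach G (fun z => F z \/ T z) x a) /\
                    (exists b, adj G t b /\ reach G (fun z => F z \/ T z) y b)) -> In T L.
Proof.
  induction m as [|m IH]; intros F x y.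
  - exists [fun _ => False]. intros T H _ _ _. left. apply pred_ext. intro z.
    split; [tauto |]. apply (card0 H).
  - destruct (classic (reach G F x y)) as [R | NR].
    + destruct (reach_path R) as (l & Hl).
      destruct (@list_choice V (V -> Prop) (fun v T => has_card T (S m) /\ T v /\
        (forall t, T t -> ~ F t) /\ ~ reach G (fun z => F z \/ T z) x y /\
        (forall t, T t -> (exists a, adj G t a /\ reach G (fun z => F z \/ T z) x a) /\
                    (exists b, adj G t b /\ reach G (fun z => F z \/ T z) y b)))
        ) with (l := l) as (L & HL).
      * intro v. destruct (IH (fun z => F z \/ z = v) x y) as (L & HL).
        exists (map (fun U z => U z \/ z = v) L). intros T (H & Tv & D & NR & Ad).
        assert (E : (fun z => (F z \/ z = v) \/ (T z /\ z <> v)) = (fun z => F z \/ T z)).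
        { apply pred_ext. intro z. destruct (classic (z = v)) as [-> |]; tauto. }
        apply in_map_iff. exists (fun z => T z /\ z <> v). split.
        { apply pred_ext. intro z. destruct (classic (z = v)) as [-> |]; tauto. }
        apply HL.
        { apply card_remove; auto. }
        { intros t (Tt & Nt) [Ft | ->]; auto. apply (D t); auto. }
        { rewrite E. auto. }
        { rewrite E. intros t (Tt & _). auto. }
      * exists L. intros T H D NT Ad.
        destruct (classic (exists v, In v l /\ T v)) as [(v & Lv & Tv) | N].
        { apply (HL v T Lv). auto. }
        { exfalso. apply NT. apply Hl. intros v Lv Tv. apply N. exists v. auto. }
    + exists []. intros T H D _ Ad. apply NR. destruct (card_pos H) as (t & Tt).
      destruct (Ad t Tt) as ((a & A & Ra) & (b & B & Rb)).
      assert (I : forall z, F z -> F z \/ T z) by tauto.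
      apply reach_trans with t.
      * apply reach_next with a; [| apply adj_sym; auto | auto]. apply (reach_mono I Ra).
      * apply reach_sym. apply reach_next with b; [| apply adj_sym; auto | auto].
        apply (reach_mono I Rb).
Qed.

Definition tight T x y := ~ T x /\ ~ T y /\ ~ reach G T x y /\
  isfull T (reach G T x) /\ isfull T (reach G T y).

(* Halin's lemma, by induction on [m]: [T] meets a fixed [x]-[y] path. *)
Lemma tight_finite m x y : exists L, forall T, has_card T m -> tight T x y -> In T L.
Proof.
  destruct (tight_finite_aux m (fun _ => False) x y) as (L & HL). exists L.
  intros T H (_ & _ & N & Fx & Fy).
  assert (E : (fun z => False \/ T z) = T) by (apply pred_ext; tauto).
  apply HL; auto; rewrite E; auto.
  intros t Tt. destruct (Fx t Tt) as (a & Ra & A), (Fy t Tt) as (b & Rb & B).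
  split; [exists a | exists b]; auto.
Qed.

End Reach.
(** * Nested separators and uncrossing *)

Section Nested.
Variable G : Graph.
Notation V := (vert G).
Implicit Types (S T U X C D A B W : V -> Prop) (x y z : V).

Definition iscomp S C := exists v, ~ S v /\ C = reach G S v.

(* Full components in which an end lives. *)
Definition flc S C := iscomp S C /\ isfull S C /\ exists r, isend r /\ tail r C.

(* Symmetric for sets with at least two full components in which an end lives, see [nest_sym]. *)
Definition nest S T := exists C, flc S C /\ forall x, C x -> ~ T x.

Definition thick S := finite_set S /\ exists C C', flc S C /\ flc S C' /\ C <> C'.

Lemma iscomp_reach S v : ~ S v -> iscomp S (reach G S v).
Proof. exists v. auto. Qed.

Lemma iscomp_at S C x : iscomp S C -> C x -> C = reach G S x.
Proof. intros (v & _ & ->) R. apply reach_eq, R. Qed.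

Lemma iscomp_eq S C C' x : iscomp S C -> iscomp S C' -> C x -> C' x -> C = C'.
Proof. intros H H' Cx Cx'. rewrite (iscomp_at H Cx), (iscomp_at H' Cx'). auto. Qed.

Lemma iscomp_ex S C : iscomp S C -> exists x, C x.
Proof. intros (v & N & ->). exists v. apply reach_refl; auto. Qed.

Lemma iscomp_notin S C x : iscomp S C -> C x -> ~ S x.
Proof. intros (v & N & ->). apply reach_notin_r. Qed.

Lemma iscomp_side S C : iscomp S C -> side S C.
Proof. intros (v & N & ->). apply side_comp. Qed.

Lemma iscomp_shift S T C x y : iscomp S C -> (forall z, C z -> ~ T z) -> C x -> C y -> reach G T x y.
Proof.
  intros H N Cx Cy. rewrite (iscomp_at H Cx) in Cy. apply (reach_shift Cy).
  intros z R. apply N. rewrite (iscomp_at H Cx). auto.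
Qed.

Lemma full_shift S T C x s : iscomp S C -> isfull S C -> (forall z, C z -> ~ T z) ->
  C x -> S s -> ~ T s -> reach G T x s.
Proof.
  intros H F N Cx Ss Ns. destruct (F s Ss) as (c & Cc & A).
  apply reach_next with c; auto; [apply (iscomp_shift H); auto | apply adj_sym; auto].
Qed.

Lemma eff_flc k r r' S v : eff k r r' -> has_card S k -> sep S r r' ->
  tail r (reach G S v) -> flc S (reach G S v).
Proof.
  intros E H P T. split; [| split].
  - apply iscomp_reach. destruct (tail_ex T) as (x & R). apply (reach_notin_l R).
  - apply (full_of_eff E H P T).
  - exists r. split; auto. apply E.
Qed.

Lemma eff_thick k r r' S : eff k r r' -> has_card S k -> sep S r r' -> thick S.
Proof.
  intros E H P. split; [apply (finite_card H) |].
  pose proof P as (v & v' & T & T' & N).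
  exists (reach G S v), (reach G S v'). split; [| split].
  - apply (eff_flc E H P T).
  - apply (eff_flc (eff_sym E) H (sep_sym P) T').
  - intro Q. apply N. rewrite Q. destruct (tail_ex T') as (x & R). apply reach_refl.
    apply (reach_notin_l R).
Qed.

Lemma thick_other S C : thick S -> exists D, flc S D /\ D <> C.
Proof.
  intros (_ & D & D' & H & H' & N). destruct (classic (D = C)) as [-> |]; [| exists D; auto].
  exists D'. auto.
Qed.

(** The component [C] is connected, avoids [T], and every vertex of [S] has a neighbour in it; hence
    [C] and [S - T] lie in one component of [G - T]. *)
Lemma nest_loc S T : nest S T ->
  exists C v, flc S C /\ C v /\ (forall x, C x -> reach G T v x) /\
    forall s, S s -> T s \/ reach G T v s.
Proof.
  intros (C & H & N). destruct (iscomp_ex (proj1 H)) as (v & Cv). exists C, v.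
  split; auto. split; auto. split.
  - intros x Cx. apply (iscomp_shift (proj1 H)); auto.
  - intros s Ss. destruct (classic (T s)); auto. right. destruct H as (H & F & _).
    apply (full_shift H F); auto.
Qed.

(** One of the two full components of [T] is not the component that may meet [S], so it avoids
    [S]. *)
Lemma loc_nest S T v : thick T -> (forall s, S s -> T s \/ reach G T v s) -> nest T S.
Proof.
  intros H L. destruct (@thick_other T (reach G T v) H) as (D & HD & N).
  exists D. split; auto. intros x Dx Sx. apply N. destruct (L x Sx) as [Tx | R].
  - exfalso. apply (iscomp_notin (proj1 HD) Dx Tx).
  - rewrite (iscomp_at (proj1 HD) Dx). symmetry. apply reach_eq; auto.
Qed.

Lemma nest_sym S T : thick T -> nest S T -> nest T S.
Proof. intros H N. destruct (nest_loc N) as (_ & v & _ & _ & _ & L). apply (loc_nest H L). Qed.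

(* [C], [C'] are sides of [S], [T]; this is the set separating [C] intersected with [C']
   from the rest. *)
Definition corner S T C C' : V -> Prop :=
  fun x => (S x /\ (C' x \/ T x)) \/ (T x /\ (C x \/ S x)).

Definition compl S C : V -> Prop := fun x => ~ C x /\ ~ S x.

Lemma corner_side S T C C' : side S C -> side T C' ->
  side (corner S T C C') (fun x => C x /\ C' x).
Proof.
  intros (H1 & H2) (K1 & K2). unfold corner. split.
  - intros x (Cx & Cx'). specialize (H1 x Cx). specialize (K1 x Cx'). tauto.
  - intros x y (Cx & Cx') A N.
    specialize (H2 x y Cx A). specialize (K2 x y Cx' A).
    destruct (classic (S y)), (classic (T y)); tauto.
Qed.

(** Submodularity with equality: two opposite corners have union [S] or [T] and intersection [S] and
    [T]. *)
Lemma corner_card S T C C' k m : side S C -> side T C' -> has_card S k -> has_card T m ->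
  exists a b, has_card (corner S T C C') a /\
    has_card (corner S T (compl S C) (compl T C')) b /\ a + b = k + m.
Proof.
  intros (H1 & _) (K1 & _) HS HT.
  destruct (card_union_inter HS HT) as (u & i & Hu & Hi & E).
  set (X := corner S T C C'). set (X' := corner S T (compl S C) (compl T C')).
  assert (L : forall x, X x -> S x \/ T x) by (unfold X, corner; tauto).
  assert (L' : forall x, X' x -> S x \/ T x) by (unfold X', corner; tauto).
  destruct (card_sub Hu L) as (a & Ha & _), (card_sub Hu L') as (b & Hb & _).
  exists a, b. split; auto. split; auto.
  destruct (card_union_inter Ha Hb) as (u' & i' & Hu' & Hi' & E').
  assert (u' = u).
  { apply (card_unique Hu'). revert Hu. apply card_ext. intro x. unfold X, X', corner, compl.
    specialize (H1 x). specialize (K1 x).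
    destruct (classic (S x)), (classic (T x)), (classic (C x)), (classic (C' x)); tauto. }
  assert (i' = i).
  { apply (card_unique Hi'). revert Hi. apply card_ext. intro x. unfold X, X', corner, compl.
    specialize (H1 x). specialize (K1 x). tauto. }
  lia.
Qed.

(** The corner at [C] and [C'] contains a tail of [r1] but not of [r2], so [X] has at least [k]
    elements; the opposite corner separates [p1] from [p2], so [X'] has at least [m]. As the sizes
    add up to [k + m], both bounds are attained. Each corner set lies in [T] and one side of it, so
    the component of [p1] or of [p2] on the other side witnesses nestedness with [T]. *)
Lemma uncross k m r1 r2 p1 p2 S T C C' :
  eff k r1 r2 -> has_card S k ->
  eff m p1 p2 -> has_card T m -> sep T p1 p2 ->
  side S C -> side T C' -> tail r1 C -> tail r1 C' -> tail r2 (fun x => ~ C x) ->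
  tail p1 (fun x => ~ C x) -> tail p1 (fun x => ~ C' x) -> tail p2 C' ->
  let X := corner S T C C' in
  let X' := corner S T (compl S C) (compl T C') in
  has_card X k /\ sep X r1 r2 /\ has_card X' m /\ sep X' p1 p2 /\ nest T X /\ nest T X'.
Proof.
  intros E HS E' HT PT SC TC R1 R1' R2 P1 P1' P2 X X'.
  destruct (corner_card SC TC HS HT) as (a & b & Ha & Hb & Eab). fold X in Ha. fold X' in Hb.
  assert (P1c : tail p1 (compl S C)).
  { apply tail_and; auto. apply tail_avoid; [apply E' | apply (finite_card HS)]. }
  assert (P1c' : tail p1 (compl T C')).
  { apply tail_and; auto. apply tail_avoid; [apply E' | apply (finite_card HT)]. }
  assert (SX : sep X r1 r2).
  { apply (sep_side (C := fun x => C x /\ C' x)); try apply E; try apply (finite_card Ha).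
    - apply corner_side; auto.
    - apply tail_and; auto.
    - revert R2. apply tail_mono. tauto. }
  assert (SX' : sep X' p1 p2).
  { apply (sep_side (C := fun x => compl S C x /\ compl T C' x));
      try apply E'; try apply (finite_card Hb).
    - apply corner_side; apply side_compl; auto.
    - apply tail_and; auto.
    - revert P2. apply tail_mono. unfold compl. tauto. }
  pose proof (proj2 (proj2 (proj2 E)) _ _ Ha SX).
  pose proof (proj2 (proj2 (proj2 E')) _ _ Hb SX').
  assert (a = k) by lia. assert (b = m) by lia. subst a b.
  split; auto. split; auto. split; auto. split; auto.
  pose proof PT as (v1 & v2 & T1 & T2 & N). split.
  - exists (reach G T v1). split; [apply (eff_flc E' HT PT T1) |].
    pose proof (tail_reach_side (side_compl TC) P1c' T1) as V1.
    intros x Rx. pose proof (side_reach (side_compl TC) V1 Rx) as (Nx & Nx').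
    unfold X, corner. tauto.
  - exists (reach G T v2). split; [apply (eff_flc (eff_sym E') HT (sep_sym PT) T2) |].
    pose proof (tail_reach_side TC P2 T2) as V2.
    intros x Rx. pose proof (side_reach TC V2 Rx) as Cx. pose proof (proj1 TC x Cx).
    unfold X', corner, compl. tauto.
Qed.

(** [X] replaces [S] for the pair [r1], [r2], and [X'] replaces [T] for the pair [p1], [p2]. The
    last clause remembers the shape of the corners for comparing crossings with third sets. *)
Definition uncrossing k m (r1 r2 p1 p2 : nat -> V) S T X X' :=
  has_card X k /\ sep X r1 r2 /\ has_card X' m /\ sep X' p1 p2 /\ nest T X /\ nest T X' /\
  exists C C', side S C /\ side T C' /\ X = corner S T C C' /\
    X' = corner S T (compl S C) (compl T C').

Lemma uncross_unseparated_aux k m r1 r2 p1 p2 S T e :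
  eff k r1 r2 -> has_card S k -> sep S r1 r2 ->
  eff m p1 p2 -> has_card T m -> sep T p1 p2 ->
  tail r1 (reach G T e) -> ~ tail p1 (reach G T e) ->
  (exists v, tail r1 (reach G S v) /\ ~ tail p1 (reach G S v)) ->
  exists X X', uncrossing k m r1 r2 p1 p2 S T X X'.
Proof.
  intros E HS PS E' HT PT Te Tn (a & Ta & Np).
  destruct (proj1 E' T (finite_card HT)) as (b & Tb).
  assert (Nb : forall x, reach G T e x -> ~ reach G T b x).
  { intros x R R'. apply Tn. apply (tail_comp Tb). apply reach_trans with x; auto.
    apply reach_sym; auto. }
  (* [C'] is what lies beyond the component of [T] containing [p1]: it contains tails of [r1] and of
     [p2]. *)
  pose (C := reach G S a). pose (C' := compl T (reach G T b)).
  assert (SC : side S C) by apply side_comp.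
  assert (TC : side T C') by apply side_compl, side_comp.
  exists (corner S T C C'), (corner S T (compl S C) (compl T C')).
  destruct (@uncross k m r1 r2 p1 p2 S T C C') as (H1 & H2 & H3 & H4 & H5 & H6); auto.
  - revert Te. apply tail_mono. intros x R. split; [apply (Nb x R) | apply (reach_notin_r R)].
  - apply (sep_tail PS Ta).
  - destruct (tail_side (proj1 E') (finite_card HS) SC) as [K | K]; [contradiction |].
    revert K. apply tail_mono. tauto.
  - revert Tb. apply tail_mono. unfold C', compl. tauto.
  - destruct (tail_side (proj1 (proj2 E')) (finite_card HT) (side_comp T b)) as [K | K]; auto.
    destruct (sep_not_same PT Tb K).
  - split; auto. split; auto. split; auto. split; auto. split; auto. split; auto.
    exists C, C'. auto.
Qed.

Lemma uncrossing_swap_r k m r1 r2 p1 p2 S T X X' :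
  uncrossing k m r2 r1 p1 p2 S T X X' -> uncrossing k m r1 r2 p1 p2 S T X X'.
Proof. intros (H1 & H2 & H3). split; auto. split; auto. apply sep_sym; auto. Qed.

Lemma uncrossing_swap_p k m r1 r2 p1 p2 S T X X' :
  uncrossing k m r1 r2 p2 p1 S T X X' -> uncrossing k m r1 r2 p1 p2 S T X X'.
Proof.
  intros (H1 & H2 & H3 & H4 & H5). split; auto. split; auto. split; auto. split; auto.
  apply sep_sym; auto.
Qed.

(** Both [r1] and [r2] live in one component of [G - T], and at least one of [p1], [p2] does not.
    That end misses the component of [r1] or the component of [r2] in [G - S], because these differ.
    After renaming within the pairs this is the situation of the auxiliary lemma. *)
Lemma uncross_unseparated k m r1 r2 p1 p2 S T :
  eff k r1 r2 -> has_card S k -> sep S r1 r2 ->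
  eff m p1 p2 -> has_card T m -> sep T p1 p2 -> ~ sep T r1 r2 ->
  exists X X', uncrossing k m r1 r2 p1 p2 S T X X'.
Proof.
  intros E HS PS E' HT PT NT.
  destruct (proj1 E T (finite_card HT)) as (e & Te).
  pose proof (nsep_same (proj1 (proj2 E)) (finite_card HT) NT Te) as Te2.
  pose proof PS as (a1 & a2 & Ta1 & Ta2 & Na).
  assert (K : forall p, isend p -> (exists v, tail r1 (reach G S v) /\ ~ tail p (reach G S v)) \/
                (exists v, tail r2 (reach G S v) /\ ~ tail p (reach G S v))).
  { intros p Ep. destruct (classic (tail p (reach G S a1))) as [P | P].
    - right. exists a2. split; auto. intro Q. apply Na. apply (tail_same P Q).
    - left. exists a1. auto. }
  assert (Aux : forall q1 q2, eff m q1 q2 -> sep T q1 q2 -> ~ tail q1 (reach G T e) ->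
     exists X X', uncrossing k m r1 r2 q1 q2 S T X X').
  { intros q1 q2 Eq Pq Nq. destruct (K q1 (proj1 Eq)) as [Kq | Kq].
    - apply (@uncross_unseparated_aux k m r1 r2 q1 q2 S T e); auto.
    - destruct (@uncross_unseparated_aux k m r2 r1 q1 q2 S T e) as (X & X' & H); auto.
      + apply eff_sym; auto.
      + apply sep_sym; auto.
      + exists X, X'. apply uncrossing_swap_r; auto. }
  destruct (classic (tail p1 (reach G T e))) as [P | P]; [| apply Aux; auto].
  destruct (Aux p2 p1) as (X & X' & H).
  - apply eff_sym; auto.
  - apply sep_sym; auto.
  - apply (sep_not_same PT P).
  - exists X, X'. apply uncrossing_swap_p; auto.
Qed.

(** The corners are the common side of [r1] and the opposite one. The second pair is listed as [r2],
    [r1] because [uncross] wants its first end outside both sides. *)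
Lemma uncross_separated k r1 r2 S T :
  eff k r1 r2 -> has_card S k -> sep S r1 r2 -> has_card T k -> sep T r1 r2 ->
  exists X X', uncrossing k k r1 r2 r2 r1 S T X X'.
Proof.
  intros E HS PS HT PT. pose proof PS as (a & _ & Ta & _). pose proof PT as (b & _ & Tb & _).
  exists (corner S T (reach G S a) (reach G T b)),
    (corner S T (compl S (reach G S a)) (compl T (reach G T b))).
  assert (SC := side_comp S a). assert (TC := side_comp T b).
  pose proof (sep_tail PS Ta). pose proof (sep_tail PT Tb).
  destruct (@uncross k k r1 r2 r2 r1 S T (reach G S a) (reach G T b))
    as (H1 & H2 & H3 & H4 & H5 & H6); auto using eff_sym, sep_sym.
  split; auto. split; auto. split; auto. split; auto. split; auto. split; auto.
  eexists _, _. split; [apply SC | split; [apply TC | split; reflexivity]].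
Qed.

(** Outside [U], each of [S] and [T] lies in a single component of [G - U]. If these components
    differed, a full component of [T] inside the second would avoid [S], and [S], [T] would be
    nested. So [X] stays within [U] and one component. *)
Lemma nest_union S T U X : thick S -> thick T -> thick U -> ~ nest S T ->
  nest U S -> nest U T -> (forall x, X x -> S x \/ T x) -> nest U X.
Proof.
  intros HS HT HU N NS NT HX.
  destruct (nest_loc (nest_sym HS NS)) as (_ & v & _ & _ & _ & L).
  destruct (nest_loc (nest_sym HT NT)) as (F & w & HF & Fw & RF & L').
  destruct (classic (reach G U v w)) as [R | R].
  - apply (@loc_nest X U v HU). intros x Xx. destruct (HX x Xx) as [Sx | Tx]; auto.
    destruct (L' x Tx); auto. right. apply reach_trans with w; auto.
  - exfalso. apply N, nest_sym; auto. exists F. split; auto.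
    intros x Fx Sx. specialize (RF x Fx). destruct (L x Sx) as [Ux | R'].
    + apply (reach_notin_r RF Ux).
    + apply R. apply reach_trans with x; auto. apply reach_sym; auto.
Qed.

(** A full component of [U] that avoids [S] is either contained in [C], where it avoids [X'], or
    disjoint from [C], where it avoids [X]. *)
Lemma nest_either S U C X X' : side S C -> nest U S ->
  (forall x, X x -> S x \/ C x) -> (forall x, X' x -> ~ C x) -> nest U X \/ nest U X'.
Proof.
  intros SC (D & HD & N) HX HX'.
  destruct (classic (exists x, D x /\ C x)) as [(x & Dx & Cx) | NC].
  - right. exists D. split; auto. intros y Dy X'y. apply (HX' y X'y).
    apply (side_reach SC Cx). apply (iscomp_shift (proj1 HD) N Dx Dy).
  - left. exists D. split; auto. intros y Dy Xy. destruct (HX y Xy); [apply (N y); auto |].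
    apply NC. exists y. auto.
Qed.

(** Passing from [S], [T] to their corners creates no crossing with a third set, counted with
    multiplicity. *)
Lemma uncrossing_nest k m r1 r2 p1 p2 S T X X' U :
  uncrossing k m r1 r2 p1 p2 S T X X' -> thick S -> thick T -> thick U -> ~ nest S T ->
  (nest U S -> nest U T -> nest U X /\ nest U X') /\
  (nest U S \/ nest U T -> nest U X \/ nest U X').
Proof.
  intros (_ & _ & _ & _ & _ & _ & C & C' & SC & TC & -> & ->) HS HT HU N.
  pose proof (proj1 SC) as S1. pose proof (proj1 TC) as T1. split.
  - intros NS NT. split; apply (@nest_union S T U); auto; unfold corner; tauto.
  - intros [NS | NT].
    + apply (@nest_either S U C); auto; unfold corner, compl; intro x; specialize (S1 x); tauto.
    + apply (@nest_either T U C'); auto; unfold corner, compl; intro x; specialize (T1 x); tauto.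
Qed.

(** Each of two full components of a crossing [T] meets [S], so [T] is a tight separator of two
    vertices of the finite set [S]. *)
Lemma crossing_finite m S : finite_set S ->
  exists L, forall T, has_card T m -> thick T -> ~ nest T S -> In T L.
Proof.
  intros F. destruct (list_finite F) as (l & Hl).
  destruct (@list_choice (V * V) (V -> Prop)
    (fun p T => has_card T m /\ tight T (fst p) (snd p))) with (l := list_prod l l) as (L & HL).
  { intros (x & y). destruct (tight_finite m x y) as (L & HL). exists L. intros T (H & Ht). auto. }
  exists L. intros T HT (_ & D & D' & HD & HD' & NE) N.
  assert (M : forall C, flc T C -> exists x, C x /\ S x).
  { intros C HC. apply NNPP. intro Nx. apply N. exists C. split; auto.
    intros x Cx Sx. apply Nx. exists x. auto. }
  destruct (M D HD) as (x & Dx & Sx), (M D' HD') as (y & Dy & Sy).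
  apply (HL (x, y)).
  - apply in_prod; apply Hl; auto.
  - split; auto. simpl.
    destruct HD as (CD & FD & _), HD' as (CD' & FD' & _).
    rewrite (iscomp_at CD Dx) in FD. rewrite (iscomp_at CD' Dy) in FD'.
    split; [apply (iscomp_notin CD Dx) | split; [apply (iscomp_notin CD' Dy) |]].
    split; auto. intro R. apply NE. rewrite (iscomp_at CD Dx), (iscomp_at CD' Dy).
    apply reach_eq; auto.
Qed.

(** * The canonical nested set of efficient separators *)

Implicit Types (N : (V -> Prop) -> Prop).

(** [N] stands for the sets chosen at smaller orders. *)
Definition cand N k r r' S :=
  has_card S k /\ sep S r r' /\ forall U, N U -> nest U S.

Definition cands N k S := exists r r', eff k r r' /\ cand N k r r' S.

Definition crossnum N k S n := has_card (fun U => cands N k U /\ ~ nest U S) n.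

(** The minimum is taken for each pair of ends separately, whereas crossings are counted against the
    candidates of all pairs. Keeping every minimiser makes the choice invariant under
    isomorphisms. *)
Definition opt N k S := exists r r' n, eff k r r' /\ cand N k r r' S /\ crossnum N k S n /\
  forall S' n', cand N k r r' S' -> crossnum N k S' n' -> n <= n'.

Fixpoint below k : (V -> Prop) -> Prop :=
  match k with
  | 0 => fun _ => False
  | S k => fun S => below k S \/ opt (below k) k S
  end.

Lemma cands_thick N k S : cands N k S -> thick S.
Proof. intros (r & r' & E & H & P & _). apply (eff_thick E H P). Qed.

Lemma crossnum_exists N k S : finite_set S -> exists n, crossnum N k S n.
Proof.
  intros F. destruct (crossing_finite k F) as (L & HL).
  apply (@finite_list _ _ L). intros U (H & NU). apply HL; auto; [| apply (cands_thick H)].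
  destruct H as (r & r' & _ & H & _). auto.
Qed.

(** Double counting: a candidate crossing one corner crosses [S] or [T], and one crossing both
    corners crosses both. The set [U], which crosses [S] or [T] but neither corner, makes the
    inequality strict. *)
Lemma uncrossing_crossnum N k r1 r2 p1 p2 S T X X' U n n' m m' :
  uncrossing k k r1 r2 p1 p2 S T X X' -> thick S -> thick T -> ~ nest S T ->
  (cands N k U /\ ~ nest U S \/ cands N k U /\ ~ nest U T) -> nest U X -> nest U X' ->
  crossnum N k S n -> crossnum N k T n' -> crossnum N k X m -> crossnum N k X' m' ->
  m + m' < n + n'.
Proof.
  intros H HS HT NST HU NX NX' Cn Cn' Cm Cm'.
  destruct (card_union_inter Cn Cn') as (u & i & Hu & Hi & E).
  destruct (card_union_inter Cm Cm') as (u' & i' & Hu' & Hi' & E').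
  assert (i' <= i).
  { apply (card_le Hi Hi'). intros Y ((CY & NY) & _ & NY').
    pose proof (uncrossing_nest H HS HT (cands_thick CY) NST) as (_ & K).
    tauto. }
  assert (u' < u); [| lia].
  apply (card_lt (a := U) Hu Hu'); [| exact HU | tauto].
  intros Y HY. assert (CY : cands N k Y) by tauto.
  pose proof (uncrossing_nest H HS HT (cands_thick CY) NST) as (K & _). tauto.
Qed.

Lemma uncrossing_cand N k r1 r2 p1 p2 S T X X' :
  (forall U, N U -> thick U) ->
  uncrossing k k r1 r2 p1 p2 S T X X' -> thick S -> thick T -> ~ nest S T ->
  (forall U, N U -> nest U S) -> (forall U, N U -> nest U T) ->
  cand N k r1 r2 X /\ cand N k p1 p2 X'.
Proof.
  intros HN H HS HT NST NS NT. pose proof H as (H1 & H2 & H3 & H4 & _).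
  split; (split; [| split]); auto; intros U NU;
    pose proof (uncrossing_nest H HS HT (HN U NU) NST) as (K & _);
    apply K; auto.
Qed.

(** Were [S] and [T] crossing, their corners would be candidates for the two pairs. [T] itself
    crosses [S] and is nested with both corners, so the total number of crossings drops and one of
    the two minima is beaten. *)
Lemma opt_nest_unseparated N k r1 r2 p1 p2 S T n m :
  (forall U, N U -> thick U) ->
  eff k r1 r2 -> eff k p1 p2 -> cand N k r1 r2 S -> cand N k p1 p2 T ->
  crossnum N k S n -> crossnum N k T m ->
  (forall S' n', cand N k r1 r2 S' -> crossnum N k S' n' -> n <= n') ->
  (forall S' n', cand N k p1 p2 S' -> crossnum N k S' n' -> m <= n') ->
  ~ sep T r1 r2 -> nest S T.
Proof.
  intros HN E E' CS CT Cn Cm Mn Mm NT. apply NNPP. intro NST.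
  pose proof CS as (HS & PS & NS). pose proof CT as (HT & PT & NT').
  assert (ThS := eff_thick E HS PS). assert (ThT := eff_thick E' HT PT).
  destruct (uncross_unseparated E HS PS E' HT PT NT) as (X & X' & H).
  destruct (uncrossing_cand HN H ThS ThT NST NS NT') as (CX & CX').
  destruct (crossnum_exists N k (finite_card (proj1 CX))) as (a & Ha).
  destruct (crossnum_exists N k (finite_card (proj1 CX'))) as (b & Hb).
  assert (a + b < n + m).
  { apply (uncrossing_crossnum (N := N) (U := T) H ThS ThT NST); try apply H; auto.
    left. split; [exists p1, p2; auto |]. intro Q. apply NST, nest_sym; auto. }
  pose proof (Mn _ _ CX Ha). pose proof (Mm _ _ CX' Hb). lia.
Qed.

Lemma opt_nest N k S T : (forall U, N U -> thick U) -> opt N k S -> opt N k T -> nest S T.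
Proof.
  intros HN (r1 & r2 & n & E & CS & Cn & Mn) (p1 & p2 & m & E' & CT & Cm & Mm).
  pose proof CS as (HS & PS & NS). pose proof CT as (HT & PT & NT').
  assert (ThS := eff_thick E HS PS). assert (ThT := eff_thick E' HT PT).
  destruct (classic (sep T r1 r2)) as [NT | NT];
    [| apply (@opt_nest_unseparated N k r1 r2 p1 p2 S T n m); auto].
  destruct (classic (sep S p1 p2)) as [NS' | NS'];
    [| apply nest_sym; auto; apply (@opt_nest_unseparated N k p1 p2 r1 r2 T S m n); auto].
  apply NNPP. intro NST.
  destruct (uncross_separated E HS PS HT NT) as (X & X' & H).
  destruct (uncrossing_cand HN H ThS ThT NST NS NT') as (CX & CX').
  destruct (crossnum_exists N k (finite_card (proj1 CX))) as (a & Ha).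
  destruct (crossnum_exists N k (finite_card (proj1 CX'))) as (b & Hb).
  assert (a + b < n + m).
  { apply (uncrossing_crossnum (N := N) (U := T) H ThS ThT NST); try apply H; auto.
    left. split; [exists p1, p2; auto |]. intro Q. apply NST, nest_sym; auto. }
  (* Now each of [S], [T] separates both pairs, so either is a candidate for the other's pair and
     [n = m]. Both corners are candidates for [r1], [r2], hence have crossing number at least [n]
     each, against [a + b < n + m]. *)
  assert (CT' : cand N k r1 r2 T) by (split; auto).
  assert (CS' : cand N k p1 p2 S) by (split; auto).
  assert (CX2 : cand N k r1 r2 X').
  { destruct CX' as (Q1 & Q2 & Q3). split; auto. split; auto. apply sep_sym; auto. }
  pose proof (Mn _ _ CX Ha). pose proof (Mn _ _ CX2 Hb).
  pose proof (Mn _ _ CT' Cm). pose proof (Mm _ _ CS' Cn). lia.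
Qed.

(** * The recursion over the orders *)

Lemma below_eff k S : below k S ->
  exists j r r', j < k /\ opt (below j) j S /\ eff j r r' /\ has_card S j /\ sep S r r'.
Proof.
  induction k as [|k IH]; simpl; [tauto |]. intros [B | O].
  - destruct (IH B) as (j & r & r' & L & H). exists j, r, r'. split; auto.
  - pose proof O as (r & r' & n & E & (H & P & _) & _). exists k, r, r'. auto 6.
Qed.

Lemma below_thick k S : below k S -> thick S.
Proof.
  intro B. destruct (below_eff B) as (j & r & r' & _ & _ & E & H & P). apply (eff_thick E H P).
Qed.

Lemma below_mono j k S : j <= k -> below j S -> below k S.
Proof. induction 1; simpl; auto. Qed.

Lemma opt_thick N k S : opt N k S -> thick S.
Proof. intros (r & r' & n & E & (H & P & _) & _). apply (eff_thick E H P). Qed.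

Lemma opt_below_nest j k S T : opt (below j) j S -> opt (below k) k T -> nest S T.
Proof.
  assert (K : forall j k S T, j < k -> opt (below j) j S -> opt (below k) k T -> nest S T).
  { clear. intros j k S T L O (r & r' & n & _ & (_ & _ & H) & _). apply H.
    apply (@below_mono (1 + j)); auto. simpl. auto. }
  intros O O'. destruct (lt_eq_lt_dec j k) as [[L | ->] | L].
  - eapply K; eauto.
  - apply (@opt_nest (below k) k S T); auto. apply below_thick.
  - apply nest_sym; [apply (opt_thick O) |]. eapply K; eauto.
Qed.

Lemma below_nest k S T : below k S -> below k T -> nest S T.
Proof.
  intros B B'. destruct (below_eff B) as (j & _ & _ & _ & O & _).
  destruct (below_eff B') as (j' & _ & _ & _ & O' & _). apply (opt_below_nest O O').
Qed.

(** Any [k]-set separating the ends is improved step by step. A chosen set [T] crossing it has fewer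
    than [k] elements, so it does not separate [r] from [r'] and the two can be uncrossed. The
    corner is nested with [T] and crosses nothing new, because the sets in [below k] are nested with
    [T]. *)
Lemma cand_exists k r r' : eff k r r' -> exists S, cand (below k) k r r' S.
Proof.
  intro E. pose proof E as (_ & _ & (S0 & H0 & P0) & _).
  assert (F : exists n, has_card (fun U => below k U /\ ~ nest U S0) n).
  { destruct (@list_choice nat (V -> Prop) (fun j U => has_card U j /\ thick U /\ ~ nest U S0))
      with (l := seq 0 k) as (L & HL).
    - intro j. destruct (crossing_finite j (finite_card H0)) as (L & HL). exists L.
      intros U (H1 & H2 & H3). auto.
    - apply (@finite_list _ _ L). intros U (B & NU).
      pose proof (below_eff B) as (j & q & q' & Lj & _ & _ & H & _).
      apply (HL j); [apply in_seq; lia |]. split; auto. split; auto. apply (below_thick B). }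
  destruct F as (n & F). revert S0 H0 P0 F.
  induction n as [n IH] using lt_wf_ind. intros S0 H0 P0 F.
  destruct (classic (exists T, below k T /\ ~ nest T S0)) as [(T & B & NT) | None].
  - pose proof (below_eff B) as (j & q & q' & Lj & _ & Eq & HT & PT).
    assert (NT' : ~ sep T r r').
    { intro Q. pose proof (proj2 (proj2 (proj2 E)) _ _ HT Q). lia. }
    assert (ThS := eff_thick E H0 P0). assert (ThT := below_thick B).
    destruct (uncross_unseparated E H0 P0 Eq HT PT NT') as (X & X' & H).
    assert (NST : ~ nest S0 T) by (intro Q; apply NT, nest_sym; auto).
    assert (Sub : forall U, below k U /\ ~ nest U X -> below k U /\ ~ nest U S0).
    { intros U (BU & NU). split; auto. intro NS. apply NU.
      pose proof (uncrossing_nest H ThS ThT (below_thick BU) NST) as (K & _).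
      apply K; auto. apply (below_nest BU B). }
    destruct (card_sub F Sub) as (n' & Hn' & _).
    apply (IH n') with X; auto; try apply H.
    apply (card_lt (a := T) F Hn' Sub); auto. intros (_ & Q). apply Q, H.
  - exists S0. split; auto. split; auto. intros U BU. apply NNPP. intro NU. apply None. eauto.
Qed.

Theorem opt_exists k r r' : eff k r r' -> exists S, opt (below k) k S /\ has_card S k /\ sep S r r'.
Proof.
  intro E. destruct (cand_exists E) as (S0 & C0).
  destruct (crossnum_exists (below k) k (finite_card (proj1 C0))) as (n0 & Hn0).
  destruct (@finite_min (fun n => exists S, cand (below k) k r r' S /\ crossnum (below k) k S n))
    as (n & (S & C & Cn) & M).
  { exists n0, S0. auto. }
  exists S. split; [| split; apply C].
  exists r, r', n. split; auto. split; auto. split; auto. intros S' n' C' Cn'. apply M. eauto.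
Qed.

End Nested.
(** * Trees *)

Section Trees.
Variables (T : Type) (a : T -> T -> Prop).
Hypothesis a_sym : forall x y, a x y -> a y x.
Hypothesis a_irrefl : forall x, ~ a x x.

Definition bridge s u (b : T -> Prop) :=
  ~ b s /\ b u /\ forall x y, a x y -> ~ b x -> b y -> x = s /\ y = u.

Lemma bridge_sym s u b : bridge s u b -> bridge u s (fun x => ~ b x).
Proof.
  intros (H1 & H2 & H3). split; [tauto | split; auto].
  intros x y A Nx Ny. destruct (H3 y x); auto. apply NNPP; auto.
Qed.

Lemma last_cons (p : list T) y d : last (y :: p) d = last p y.
Proof.
  revert y d. induction p as [|z p IH]; intros y d; auto.
  change (last (y :: z :: p) d) with (last (z :: p) d). rewrite !IH. auto.
Qed.

Lemma chain_app p q : chain a (p ++ q) -> chain a p /\ chain a q.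
Proof.
  induction p as [|x [|y p] IH]; simpl.
  - auto.
  - destruct q; simpl; tauto.
  - intros (A & C). apply IH in C. tauto.
Qed.

Lemma chain_cross (b : T -> Prop) p x : chain a (x :: p) -> b x -> ~ b (last p x) ->
  exists l u v l', x :: p = l ++ u :: v :: l' /\ b u /\ ~ b v /\ a u v.
Proof.
  revert x. induction p as [|y p IH]; intros x C Bx Nl.
  - simpl in Nl. tauto.
  - simpl in C. destruct C as (A & C).
    destruct (classic (b y)) as [By | Ny].
    + destruct (IH y C By) as (l & u & v & l' & E & H).
      { rewrite <- last_cons with (d := x). auto. }
      exists (x :: l), u, v, l'. simpl. rewrite E. auto.
    + exists [], x, y, p. auto.
Qed.


Lemma bridge_in_chain s u b p x : bridge s u b -> chain a (x :: p) -> b x -> ~ b (last p x) ->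
  exists l l', x :: p = l ++ u :: s :: l'.
Proof.
  intros (_ & _ & H) C Bx Nl. destruct (chain_cross C Bx Nl) as (l & y & z & l' & E & By & Nz & A).
  destruct (H z y) as (-> & ->); auto. exists l, l'. auto.
Qed.

(** The closing edge of a cycle would be a bridge; the rest of the cycle must cross it as well, so
    the first and last node occur consecutively, which repeats a node when there are at least
    three. *)
Lemma no_cycle p : (forall s u, a s u -> exists b, bridge s u b) -> ~ is_cycle a p.
Proof.
  intros Br (L & ND & C & x & Hx & A). destruct p as [|x' p]; [discriminate |].
  injection Hx as ->. rewrite last_cons in A. remember (last p x) as s eqn:Es.
  destruct (Br _ _ A) as (b & B).
  pose proof B as (B1 & B2 & _).
  destruct (bridge_in_chain (p := p) (x := x) B C B2) as (l & l' & E); [rewrite <- Es; auto |].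
  destruct l as [|y l].
  - injection E as E. rewrite E in *. rewrite last_cons in Es.
    destruct l' as [|z l']; [simpl in L; lia |].
    rewrite last_cons in Es. inversion ND as [|? ? _ ND']. inversion ND' as [|? ? NI _].
    apply NI. rewrite Es. clear. revert z. induction l' as [|w l' IH]; intro z; [simpl; auto |].
    right. rewrite last_cons. apply IH.
  - injection E as -> E. rewrite E in ND. inversion ND as [|? ? NI _]. apply NI.
    apply in_or_app. simpl. auto.
Qed.

Lemma path_shorten p : forall x y, chain a (x :: p) -> last p x = y -> exists q, is_path a x y q.
Proof.
  induction p as [p IH] using (well_founded_induction (well_founded_ltof _ (@length T))).
  intros x y C L. destruct p as [|z p].
  - exists [x]. simpl in L. subst. split; auto. split; auto. split; simpl; auto.
    repeat constructor; auto.
  - rewrite last_cons in L. simpl in C. destruct C as (A & C).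
    destruct (IH p) with (x := z) (y := y) as (q & Hh & Hl & Hc & Hn); auto.
    { unfold ltof. simpl. lia. }
    destruct q as [|w q]; [discriminate |]. injection Hh as ->.
    destruct (classic (In x (z :: q))) as [I | I].
    + apply in_split in I as (l1 & l2 & E). exists (x :: l2). rewrite E in *.
      split; auto. split; [| split].
      * rewrite last_cons in *. rewrite <- Hl. clear. revert z. 
        induction l1 as [|u l1 IH]; intro z.
        { simpl app. rewrite last_cons. auto. }
        { simpl app. rewrite last_cons. apply IH. }
      * apply chain_app in Hc. apply Hc.
      * apply NoDup_app_remove_l in Hn. auto.
    + exists (x :: z :: q). split; auto. split; [| split].
      * rewrite last_cons in *. rewrite last_cons. auto.
      * simpl. auto.
      * constructor; auto.
Qed.

Lemma path_of_reach x y : clos_refl_trans T a x y -> exists p, is_path a x y p.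
Proof.
  intro R. apply clos_rt_rt1n in R.
  assert (H : exists p, chain a (x :: p) /\ last p x = y).
  { induction R as [x | x z y A R (p & C & L)].
    - exists []. simpl. auto.
    - exists (z :: p). rewrite last_cons. simpl. auto. }
  destruct H as (p & C & L). apply (path_shorten C L).
Qed.

Lemma bridges_tree : inhabited T -> (forall x y, clos_refl_trans T a x y) ->
  (forall s u, a s u -> exists b, bridge s u b) -> is_tree a.
Proof.
  intros I R Br. split; auto. split; auto. split; auto. split.
  - intros x y. apply path_of_reach, R.
  - intro p. apply no_cycle; auto.
Qed.

(** [s] is the predecessor of [t2] on the path; crossing the bridge once more would repeat [s] or
    [t2]. Quantifying over [b] lets each tree insert its own bridge set when [td_T3] is checked. *)
Lemma on_path_bridge t1 t2 t3 : on_path a t1 t2 t3 -> t2 <> t1 ->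
  exists s, a s t2 /\ forall b, bridge s t2 b -> ~ b t1 /\ b t3.
Proof.
  intros (p & (Hh & Hl & Hc & Hn) & I) N.
  destruct p as [|x p]; [discriminate |]. injection Hh as ->. rewrite last_cons in Hl.
  destruct I as [-> | I]; [tauto |]. apply in_split in I as (l1 & l2 & ->).
  assert (E : exists l0 s, t1 :: l1 = l0 ++ [s]).
  { destruct (exists_last (l := t1 :: l1)) as (l0 & s & E); [discriminate |]. eauto. }
  destruct E as (l0 & s & E).
  change (t1 :: l1 ++ t2 :: l2) with ((t1 :: l1) ++ t2 :: l2) in *.
  assert (D : forall z, In z (t1 :: l1) -> ~ In z (t2 :: l2)).
  { intros z I I'. apply in_split in I as (k1 & k2 & Ek). rewrite Ek, <- app_assoc in Hn.
    apply NoDup_app_remove_l in Hn. inversion Hn as [|? ? NI _]. apply NI.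
    apply in_or_app. auto. }
  exists s. split.
  - rewrite E in Hc. rewrite <- app_assoc in Hc. apply chain_app in Hc as (_ & Hc).
    simpl in Hc. tauto.
  - intros b B. apply chain_app in Hc as (C1 & C2). pose proof B as (Bs & Bt & _). split.
    + intro B1. assert (L : last l1 t1 = s).
      { rewrite <- (last_cons l1 t1 t1), E. apply last_last. }
      destruct (bridge_in_chain B C1 B1) as (m & m' & F); [rewrite L; auto |].
      apply (D t2); [rewrite F; apply in_or_app |]; simpl; auto.
    + apply NNPP. intro N3. rewrite <- Hl in N3.
      assert (L : last (l1 ++ t2 :: l2) t1 = last l2 t2).
      { clear. revert t1. induction l1 as [|u l1 IH]; intro z; simpl app; rewrite last_cons; auto. }
      rewrite L in N3. destruct (bridge_in_chain B C2 Bt N3) as (m & m' & F).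
      apply (D s); [rewrite E | rewrite F]; apply in_or_app; simpl; auto.
Qed.

(** The relation on the left is that of [tside], so the separations induced by an edge can be read
    off from its bridge set. *)
Lemma bridge_sides s u b : bridge s u b -> (forall x y, clos_refl_trans T a x y) ->
  forall t, clos_refl_trans T (fun x y => a x y /\ ~ ((x = s /\ y = u) \/ (x = u /\ y = s))) s t
    <-> ~ b t.
Proof.
  intros B R t. pose proof B as (Bs & Bu & H). split.
  - intro C. apply clos_rt_rtn1 in C. induction C as [|y z (A & N) _ IH]; auto.
  - revert t.
    assert (K : forall t,
      (~ b t -> clos_refl_trans T (fun x y => a x y /\ ~ ((x = s /\ y = u) \/ (x = u /\ y = s))) s t)
      /\ (b t -> clos_refl_trans T (fun x y => a x y /\ ~ ((x = s /\ y = u) \/ (x = u /\ y = s))) u t)).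
    { intro t. pose proof (R s t) as C. apply clos_rt_rtn1 in C.
      induction C as [|y z A _ (IH1 & IH2)].
      - split; [intros; apply rt_refl | tauto].
      - destruct (classic (b y)) as [By | Ny], (classic (b z)) as [Bz | Nz];
          (split; intro Q; [try contradiction | try contradiction]).
        + apply rt_trans with y; auto. apply rt_step. split; auto.
          intros [(-> & ->) | (-> & ->)]; contradiction.
        + destruct (H z y) as (-> & ->); auto. apply rt_refl.
        + destruct (H y z) as (-> & ->); auto. apply rt_refl.
        + apply rt_trans with y; auto. apply rt_step. split; auto.
          intros [(-> & ->) | (-> & ->)]; contradiction. }
    intros t Nt. apply K, Nt.
Qed.

End Trees.

(** * The tree of a nested set of separators

   [sg S T] is the direction of [S] in which [T] lies and [dirs S] are the directions at [S].
   Between the separators sit the regions, orientations that point towards a common place. *)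

Section NestTree.
Variables (I D : Type) (sg : I -> I -> D) (dirs : I -> D -> Prop).
Hypothesis sg_dirs : forall S T, S <> T -> dirs S (sg S T).
(** If [U] lies between [S] and [X], then [X] sees [S] and [U] in the same direction. *)
Hypothesis sg_triangle : forall S U X, X <> U -> S <> U -> S <> X ->
  sg U S <> sg U X -> sg X S = sg X U.
Hypothesis sg_finite : forall S T, S <> T ->
  finite_set (fun U => U <> S /\ U <> T /\ sg U S <> sg U T).

Definition orient S C : I -> D := fun T => if dec (T = S) then C else sg T S.

(** A region is an orientation as it appears from some separator facing it; being a function, it is
    a single node even if several separators face it. Orientations towards an end of the tree do not
    have this form. When there are no separators, the only function on the empty type serves as the
    single region. *)
Definition region (p : I -> D) := (exists S C, dirs S C /\ p = orient S C) \/ (I -> False).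

Definition bnode := (I + {p | region p})%type.

Definition badj (x y : bnode) : Prop :=
  match x, y with
  | inl T, inr p => exists C, dirs T C /\ proj1_sig p = orient T C
  | inr p, inl T => exists C, dirs T C /\ proj1_sig p = orient T C
  | _, _ => False
  end.

Definition bside S C (x : bnode) : Prop :=
  match x with
  | inl T => T <> S /\ sg S T = C
  | inr p => proj1_sig p S = C
  end.

Lemma orient_self S C : orient S C S = C.
Proof. unfold orient. destruct (dec (S = S)); tauto. Qed.

Lemma orient_other S C T : T <> S -> orient S C T = sg T S.
Proof. unfold orient. destruct (dec (T = S)); tauto. Qed.

Lemma badj_sym x y : badj x y -> badj y x.
Proof. destruct x, y; simpl; auto. Qed.

Lemma badj_irrefl x : ~ badj x x.
Proof. destruct x; simpl; auto. Qed.

Lemma bnode_eq (p q : {p | region p}) : proj1_sig p = proj1_sig q -> p = q.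
Proof. destruct p as (p & Hp), q as (q & Hq). simpl. intros ->. f_equal. apply proof_irrelevance. Qed.

Lemma bside_iff S C T q : badj (inl T) (inr q) -> T <> S ->
  bside S C (inl T) <-> bside S C (inr q).
Proof.
  intros (C' & H & E) N. simpl. rewrite E, orient_other; auto. tauto.
Qed.

(** A region adjacent to some [T] other than [S] points at [S] in the direction of [T], so this edge
    stays on one side of [S]. Among the regions at [S], only [orient S C] belongs to direction
    [C]. *)
Lemma bside_bridge S C p : dirs S C -> proj1_sig p = orient S C ->
  bridge badj (inl S) (inr p) (bside S C).
Proof.
  intros H E. split; [simpl; tauto | split].
  - simpl. rewrite E. apply orient_self.
  - intros [T | q] [T' | q']; simpl badj; try tauto; intros A NB B.
    + destruct (classic (T = S)) as [-> | N].
      * split; auto. f_equal. apply bnode_eq. simpl in B. destruct A as (C' & _ & E').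
        rewrite E' in B. rewrite orient_self in B. subst C'. congruence.
      * exfalso. apply NB, (bside_iff _ A N), B.
    + exfalso. apply NB. apply (bside_iff (T := T') _ A); auto. apply B.
Qed.

Definition consistent (q : I -> D) := forall U X, U <> X -> q U <> sg U X -> q X = sg X U.

(* The nodes that separate [S] from the place where [q] points to. *)
Definition between S (q : I -> D) : I -> Prop := fun T => T <> S /\ q T <> sg T S.

Lemma between_sub q S T X : consistent q -> between S q T -> between T q X -> between S q X.
Proof.
  intros Cq (N & H) (N' & H'). assert (E : q T = sg T X) by (apply Cq; auto).
  assert (NX : X <> S) by (intros ->; auto).
  split; auto. intro Q. apply H'. rewrite Q. apply sg_triangle; auto. congruence.
Qed.

(** Moving from [S] to a separator between [S] and [q] strictly decreases the finite set of
    separators in between, so the walk ends at one facing [q]. [Z] is a property handed on at each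
    move. *)
Lemma descent q S (Z : I -> Prop) : consistent q -> finite_set (between S q) -> Z S ->
  (forall T X, Z T -> between T q X -> Z X) -> exists T, Z T /\ forall X, ~ between T q X.
Proof.
  intros Cq (n & F) ZS HZ. revert S F ZS. induction n as [n IH] using lt_wf_ind. intros S F ZS.
  destruct (classic (exists T, between S q T)) as [(T & B) | N].
  - destruct (@card_sub _ _ (between T q) _ F) as (m & Hm & _).
    { intros X. apply between_sub; auto. }
    apply (IH m) with T; auto; [| eauto].
    apply (card_lt (a := T) F Hm); auto; [intro X; apply between_sub; auto |].
    intros (Q & _). auto.
  - exists S. split; auto. intros X B. apply N. eauto.
Qed.

Lemma between_none q T : (forall X, ~ between T q X) -> q = orient T (q T).
Proof.
  intro H. apply functional_extensionality. intro X. unfold orient.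
  destruct (dec (X = T)) as [-> | N]; auto. apply NNPP. intro Q. apply (H X). split; auto.
Qed.

Lemma region_consistent p : region p -> consistent p.
Proof.
  intros [(S & C & HC & ->) | F]; [| intro U; destruct (F U)].
  intros U X N. unfold orient. destruct (dec (U = S)) as [-> |], (dec (X = S)) as [-> |]; try tauto.
  intros Q. apply sg_triangle; auto.
Qed.

Lemma region_between p T : region p -> finite_set (between T p).
Proof.
  intros [(S & C & HC & ->) | F]; [| destruct (F T)].
  destruct (classic (S = T)) as [-> | N].
  - apply finite_list with []. intros X (NX & Q). apply Q, orient_other; auto.
  - apply (finite_sub (A := fun X => (X <> S /\ X <> T /\ sg X S <> sg X T) \/ X = S)).
    + apply finite_union; auto. apply finite_single.
    + intros X (NX & Q). destruct (classic (X = S)); auto. left. split; auto. split; auto.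
      rewrite orient_other in Q; auto.
Qed.

Lemma region_dirs p T : region p -> dirs T (p T).
Proof.
  intros [(S & C & HC & ->) | F]; [| destruct (F T)].
  unfold orient. destruct (dec (T = S)) as [-> | N]; auto.
Qed.

(** By induction on the number of separators between [S] and [T]: one of them splits the task into
    two with fewer in between, and if there is none, [S] and [T] face a common region. *)
Lemma bconnected_inl S T : clos_refl_trans bnode badj (inl S) (inl T).
Proof.
  destruct (classic (S = T)) as [-> | N]; [apply rt_refl |].
  destruct (sg_finite N) as (n & F). revert S T N F.
  induction n as [n IH] using lt_wf_ind. intros S T N F.
  destruct (classic (exists U, U <> S /\ U <> T /\ sg U S <> sg U T)) as [(U & NS & NT & Q) | None].
  - assert (Aux : forall S T, S <> T -> has_card (fun U => U <> S /\ U <> T /\ sg U S <> sg U T) n ->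
      U <> S -> U <> T -> sg U S <> sg U T -> clos_refl_trans bnode badj (inl S) (inl U)).
    { clear S T N F NS NT Q. intros S T N F NS NT Q.
      assert (Sub : forall X, X <> S /\ X <> U /\ sg X S <> sg X U ->
                X <> S /\ X <> T /\ sg X S <> sg X T).
      { intros X (XS & XU & H).
        assert (E : sg U S = sg U X).
        { apply NNPP. intro K. apply H. apply sg_triangle; auto. }
        assert (XT : X <> T) by (intros ->; auto).
        split; auto. split; auto. intro K. apply H. rewrite K. apply sg_triangle; auto; congruence. }
      destruct (card_sub F Sub) as (m & Hm & _).
      apply (IH m); auto. apply (card_lt (a := U) F Hm Sub); auto. tauto. }
    apply rt_trans with (inl U); [apply (Aux S T); auto |].
    assert (K : clos_refl_trans bnode badj (inl T) (inl U)).
    { apply (Aux T S); auto. revert F. apply card_ext. intro X. intuition. }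
    clear - K. induction K; [apply rt_step, badj_sym; auto | apply rt_refl | eapply rt_trans; eauto].
  - assert (E : orient S (sg S T) = orient T (sg T S)).
    { apply functional_extensionality. intro X. unfold orient.
      destruct (dec (X = S)), (dec (X = T)); subst; try tauto.
      apply NNPP. intro Q. apply None. eauto. }
    assert (R : region (orient S (sg S T))) by (left; eauto).
    apply rt_trans with (inr (exist _ _ R)); apply rt_step; simpl; eauto.
Qed.

Lemma bconnected x y : clos_refl_trans bnode badj x y.
Proof.
  destruct (classic (inhabited I)) as [[i] | F].
  - assert (K : forall x, clos_refl_trans bnode badj x (inl i) /\ clos_refl_trans bnode badj (inl i) x).
    { intros [S | (p & Hp)].
      - split; apply bconnected_inl.
      - destruct Hp as [(S & C & HC & E) | F]; [| destruct (F i)].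
        set (n := inr _ : bnode). assert (A : badj (inl S) n) by (simpl; eauto).
        split; apply rt_trans with (inl S);
          try apply bconnected_inl; apply rt_step; auto using badj_sym. }
    apply rt_trans with (inl i); apply K.
  - assert (E : x = y); [| subst; apply rt_refl].
    destruct x as [S | p], y as [T | q]; try solve [exfalso; apply F; constructor; auto].
    f_equal. apply bnode_eq. apply functional_extensionality. intro S.
    exfalso. apply F. constructor; auto.
Qed.

Lemma badj_bridge x y : badj x y -> exists b, bridge badj x y b.
Proof.
  assert (K : forall S p, badj (inl S) (inr p) -> exists b, bridge badj (inl S) (inr p) b).
  { intros S p (C & H & E). exists (bside S C). apply bside_bridge; auto. }
  destruct x as [S | p], y as [T | q]; simpl badj; try tauto; intro A.
  - apply K, A.
  - destruct (K T p A) as (b & B). exists (fun x => ~ b x).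
    apply bridge_sym; auto. apply badj_sym.
Qed.

Lemma bnode_tree : is_tree badj.
Proof.
  apply bridges_tree; auto using badj_sym, badj_irrefl, badj_bridge, bconnected.
  destruct (classic (inhabited I)) as [[i] | F].
  - constructor. apply (inl i).
  - assert (R : forall p, region p) by (right; auto).
    assert (K : forall i : I, D) by (intro i; exfalso; auto).
    constructor. right. exists K. auto.
Qed.

End NestTree.
(** * Torsos and the ends living in them *)

Section States.
Variable G : Graph.
Notation V := (vert G).
Implicit Types (S T U X C D L W : V -> Prop) (x y z : V) (r : nat -> V).

(** The end lies in the closure of [W]: no finite set cuts it off from [W]. This replaces ends of
    the torso by ends of [G]. *)
Definition lives W r := forall X, finite_set X -> exists v, W v /\ tail r (reach G X v).

(** This depends on [G] and [W] only; [torso_core] and [torso_region] show that it agrees with the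
    torso taken inside a decomposition of the previous torso. *)
Definition torso W x y := W x /\ W y /\ x <> y /\
  (adj G x y \/ exists a b, adj G x a /\ reach G W a b /\ adj G b y).

Lemma torso_sym W x y : torso W x y -> torso W y x.
Proof.
  intros (Wx & Wy & N & H). split; auto. split; auto. split; auto.
  destruct H as [A | (a & b & A & R & B)]; [left; apply adj_sym; auto |].
  right. exists b, a. split; [apply adj_sym; auto | split; [apply reach_sym; auto | apply adj_sym; auto]].
Qed.

(* In the torso of [W] only ends living in [W] matter: [msep] are the separators used there,
   [lcomp] the components in which such an end lives, [dust] the other ones. *)
Definition msep k W S := opt (below k) k S /\
  exists r r', isend r /\ isend r' /\ lives W r /\ lives W r' /\ sep S r r'.

Definition lcomp W S C := iscomp S C /\ exists r, isend r /\ lives W r /\ tail r C.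

Definition dust k W L := exists S, msep k W S /\ iscomp S L /\ ~ lcomp W S L.

Definition core k W : V -> Prop := fun x => W x /\ forall L, dust k W L -> ~ L x.

(** No pair of ends living in [W] is left over from a smaller order, and the separators chosen for
    such pairs, of whatever order, have not been cut apart by the steps already made. *)
Definition inv k W :=
  (forall r r' S j, isend r -> isend r' -> lives W r -> lives W r' ->
     has_card S j -> sep S r r' -> k <= j) /\
  (forall r r' S j, lives W r -> lives W r' -> eff j r r' -> opt (below j) j S -> sep S r r' ->
     forall x, S x -> W x).

Definition nodust k W := forall S x, msep k W S -> W x -> ~ S x -> lcomp W S (reach G S x).

(* The direction at [S] in which [T] lies. *)
Definition sigma S T : V -> Prop := fun x => exists t, T t /\ ~ S t /\ reach G S t x.

Lemma lives_mono W W' r : (forall x, W x -> W' x) -> lives W r -> lives W' r.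
Proof. intros H L X F. destruct (L X F) as (v & Wv & T). eauto. Qed.

Lemma lives_full r : isend r -> lives full r.
Proof. intros E X F. destruct (E X F) as (v & T). exists v. split; [exact Logic.I | auto]. Qed.

Lemma opt_card k S : opt (below k) k S -> has_card S k.
Proof. intros (r & r' & n & _ & (H & _) & _). auto. Qed.

Lemma finite_tight k (A B : V -> Prop) : finite_set A -> finite_set B ->
  finite_set (fun U => has_card U k /\ exists x y, A x /\ B y /\ tight U x y).
Proof.
  intros FA FB. destruct (list_finite FA) as (la & Ha), (list_finite FB) as (lb & Hb).
  destruct (@list_choice (V * V) (V -> Prop)
    (fun p T => has_card T k /\ tight T (fst p) (snd p))) with (l := list_prod la lb) as (L & HL).
  { intros (x & y). destruct (tight_finite k x y) as (L & HL). exists L. intros T (H & Ht). auto. }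
  apply (@finite_list _ _ L). intros U (H & x & y & Ax & By & Ht).
  apply (HL (x, y)); [apply in_prod; [apply Ha | apply Hb] |]; auto.
Qed.

(** Being nested with [T], the set [S] meets at most one component of [G - T]. If this were not the
    one in which both ends live, that component would join the two ends without meeting [S]. *)
Lemma opt_loc j k S T r r' v : opt (below j) j S -> opt (below k) k T -> isend r' ->
  ~ sep T r r' -> sep S r r' -> tail r (reach G T v) -> forall s, S s -> T s \/ reach G T v s.
Proof.
  intros O O' E' NT PS Tv.
  pose proof (nsep_same E' (finite_card (opt_card O')) NT Tv) as Tv'.
  destruct (nest_loc (opt_below_nest O O')) as (_ & w & _ & _ & _ & H).
  destruct (classic (reach G T v w)) as [R | R].
  - intros s Ss. destruct (H s Ss); auto. right. apply reach_trans with w; auto.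
  - exfalso. destruct (tail_ex Tv) as (x & Rx).
    assert (K : forall z, reach G T v z -> ~ S z).
    { intros z Rz Sz. destruct (H z Sz) as [Tz | Rw].
      - apply (reach_notin_r Rz Tz).
      - apply R. apply reach_trans with z; auto. apply reach_sym; auto. }
    destruct PS as (a & b & Ta & Tb & N). apply N.
    destruct (tail_ex2 Ta Tv) as (y & Ry & Ry'), (tail_ex2 Tb Tv') as (z & Rz & Rz').
    apply reach_trans with y; auto. apply reach_trans with z; [| apply reach_sym; auto].
    assert (Q : reach G T y z) by (apply reach_trans with v; [apply reach_sym |]; auto).
    apply (reach_shift Q). intros u Ru. apply K. apply reach_trans with y; auto.
Qed.

Section Inv.
Variables (k : nat) (W : V -> Prop).
Hypothesis HI : inv k W.

Lemma msep_card S : msep k W S -> has_card S k.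
Proof. intros (O & _). apply (opt_card O). Qed.

Lemma lives_eff r r' S : has_card S k -> isend r -> isend r' -> lives W r -> lives W r' ->
  sep S r r' -> eff k r r'.
Proof.
  intros H E E' L L' P. split; auto. split; auto. split; [eauto |].
  intros T j HT PT. apply (proj1 HI r r' T j); auto.
Qed.

Lemma msep_sub S x : msep k W S -> S x -> W x.
Proof.
  intros M. pose proof M as (O & r & r' & E & E' & L & L' & P).
  apply (proj2 HI r r' S k); auto. apply (lives_eff (msep_card M)); auto.
Qed.

Lemma lcomp_other S C : msep k W S -> exists r D, isend r /\ lives W r /\ lcomp W S D /\
  tail r D /\ D <> C.
Proof.
  intros M. pose proof M as (O & r & r' & E & E' & L & L' & P). pose proof P as (v & v' & T & T' & N).
  assert (K : forall r v, isend r -> lives W r -> tail r (reach G S v) -> lcomp W S (reach G S v)).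
  { intros p w Ep Lp Tp. split; [| eauto]. apply iscomp_reach. destruct (tail_ex Tp) as (x & R).
    apply (reach_notin_l R). }
  destruct (classic (reach G S v = C)) as [<- | Q].
  - exists r', (reach G S v'). split; auto. split; auto. split; [eauto |]. split; auto.
    intro Q. apply N. rewrite <- Q. destruct (tail_ex T') as (x & R). apply reach_refl, (reach_notin_l R).
  - exists r, (reach G S v). eauto 6.
Qed.

(** Another component hosts a second living end, and by [inv] the set [S] separates the two ends
    efficiently, which forces fullness. *)
Lemma lcomp_flc S C : msep k W S -> lcomp W S C -> flc S C.
Proof.
  intros M (IC & r & E & L & T). split; auto. split; [| eauto].
  destruct (lcomp_other C M) as (r' & D & E' & L' & (ID & _) & T' & N).
  assert (P : sep S r r').
  { destruct IC as (v & _ & ->), ID as (w & _ & ->). exists v, w. split; auto. split; auto.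
    intro R. apply N. symmetry. apply reach_eq; auto. }
  destruct IC as (v & _ & ->).
  apply (full_of_eff (lives_eff (msep_card M) E E' L L' P) (msep_card M) P T).
Qed.

Lemma msep_diff S T : msep k W S -> msep k W T -> S <> T -> exists t, T t /\ ~ S t.
Proof.
  intros MS MT N. apply NNPP. intro H. apply N.
  apply (card_eq_sub (msep_card MS) (msep_card MT)). intros x Tx. apply NNPP. intro Q. eauto.
Qed.

(** Nestedness puts [T] into [S] and one component. That a living end lies there is seen from a
    component of [T] which hosts one and avoids [S]: it is full, so it ends up in the same component
    of [G - S] as the rest of [T]. *)
Lemma msep_loc S T : msep k W S -> msep k W T -> S <> T ->
  exists C, lcomp W S C /\ forall t, T t -> S t \/ C t.
Proof.
  intros MS MT N.
  destruct (nest_loc (opt_below_nest (proj1 MS) (proj1 MT))) as (_ & v & _ & _ & _ & H).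
  destruct (lcomp_other (reach G T v) MT) as (r & E & Er & Lr & LE & TE & NE).
  assert (NS : forall x, E x -> ~ S x).
  { intros x Ex Sx. destruct (H x Sx) as [Tx | R].
    - apply (iscomp_notin (proj1 LE) Ex Tx).
    - apply NE. apply (iscomp_eq (proj1 LE) (iscomp_reach (reach_notin_l R)) Ex R). }
  destruct (iscomp_ex (proj1 LE)) as (e & Ee).
  exists (reach G S e). split; [split |].
  - apply iscomp_reach, NS, Ee.
  - exists r. split; auto. split; auto. revert TE. apply tail_mono. intros x Ex.
    apply (iscomp_shift (proj1 LE)); auto.
  - intros t Tt. destruct (classic (S t)) as [|Nt]; auto. right.
    apply (full_shift (proj1 LE)); auto. apply (lcomp_flc MT LE).
Qed.

Lemma sigma_eq S T C t : iscomp S C -> (forall t, T t -> S t \/ C t) -> T t -> ~ S t -> sigma S T = C.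
Proof.
  intros IC H Tt Nt. apply pred_ext. intro x. split.
  - intros (u & Tu & Nu & R). destruct (H u Tu) as [|Cu]; [tauto |].
    apply (side_reach (iscomp_side IC) Cu R).
  - intro Cx. exists t. split; auto. split; auto. destruct (H t Tt) as [|Ct]; [tauto |].
    rewrite (iscomp_at IC Ct) in Cx. auto.
Qed.

Lemma sigma_spec S T : msep k W S -> msep k W T -> S <> T ->
  lcomp W S (sigma S T) /\ forall t, T t -> S t \/ sigma S T t.
Proof.
  intros MS MT N. destruct (msep_loc MS MT N) as (C & LC & H).
  destruct (msep_diff MS MT N) as (t & Tt & Nt).
  rewrite (sigma_eq (proj1 LC) H Tt Nt). auto.
Qed.

Lemma sigma_at S T x : msep k W S -> msep k W T -> S <> T -> T x -> ~ S x -> sigma S T = reach G S x.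
Proof.
  intros MS MT N Tx Nx. destruct (sigma_spec MS MT N) as (LC & H).
  apply (iscomp_at (proj1 LC)). destruct (H x Tx); tauto.
Qed.

(** The triangle rule for a vertex in place of a separator: the component of [y] avoids [X], and
    being full it is joined to [U] outside [X]. *)
Lemma point_triangle U X y : msep k W U -> msep k W X -> U <> X ->
  lcomp W U (reach G U y) -> reach G U y <> sigma U X -> ~ X y /\ reach G X y = sigma X U.
Proof.
  intros MU MX N LY Q. destruct (sigma_spec MU MX N) as (LC & H).
  assert (Ny : ~ U y).
  { destruct (iscomp_ex (proj1 LY)) as (z & R). apply (reach_notin_l R). }
  assert (NX : forall z, reach G U y z -> ~ X z).
  { intros z R Xz. destruct (H z Xz) as [Uz | Cz].
    - apply (reach_notin_r R Uz).
    - apply Q. apply (iscomp_eq (proj1 LY) (proj1 LC) R Cz). }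
  assert (Ry : reach G U y y) by (apply reach_refl; auto).
  split; [auto |].
  destruct (msep_diff MX MU (not_eq_sym N)) as (u & Uu & Nu).
  rewrite (sigma_at MX MU (not_eq_sym N) Uu Nu). apply reach_eq.
  apply (full_shift (proj1 LY)); auto. apply (lcomp_flc MU LY).
Qed.

Lemma sigma_triangle S U X : msep k W S -> msep k W U -> msep k W X ->
  X <> U -> S <> U -> S <> X -> sigma U S <> sigma U X -> sigma X S = sigma X U.
Proof.
  intros MS MU MX N1 N2 N3 Q. destruct (msep_diff MU MS (not_eq_sym N2)) as (y & Sy & Ny).
  pose proof (sigma_at MU MS (not_eq_sym N2) Sy Ny) as E. rewrite E in Q.
  destruct (sigma_spec MU MS (not_eq_sym N2)) as (LS & _). rewrite E in LS.
  destruct (point_triangle MU MX (not_eq_sym N1) LS Q) as (NX & R).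
  rewrite (sigma_at MX MS (not_eq_sym N3) Sy NX). auto.
Qed.

Lemma tight_lcomp U x y : msep k W U -> lcomp W U (reach G U x) -> lcomp W U (reach G U y) ->
  reach G U x <> reach G U y -> tight U x y.
Proof.
  intros MU Lx Ly N.
  assert (K : forall z, lcomp W U (reach G U z) -> ~ U z).
  { intros z Lz. destruct (iscomp_ex (proj1 Lz)) as (w & R). apply (reach_notin_l R). }
  split; [apply K; auto | split; [apply K; auto | split]].
  - intro R. apply N, reach_eq, R.
  - split; [apply (lcomp_flc MU Lx) | apply (lcomp_flc MU Ly)].
Qed.

(** A separator between [S] and [T] is tight for a vertex of [S] and a vertex of [T]. *)
Lemma sigma_finite S T : msep k W S -> msep k W T ->
  finite_set (fun U => msep k W U /\ U <> S /\ U <> T /\ sigma U S <> sigma U T).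
Proof.
  intros MS MT.
  apply (finite_sub (finite_tight k (finite_card (msep_card MS)) (finite_card (msep_card MT)))).
  intros U (MU & NS & NT & Q). split; [apply (msep_card MU) |].
  destruct (msep_diff MU MS NS) as (x & Sx & Nx), (msep_diff MU MT NT) as (y & Ty & Ny).
  rewrite (sigma_at MU MS NS Sx Nx), (sigma_at MU MT NT Ty Ny) in Q.
  exists x, y. split; auto. split; auto. apply tight_lcomp; auto.
  - rewrite <- (sigma_at MU MS NS Sx Nx). apply (sigma_spec MU MS NS).
  - rewrite <- (sigma_at MU MT NT Ty Ny). apply (sigma_spec MU MT NT).
Qed.

(** * Cutting off the components in which no end lives *)

Lemma dust_msep L T x : dust k W L -> msep k W T -> T x -> ~ L x.
Proof.
  intros (S & MS & IL & NL) MT Tx Lx. destruct (classic (S = T)) as [-> | N].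
  - apply (iscomp_notin IL Lx Tx).
  - destruct (msep_loc MS MT N) as (C & LC & H). destruct (H x Tx) as [Sx | Cx].
    + apply (iscomp_notin IL Lx Sx).
    + apply NL. rewrite (iscomp_eq IL (proj1 LC) Lx Cx). auto.
Qed.

(** [L] is connected and avoids the separator belonging to [L'], so it cannot leave [L']. *)
Lemma dust_sub L L' x : dust k W L -> dust k W L' -> L x -> L' x -> forall y, L y -> L' y.
Proof.
  intros (S & MS & IL & NL) D' Lx L'x y Ly. pose proof D' as (S' & MS' & IL' & NL').
  rewrite (iscomp_at IL' L'x). apply (iscomp_shift IL); auto.
  intros z Lz Sz. revert Lz. apply (@dust_msep L S' z); auto. exists S. auto.
Qed.

Lemma dust_eq L L' x : dust k W L -> dust k W L' -> L x -> L' x -> L = L'.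
Proof. intros. apply pred_ext. intro y. split; eapply dust_sub; eauto. Qed.

Lemma msep_core S x : msep k W S -> S x -> core k W x.
Proof. intros M Sx. split; [apply (msep_sub M Sx) |]. intros L D. apply (dust_msep D M Sx). Qed.

Definition nbhd L x := L x \/ exists c, L c /\ adj G c x.

Lemma nbhd_core L x : dust k W L -> nbhd L x -> L x \/ core k W x.
Proof.
  intros (S & MS & IL & NL) [Lx | (c & Lc & A)]; auto.
  destruct (classic (S x)) as [Sx | Nx].
  - right. apply (msep_core MS Sx).
  - left. apply (proj2 (iscomp_side IL) c); auto.
Qed.

Lemma dust_torso L x y : dust k W L -> L x -> torso W x y -> nbhd L y.
Proof.
  intros (S & MS & IL & NL) Lx (Wx & Wy & N & [A | (a & b & A & R & B)]).
  - right. eauto.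
  - right. exists b. split; auto.
    assert (Rs : reach G S a b) by (apply (reach_mono (S := W)); auto; intro; apply (msep_sub MS)).
    apply (side_reach (iscomp_side IL) (x := a)); auto.
    apply (proj2 (iscomp_side IL) x); auto. apply (reach_notin_l Rs).
Qed.

Lemma dust_reach_core L x y : dust k W L -> L x -> reach G (core k W) x y -> L y.
Proof.
  intros (S & MS & IL & NL) Lx R. apply (side_reach (iscomp_side IL) Lx).
  apply (reach_mono (S := core k W)); auto. intro; apply (msep_core MS).
Qed.

(** The leaves are the components themselves, so a component cut off by several separators gives one
    leaf. *)
Definition anode := option {L | dust k W L}.

Definition aadj (s t : anode) : Prop :=
  match s, t with None, Some _ => True | Some _, None => True | _, _ => False end.

Definition apart (t : anode) : V -> Prop :=
  match t with
  | None => core k W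
  | Some L => fun x => W x /\ nbhd (proj1_sig L) x
  end.

Lemma aadj_sym s t : aadj s t -> aadj t s.
Proof. destruct s, t; simpl; auto. Qed.

Lemma aadj_bridge (L : {L | dust k W L}) : bridge aadj None (Some L) (fun t => t = Some L).
Proof.
  split; [discriminate | split; auto]. intros [M|] [M'|]; simpl; try tauto; intros _ N E; auto.
  discriminate.
Qed.

Lemma aadj_tree : is_tree aadj.
Proof.
  apply bridges_tree.
  - apply aadj_sym.
  - intros [L|]; simpl; auto.
  - constructor. exact None.
  - assert (K : forall t, clos_refl_trans anode aadj None t /\ clos_refl_trans anode aadj t None).
    { intros [L|]; split; try apply rt_refl; apply rt_step; simpl; auto. }
    intros s t. apply rt_trans with None; apply K.
  - intros [L|] [M|]; simpl; try tauto; intros _.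
    + eexists. apply bridge_sym; [apply aadj_sym |]. apply aadj_bridge.
    + eexists. apply aadj_bridge.
Qed.

Lemma dust_sig_eq (L L' : {L | dust k W L}) : proj1_sig L = proj1_sig L' -> L = L'.
Proof. destruct L as (L & D), L' as (L' & D'). simpl. intros ->. f_equal. apply proof_irrelevance. Qed.

Lemma apart_T3 t1 t2 t3 : on_path aadj t1 t2 t3 ->
  forall x, apart t1 x -> apart t3 x -> apart t2 x.
Proof.
  intros P x P1 P3. destruct (classic (t2 = t1)) as [-> | N]; auto.
  destruct (on_path_bridge aadj_sym P N) as (s & A & B). destruct t2 as [L|].
  - destruct s; [destruct A |]. destruct (B _ (aadj_bridge L)) as (_ & <-). auto.
  - destruct s as [L|]; [| destruct A].
    destruct (B _ (bridge_sym aadj_sym (aadj_bridge L))) as (B1 & B3).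
    apply NNPP in B1. subst t1. destruct t3 as [L'|]; auto.
    destruct P1 as (Wx & P1), P3 as (_ & P3). simpl.
    destruct (nbhd_core (proj2_sig L) P1) as [Lx |]; auto.
    destruct (nbhd_core (proj2_sig L') P3) as [L'x |]; auto.
    exfalso. apply B3. f_equal. apply dust_sig_eq.
    apply (dust_eq (proj2_sig L') (proj2_sig L) L'x Lx).
Qed.

(** The case [x = y] is included because it yields the covering of vertices. *)
Lemma apart_edge x y : W x -> W y -> x = y \/ torso W x y -> exists t, apart t x /\ apart t y.
Proof.
  intros Wx Wy H.
  assert (K : forall x y, W x -> W y -> x = y \/ torso W x y -> ~ core k W x ->
      exists t, apart t x /\ apart t y).
  { clear x y Wx Wy H. intros x y Wx Wy H N.
    assert (D : exists L, dust k W L /\ L x).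
    { apply NNPP. intro Q. apply N. split; auto. intros L D Lx. eauto. }
    destruct D as (L & D & Lx). exists (Some (exist _ L D)). simpl. split; split; auto.
    - left; auto.
    - destruct H as [<- | H]; [left; auto | apply (dust_torso D Lx H)]. }
  destruct (classic (core k W x)) as [Cx |]; [| apply K; auto].
  destruct (classic (core k W y)) as [Cy |]; [exists None; simpl; auto |].
  destruct (K y x) as (t & Hy & Hx); eauto. destruct H; auto. right. apply torso_sym; auto.
Qed.

Definition tdA : TD W (torso W).
Proof.
  refine (@Build_TD V W (torso W) anode aadj aadj_tree apart _ _ _ apart_T3).
  - intros [L|] x; simpl; [tauto |]. intros (Wx & _). auto.
  - intros x Wx. destruct (@apart_edge x x) as (t & H & _); eauto.
  - intros x y Wx Wy A. apply apart_edge; auto.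
Defined.

(** A walk outside the core either avoids [W] or enters some dust component and then remains in it,
    so that its ends lie in the adhesion set of that leaf. Conversely a dust component is connected
    and misses the core. *)
Lemma torso_core x y : torso (core k W) x y <-> torso_adj (D := tdA) None x y.
Proof.
  split.
  - intros (Cx & Cy & N & H). split; auto. split; auto. split; auto.
    pose proof Cx as (Wx & _). pose proof Cy as (Wy & _).
    destruct H as [A | (a & b & A & R & B)].
    + left. split; auto.
    + destruct (classic (exists z, W z /\ reach G (core k W) a z)) as [(z & Wz & Rz) | Q].
      * right. assert (D : exists L, dust k W L /\ L z).
        { apply NNPP. intro Q. apply (reach_notin_r Rz). split; auto. intros L D Lz. eauto. }
        destruct D as (L & D & Lz). exists (Some (exist _ L D)). split; [simpl; auto |].
        assert (La : L a) by (apply (dust_reach_core D Lz); apply reach_sym; auto).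
        assert (Lb : L b) by (apply (dust_reach_core D La R)).
        split; split; auto; simpl; right; [exists a | exists b]; split; auto.
        apply adj_sym; auto.
      * left. split; auto. split; auto. split; auto. right. exists a, b. split; auto. split; auto.
        apply (reach_shift R). intros z Rz Wz. eauto.
  - intros (Cx & Cy & N & H). simpl in Cx, Cy. split; auto. split; auto. split; auto.
    destruct H as [(_ & _ & _ & [A | (a & b & A & R & B)]) | (s & A & Px & Py)]; auto.
    + right. exists a, b. split; auto. split; auto. revert R. apply reach_mono. intros z (Wz & _). auto.
    + destruct s as [(L & D)|]; [| destruct A]. simpl in Px, Py.
      destruct Px as (_ & [Lx | (c & Lc & Ac)]); [destruct (proj2 Cx L D Lx) |].
      destruct Py as (_ & [Ly | (d & Ld & Ad)]); [destruct (proj2 Cy L D Ly) |].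
      right. exists c, d. split; [apply adj_sym; auto | split; auto].
      pose proof D as (S & _ & IL & _). apply (iscomp_shift IL); auto.
      intros z Lz (_ & Q). apply (Q L D Lz).
Qed.

(** A component of [G - X] that hosts [r] and misses the core contains a vertex of [W] in some dust
    [L]; the component cannot leave [L], so [r] would live in [L]. *)
Lemma lives_core r : isend r -> lives W r <-> lives (core k W) r.
Proof.
  intro E. split; [| apply lives_mono; intros x (Wx & _); auto].
  intros Lr X F. destruct (E X F) as (e & Te). apply NNPP. intro N.
  assert (K : forall z, reach G X e z -> ~ core k W z).
  { intros z R Cz. apply N. exists z. split; auto. apply (tail_comp Te R). }
  destruct (Lr X F) as (v & Wv & Tv). pose proof (tail_same Te Tv) as R.
  apply (K v R). split; auto. intros L D Lv. pose proof D as (S & MS & IL & NL).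
  apply NL. split; auto. exists r. split; auto. split; auto. revert Tv. apply tail_mono.
  intros x Rx. apply (dust_reach_core D Lv). apply (reach_shift Rx). intros z Rz. apply K.
  apply reach_trans with v; auto.
Qed.

Lemma msep_core_iff S : msep k (core k W) S <-> msep k W S.
Proof.
  split; intros (O & r & r' & E & E' & L & L' & P); split; auto; exists r, r';
    repeat split; auto; apply lives_core; auto.
Qed.

Lemma lcomp_core_iff S C : lcomp (core k W) S C <-> lcomp W S C.
Proof.
  split; intros (IC & r & E & L & T); split; auto; exists r; repeat split; auto; apply lives_core; auto.
Qed.

(** If [T] separates the pair, then [S] has order [k] too and [msep_loc] applies; otherwise both
    ends live in one component of [G - T], which must then contain the rest of [S]. *)
Lemma opt_region_loc r r' S j T : lives W r -> lives W r' -> eff j r r' -> opt (below j) j S ->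
  sep S r r' -> msep k W T -> S <> T -> exists C, lcomp W T C /\ forall s, S s -> T s \/ C s.
Proof.
  intros L L' E O P MT N. pose proof E as (Er & Er' & _ & _).
  destruct (classic (sep T r r')) as [Q | Q].
  - assert (j = k).
    { apply (eff_unique E). apply (lives_eff (msep_card MT)); auto. }
    subst j. apply msep_loc; auto. split; auto. exists r, r'. auto 6.
  - destruct (Er T (finite_card (msep_card MT))) as (v & Tv).
    exists (reach G T v). split.
    + split; [| eauto]. apply iscomp_reach. destruct (tail_ex Tv) as (x & R). apply (reach_notin_l R).
    + apply (opt_loc O (proj1 MT) Er' Q P Tv).
Qed.

Lemma inv_core : inv k (core k W).
Proof.
  destruct HI as (I1 & I2).
  assert (Lw : forall r, lives (core k W) r -> lives W r).
  { intro r. apply lives_mono. intros x (Wx & _). auto. }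
  split.
  - intros. apply (I1 r r' S j); auto.
  - intros r r' S j L L' E O P x Sx. split; [apply (I2 r r' S j); auto |].
    intros D HD Dx. pose proof HD as (T & MT & ID & ND).
    destruct (classic (S = T)) as [-> | N].
    + apply (iscomp_notin ID Dx Sx).
    + destruct (@opt_region_loc r r' S j T) as (C & LC & H); auto.
      destruct (H x Sx) as [Tx | Cx].
      * apply (iscomp_notin ID Dx Tx).
      * apply ND. rewrite (iscomp_eq ID (proj1 LC) Dx Cx). auto.
Qed.

Lemma nodust_core : nodust k (core k W).
Proof.
  intros S x M (Wx & Dx) Nx. apply msep_core_iff in M. apply lcomp_core_iff.
  apply NNPP. intro N. apply (Dx (reach G S x)).
  - exists S. split; auto. split; auto. apply iscomp_reach; auto.
  - apply reach_refl; auto.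
Qed.

End Inv.
End States.
(** * The tree-decomposition along the separators of order [k] *)

Section Regions.
Variable G : Graph.
Notation V := (vert G).
Implicit Types (C D L : V -> Prop) (x y z : V) (r : nat -> V).
Variables (k : nat) (W : V -> Prop).
Hypothesis HI : inv k W.
Hypothesis ND : nodust k W.

Definition sepn := {S | msep k W S}.
Implicit Types (S T : sepn) (p q : sepn -> V -> Prop).

Definition sgB S T : V -> Prop := sigma (proj1_sig S) (proj1_sig T).
Definition dirB S C := lcomp W (proj1_sig S) C.

Lemma sepn_eq S T : proj1_sig S = proj1_sig T -> S = T.
Proof. destruct S as (S & H), T as (T & H'). simpl. intros ->. f_equal. apply proof_irrelevance. Qed.

Lemma sepn_neq S T : S <> T -> proj1_sig S <> proj1_sig T.
Proof. intros N E. apply N, sepn_eq, E. Qed.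

Lemma sgB_spec S T : S <> T -> dirB S (sgB S T) /\ forall t, proj1_sig T t -> proj1_sig S t \/ sgB S T t.
Proof. intro N. apply (sigma_spec HI (proj2_sig S) (proj2_sig T) (sepn_neq N)). Qed.

Lemma sgB_dirs S T : S <> T -> dirB S (sgB S T).
Proof. intro N. apply (sgB_spec N). Qed.

Lemma sgB_triangle (S U X : sepn) : X <> U -> S <> U -> S <> X ->
  sgB U S <> sgB U X -> sgB X S = sgB X U.
Proof.
  intros N1 N2 N3. apply (sigma_triangle HI); auto using sepn_neq; apply proj2_sig.
Qed.

Lemma sgB_finite S T : S <> T ->
  finite_set (fun U => U <> S /\ U <> T /\ sgB U S <> sgB U T).
Proof.
  intros N. pose proof (finite_sig (sigma_finite HI (proj2_sig S) (proj2_sig T))) as F.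
  apply (finite_sub F). intros U (N1 & N2 & Q). auto using sepn_neq.
Qed.

Definition rnode := bnode sgB dirB.
Definition radj : rnode -> rnode -> Prop := @badj _ _ sgB dirB.

Definition bpart p : V -> Prop := fun x => W x /\ forall T, proj1_sig T x \/ p T x.

Definition rpart (t : rnode) : V -> Prop :=
  match t with
  | inl T => proj1_sig T
  | inr p => bpart (proj1_sig p)
  end.

Lemma rtree : is_tree radj.
Proof. apply bnode_tree; [apply sgB_dirs | apply sgB_triangle | apply sgB_finite]. Qed.

Lemma rconnected s t : clos_refl_trans rnode radj s t.
Proof. apply bconnected; [apply sgB_dirs | apply sgB_triangle | apply sgB_finite]. Qed.

Lemma reg_dirs p T : region sgB dirB p -> dirB T (p T).
Proof. apply region_dirs, sgB_dirs. Qed.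

Lemma reg_consistent p : region sgB dirB p -> consistent sgB p.
Proof. apply region_consistent, sgB_triangle. Qed.

Lemma sepn_sub S x : proj1_sig S x -> W x.
Proof. apply (msep_sub HI (proj2_sig S)). Qed.

Lemma orient_sub S C x : dirB S C -> proj1_sig S x -> bpart (orient sgB S C) x.
Proof.
  intros HC Sx. split; [apply (sepn_sub Sx) |]. intro T.
  destruct (classic (T = S)) as [-> | N]; auto. rewrite orient_other; auto.
  apply (sgB_spec N); auto.
Qed.

Lemma bside_in S C t x : dirB S C -> bside (sg := sgB) (dirs := dirB) S C t -> rpart t x ->
  proj1_sig S x \/ C x.
Proof.
  intros HC B P. destruct t as [T | (p & Hp)]; simpl in B, P.
  - destruct B as (N & <-). apply (sgB_spec (not_eq_sym N)); auto.
  - destruct P as (_ & P). rewrite <- B. apply P.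
Qed.

Lemma bside_out S C t x : dirB S C -> ~ bside (sg := sgB) (dirs := dirB) S C t -> rpart t x ->
  ~ C x.
Proof.
  intros HC B P Cx. pose proof (iscomp_notin (proj1 HC) Cx) as NS.
  destruct t as [T | (p & Hp)]; simpl in B, P.
  - destruct (classic (T = S)) as [-> | N]; [auto |]. apply B. split; auto.
    destruct (sgB_spec (not_eq_sym N)) as (LT & H). destruct (H x P) as [|K]; [tauto |].
    apply (iscomp_eq (proj1 LT) (proj1 HC) K Cx).
  - destruct P as (_ & P). destruct (P S) as [|K]; [tauto |]. apply B.
    apply (iscomp_eq (proj1 (reg_dirs S Hp)) (proj1 HC) K Cx).
Qed.

(** A vertex in parts on both sides of an edge at [S] must lie in [S], and [S] is contained in the
    parts at both ends of that edge. *)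
Lemma rpart_T3 t1 t2 t3 : on_path radj t1 t2 t3 ->
  forall x, rpart t1 x -> rpart t3 x -> rpart t2 x.
Proof.
  intros P x P1 P3. destruct (classic (t2 = t1)) as [-> | N]; auto.
  destruct (on_path_bridge (@badj_sym _ _ _ _) P N) as (s & A & B).
  destruct s as [S | q], t2 as [T | p]; simpl in A; try tauto; destruct A as (C & HC & E);
    pose proof (bside_bridge HC E) as Br.
  - destruct (B _ Br) as (B1 & B3).
    pose proof (bside_out HC B1 P1). destruct (bside_in HC B3 P3) as [Sx | Cx]; [| tauto].
    simpl. rewrite E. apply orient_sub; auto.
  - destruct (B _ (bridge_sym (@badj_sym _ _ _ _) Br)) as (B1 & B3). apply NNPP in B1.
    pose proof (bside_out HC B3 P3). destruct (bside_in HC B1 P1); simpl; tauto.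
Qed.

(** * Orientations that are regions *)

Lemma orientation_region q S : (forall T, dirB T (q T)) -> consistent sgB q ->
  finite_set (between sgB S q) -> region sgB dirB q.
Proof.
  intros Hq Cq F.
  destruct (@descent _ _ sgB sgB_triangle q S (fun _ => True) Cq F) as (T & _ & H); auto.
  left. exists T, (q T). split; auto. apply between_none; auto.
Qed.

(** Each separator counted is tight for a vertex of [A] and a vertex of [S]. Below, [A] is the pair
    of ends of an edge, or a finite set separating two ends. *)
Lemma between_finite q S (A : V -> Prop) : finite_set A ->
  (forall T, T <> S -> q T <> sgB T S -> exists x, A x /\ q T = reach G (proj1_sig T) x) ->
  (forall T, dirB T (q T)) -> finite_set (between sgB S q).
Proof.
  intros FA H Hq.
  pose proof (finite_tight k FA (finite_card (msep_card (proj2_sig S)))) as F.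
  assert (F' : finite_set (fun U => msep k W U /\ has_card U k /\
     exists x y, A x /\ proj1_sig S y /\ tight U x y)) by (apply (finite_sub F); tauto).
  apply (finite_sub (finite_sig F')). intros T (N & Q).
  split; [apply (msep_card (proj2_sig T)) |].
  destruct (H T N Q) as (x & Ax & E).
  destruct (msep_diff (proj2_sig T) (proj2_sig S) (sepn_neq N)) as (y & Sy & Ny).
  exists x, y. split; auto. split; auto.
  pose proof (sigma_at HI (proj2_sig T) (proj2_sig S) (sepn_neq N) Sy Ny) as E'.
  apply (tight_lcomp HI (proj2_sig T)).
  - rewrite <- E. apply Hq.
  - rewrite <- E'. apply (sgB_dirs N).
  - rewrite <- E, <- E'. auto.
Qed.

Lemma torso_reach T x y : torso W x y -> ~ proj1_sig T x -> ~ proj1_sig T y ->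
  reach G (proj1_sig T) x y.
Proof.
  intros (_ & _ & _ & [A | (a & b & A & R & B)]) Nx Ny.
  - apply reach_next with x; auto. apply reach_refl; auto.
  - assert (R' : reach G (proj1_sig T) a b).
    { apply (reach_mono (S := W)); auto. intros z. apply sepn_sub. }
    apply reach_trans with a.
    + apply reach_next with x; auto; [apply reach_refl; auto | apply (reach_notin_l R')].
    + apply reach_next with b; auto.
Qed.

(** If no separator contains both [x] and [y], each one sees an endpoint outside itself, and the
    component of that endpoint does not depend on the choice. By [nodust] it is a direction, so all
    separators point at the edge and this orientation is a region. *)
Lemma rpart_edge x y : W x -> W y -> x = y \/ torso W x y -> exists t, rpart t x /\ rpart t y.
Proof.
  intros Wx Wy H.
  destruct (classic (exists S, proj1_sig S x /\ proj1_sig S y)) as [(S & Sx & Sy) | N].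
  { exists (inl S). auto. }
  pose (q := fun T => if dec (proj1_sig T x) then reach G (proj1_sig T) y else reach G (proj1_sig T) x).
  assert (F : forall T z, z = x \/ z = y -> ~ proj1_sig T z -> q T = reach G (proj1_sig T) z).
  { intros T z Hz Nz. unfold q. destruct (dec (proj1_sig T x)) as [Tx | Nx].
    - destruct Hz as [-> | ->]; auto. tauto.
    - destruct Hz as [-> | ->]; auto. apply reach_eq.
      destruct H as [<- | H]; [apply reach_refl; auto | apply torso_reach; auto]. }
  assert (Out : forall T, exists z, (z = x \/ z = y) /\ ~ proj1_sig T z).
  { intro T. destruct (classic (proj1_sig T x)) as [Tx|]; [| eauto].
    exists y. split; auto. intro Ty. eauto. }
  assert (Hq : forall T, dirB T (q T)).
  { intro T. destruct (Out T) as (z & Hz & Nz). rewrite (F T z Hz Nz).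
    apply (ND (proj2_sig T)); auto. destruct Hz as [-> | ->]; auto. }
  assert (Rq : region sgB dirB q).
  { destruct (classic (inhabited sepn)) as [[S] | E]; [| right; intro S; apply E; constructor; auto].
    apply orientation_region with S; auto.
    - intros U X NUX Q. destruct (Out U) as (z & Hz & Nz). rewrite (F U z Hz Nz) in Q.
      destruct (point_triangle HI (proj2_sig U) (proj2_sig X) (sepn_neq NUX)
        (ND (proj2_sig U) (ltac:(destruct Hz as [-> | ->]; auto) : W z) Nz) Q) as (NX & E).
      rewrite (F X z Hz NX). auto.
    - apply between_finite with (fun z => z = x \/ z = y); auto.
      + apply finite_union; apply finite_single.
      + intros T _ _. destruct (Out T) as (z & Hz & Nz). exists z. auto. }
  assert (K : forall z, z = x \/ z = y -> bpart q z).
  { intros z Hz. split; [destruct Hz as [-> | ->]; auto |]. intro T.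
    destruct (classic (proj1_sig T z)); auto. right. rewrite (F T z Hz); auto. apply reach_refl; auto. }
  exists (inr (exist _ q Rq)). split; simpl; auto.
Qed.

Definition tdB : TD W (torso W).
Proof.
  refine (@Build_TD V W (torso W) rnode radj rtree rpart _ _ _ rpart_T3).
  - intros [S | p] x; simpl; [apply sepn_sub | intros (Wx & _); auto].
  - intros x Wx. destruct (@rpart_edge x x) as (t & H & _); eauto.
  - intros x y Wx Wy A. apply rpart_edge; auto.
Defined.

(** Among the separators that cut [z] off from [p], one facing [p] is reached by descent;
    [point_triangle] keeps [z] cut off at each move. *)
Lemma outside_region p z : region sgB dirB p -> W z -> ~ bpart p z ->
  exists T, p = orient sgB T (p T) /\ ~ proj1_sig T z /\ ~ p T z.
Proof.
  intros Rp Wz N.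
  assert (Z : exists T, ~ proj1_sig T z /\ ~ p T z).
  { apply NNPP. intro Q. apply N. split; auto. intro T. apply NNPP. intro Q'. apply Q.
    exists T. tauto. }
  destruct Z as (T0 & Z0).
  destruct (@descent _ _ sgB sgB_triangle p T0 (fun T => ~ proj1_sig T z /\ ~ p T z))
    as (T & ZT & H); auto.
  - apply reg_consistent; auto.
  - apply (region_between sgB_finite T0 Rp).
  - intros T X (NT & Np) (NX & Q).
    assert (E : p T = sgB T X) by (apply (reg_consistent Rp); auto).
    assert (LT : lcomp W (proj1_sig T) (reach G (proj1_sig T) z)) by (apply (ND (proj2_sig T)); auto).
    destruct (point_triangle HI (proj2_sig T) (proj2_sig X) (sepn_neq (not_eq_sym NX)) LT)
      as (NXz & EX).
    { intro K. apply Np. rewrite E. unfold sgB. rewrite <- K. apply reach_refl; auto. }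
    split; auto. intro K. apply Q. rewrite (iscomp_at (proj1 (reg_dirs X Rp)) K). auto.
  - exists T. split; auto. apply between_none; auto.
Qed.

(** A walk outside the region that meets [z] in [W] runs beyond a separator [T] facing the region,
    so both its ends lie in [T]. Conversely, two vertices of an adjacent [S] are joined through a
    full component of [S] other than the one pointing to the region. *)
Lemma torso_region (p : {p | region sgB dirB p}) x y :
  torso (bpart (proj1_sig p)) x y <-> torso_adj (D := tdB) (inr p) x y.
Proof.
  destruct p as (p & Rp). simpl. split.
  - intros (Px & Py & N & H). split; auto. split; auto. split; auto.
    pose proof Px as (Wx & _). pose proof Py as (Wy & _).
    destruct H as [A | (a & b & A & R & B)].
    + left. split; auto.
    + destruct (classic (exists z, W z /\ reach G (bpart p) a z)) as [(z & Wz & Rz) | Q].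
      * right. destruct (outside_region Rp Wz (reach_notin_r Rz)) as (T & E & NT & Np).
        exists (inl T). split; [exists (p T); split; auto; apply reg_dirs; auto |].
        assert (Sub : forall u, proj1_sig T u -> bpart p u).
        { intros u Tu. rewrite E. apply orient_sub; auto. apply reg_dirs; auto. }
        assert (K : forall u c, bpart p u -> adj G u c -> reach G (bpart p) z c -> proj1_sig T u).
        { intros u c (_ & Pu) Ac Rc. apply NNPP. intro Nu. destruct (Pu T) as [|Pu']; [tauto |].
          apply Np. apply (side_reach (iscomp_side (proj1 (reg_dirs T Rp))) Pu').
          apply reach_sym. apply reach_next with c; auto; [| apply adj_sym; auto].
          revert Rc. apply reach_mono. auto. }
        split; simpl.
        { apply (K x a); auto. apply reach_sym; auto. }
        { apply (K y b); auto; [apply adj_sym; auto |]. apply reach_trans with a; auto.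
          apply reach_sym; auto. }
      * left. split; auto. split; auto. split; auto. right. exists a, b. split; auto. split; auto.
        apply (reach_shift R). intros z Rz Wz. eauto.
  - intros (Px & Py & N & H). simpl in Px, Py. split; auto. split; auto. split; auto.
    destruct H as [(_ & _ & _ & [A | (a & b & A & R & B)]) | (s & A & Sx & Sy)]; auto.
    + right. exists a, b. split; auto. split; auto. revert R. apply reach_mono. intros z (Wz & _). auto.
    + destruct s as [S | q]; [| destruct A]. destruct A as (C & HC & E). simpl in E, Sx, Sy.
      destruct (lcomp_other C (proj2_sig S)) as (_ & D & _ & _ & LD & _ & NE).
      pose proof (lcomp_flc HI (proj2_sig S) LD) as (_ & FD & _).
      destruct (FD x Sx) as (c & Dc & Ac), (FD y Sy) as (d & Dd & Ad).
      right. exists c, d. split; auto. split; [| apply adj_sym; auto].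
      apply (iscomp_shift (proj1 LD)); auto. intros z Dz (_ & Pz).
      destruct (Pz S) as [Sz | Cz].
      * apply (iscomp_notin (proj1 LD) Dz Sz).
      * rewrite E, orient_self in Cz. apply NE. apply (iscomp_eq (proj1 LD) (proj1 HC) Dz Cz).
Qed.

(** * Ends living in a region *)

Lemma lives_region_tail p r T : isend r -> region sgB dirB p -> lives (bpart p) r -> tail r (p T).
Proof.
  intros E Rp L. destruct (L (proj1_sig T) (finite_card (msep_card (proj2_sig T)))) as (v & (_ & Pv) & Tv).
  destruct (Pv T) as [Tx | Px].
  - destruct (tail_ex Tv) as (x & R). destruct (reach_notin_l R Tx).
  - revert Tv. apply tail_mono. intros x. apply (side_reach (iscomp_side (proj1 (reg_dirs T Rp))) Px).
Qed.

Lemma lives_region p r : isend r -> region sgB dirB p -> lives W r -> (forall T, tail r (p T)) ->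
  lives (bpart p) r.
Proof.
  intros E Rp L H X F. destruct (E X F) as (e & Te). apply NNPP. intro N.
  assert (K : forall z, reach G X e z -> ~ bpart p z).
  { intros z R Pz. apply N. exists z. split; auto. apply (tail_comp Te R). }
  destruct (L X F) as (v & Wv & Tv). pose proof (tail_same Te Tv) as R.
  destruct (outside_region Rp Wv (K v R)) as (T & ET & NT & Np).
  apply Np. destruct (tail_ex2 Tv (H T)) as (x & Rx & Px).
  apply (side_reach (iscomp_side (proj1 (reg_dirs T Rp))) Px). apply reach_sym.
  apply (reach_shift Rx). intros z Rz Tz. apply (K z); [apply reach_trans with v; auto |].
  rewrite ET. apply orient_sub; auto. apply reg_dirs; auto.
Qed.

(** Two ends of the region live in the direction [p T] of every [T], so no chosen [k]-set separates
    them, and by [opt_exists] no [k]-set at all. Their later separators lie in the direction [p T]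
    by [opt_loc]. *)
Lemma inv_region p : region sgB dirB p -> inv (1 + k) (bpart p).
Proof.
  intro Rp.
  assert (Lw : forall r, lives (bpart p) r -> lives W r).
  { intro r. apply lives_mono. intros x (Wx & _). auto. }
  assert (NS : forall r r' T, isend r -> isend r' -> lives (bpart p) r -> lives (bpart p) r' ->
     ~ sep (proj1_sig T) r r').
  { intros r r' T E E' L L' P.
    pose proof (lives_region_tail T E Rp L) as H. pose proof (lives_region_tail T E' Rp L') as H'.
    destruct (proj1 (reg_dirs T Rp)) as (v & _ & Ev). rewrite Ev in H, H'.
    apply (sep_not_same P H H'). }
  assert (I1 : forall r r' (S : V -> Prop) j, isend r -> isend r' -> lives (bpart p) r -> lives (bpart p) r' ->
     has_card S j -> sep S r r' -> 1 + k <= j).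
  { intros r r' S j E E' L L' HS P. pose proof (proj1 HI r r' S j E E' (Lw _ L) (Lw _ L') HS P).
    assert (k <> j); [| lia]. intros <-.
    destruct (opt_exists (lives_eff HI HS E E' (Lw _ L) (Lw _ L') P)) as (S' & O & HS' & P').
    assert (M : msep k W S') by (split; auto; exists r, r'; auto 6).
    apply (NS r r' (exist _ S' M)); auto. }
  split; auto.
  intros r r' S j L L' E O P x Sx. pose proof E as (Er & Er' & _ & _).
  split; [apply (proj2 HI r r' S j); auto |]. intro T.
  assert (NST : S <> proj1_sig T) by (intros ->; apply (NS r r' T); auto).
  pose proof (lives_region_tail T Er Rp L) as H.
  pose proof (reg_dirs T Rp) as (IC & _). pose proof IC as (v & _ & Ev). rewrite Ev in *.
  apply (opt_loc O (proj1 (proj2_sig T)) Er' (NS r r' T Er Er' L L') P H); auto.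
Qed.

(** All separators point at the common component of the two ends. Each such component meets [X], as
    otherwise it would join the ends outside [X]; finiteness of [X] thus keeps the orientation from
    running towards an end of the tree. *)
Lemma region_of_ends r r' (X : V -> Prop) : isend r -> isend r' -> lives W r -> lives W r' ->
  finite_set X -> sep X r r' -> (forall T, ~ sep (proj1_sig T) r r') ->
  exists p, region sgB dirB p /\ lives (bpart p) r /\ lives (bpart p) r'.
Proof.
  intros E E' L L' FX PX NS.
  pose (q := fun T x => tail r (reach G (proj1_sig T) x)).
  assert (FT : forall T, finite_set (proj1_sig T)).
  { intro T. apply (finite_card (msep_card (proj2_sig T))). }
  assert (Q : forall T x, tail r (reach G (proj1_sig T) x) -> q T = reach G (proj1_sig T) x).
  { intros T x Tx. apply pred_ext. intro y. split; intro H.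
    - apply (tail_same Tx H).
    - apply (tail_comp Tx H). }
  assert (Hq : forall T, dirB T (q T)).
  { intro T. destruct (E _ (FT T)) as (v & Tv). rewrite (Q T v Tv). split; [| eauto].
    apply iscomp_reach. destruct (tail_ex Tv) as (x & R). apply (reach_notin_l R). }
  assert (Tq : forall T, tail r (q T)).
  { intro T. destruct (E _ (FT T)) as (v & Tv). rewrite (Q T v Tv). auto. }
  assert (Tq' : forall T, tail r' (q T)).
  { intro T. destruct (E _ (FT T)) as (v & Tv). rewrite (Q T v Tv).
    apply (nsep_same E' (FT T) (NS T) Tv). }
  assert (Rq : region sgB dirB q).
  { destruct (classic (inhabited sepn)) as [[S] | Em]; [| right; intro S; apply Em; constructor; auto].
    apply orientation_region with S; auto.
    - intros U Y N NQ. destruct (tail_ex2 (Tq U) (Tq Y)) as (y & Uy & Yy).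
      rewrite (Q U y Uy) in NQ. rewrite (Q Y y Yy).
      apply (point_triangle HI (proj2_sig U) (proj2_sig Y) (sepn_neq N)); auto.
      rewrite <- (Q U y Uy). apply Hq.
    - apply between_finite with X; auto. intros T _ _. apply NNPP. intro N.
      destruct (tail_ex (Tq T)) as (x & qx).
      assert (K : forall y, q T y -> reach G X x y).
      { intros y qy. apply (iscomp_shift (proj1 (Hq T))); auto. intros z qz Xz. apply N.
        exists z. auto. }
      apply (sep_not_same PX (v := x)).
      + apply (tail_mono K (Tq T)).
      + apply (tail_mono K (Tq' T)). }
  exists q. split; auto. split; apply lives_region; auto.
Qed.

Lemma rpart_cover x : W x -> exists t, rpart t x.
Proof. intro Wx. destruct (@rpart_edge x x) as (t & H & _); eauto. Qed.

Lemma edge_sides S C (p : {p | region sgB dirB p}) : dirB S C -> proj1_sig p = orient sgB S C ->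
  (forall x, edge_sepA (D := tdB) (inl S) (inr p) x <-> W x /\ ~ C x) /\
  (forall x, edge_sepB (D := tdB) (inl S) (inr p) x <-> W x /\ (proj1_sig S x \/ C x)).
Proof.
  intros HC E. pose proof (bside_bridge HC E) as Br.
  pose proof (bridge_sym (@badj_sym _ _ _ _) Br) as Br'.
  pose proof (bridge_sides (@badj_sym _ _ _ _) Br rconnected) as TA.
  pose proof (bridge_sides (@badj_sym _ _ _ _) Br' rconnected) as TB.
  split; intro x; split.
  - intros (t & Ht & Px). split; [apply (part_sub (t0 := tdB) Px) |].
    apply TA in Ht. apply (bside_out HC Ht Px).
  - intros (Wx & Nx). destruct (rpart_cover Wx) as (t & Px).
    destruct (classic (bside (sg := sgB) (dirs := dirB) S C t)) as [B | B].
    + exists (inl S). split; [apply rt_refl |]. destruct (bside_in HC B Px); simpl; tauto.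
    + exists t. split; auto. apply TA. auto.
  - intros (t & Ht & Px). split; [apply (part_sub (t0 := tdB) Px) |].
    apply TB in Ht. apply NNPP in Ht. apply (bside_in HC Ht Px).
  - intros (Wx & [Sx | Cx]).
    + exists (inr p). split; [apply rt_refl |]. simpl. rewrite E. apply orient_sub; auto.
    + destruct (rpart_cover Wx) as (t & Px). exists t. split; auto. apply TB. intro N.
      apply (bside_out HC N Px Cx).
Qed.

End Regions.
(** * The tree of tree-decompositions *)

Section Construction.
Variable G : Graph.
Notation V := (vert G).
Implicit Types (r : nat -> V) (l : list (V -> Prop)).

(** The order treated at depth [n]: every order takes two steps. *)
Definition level n := Nat.div2 n.

Definition step n (W W' : V -> Prop) : Prop :=
  if Nat.odd n
  then exists p, region (@sgB G (level n) W) (@dirB G (level n) W) p /\ W' = bpart p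
  else W' = core (level n) W.

(* A node is the list of vertex sets chosen so far, the current one first; at even length the
   next step removes the dust, at odd length it passes to a region. *)
Fixpoint valid l : Prop :=
  match l with
  | [] => True
  | W :: l => valid l /\ step (length l) (hd full l) W
  end.

Definition good n (W : V -> Prop) :=
  inv (level n) W /\ (Nat.odd n = true -> nodust (level n) W).

Lemma level_even n : Nat.odd n = false -> level (S n) = level n /\ Nat.odd (S n) = true.
Proof.
  intro H. assert (E : Nat.even n = true) by (rewrite <- Nat.negb_odd, H; auto).
  apply Nat.even_spec in E as (m & ->). unfold level.
  rewrite Nat.div2_double, Nat.div2_succ_double. split; auto.
  apply Nat.odd_spec. exists m. lia.
Qed.

Lemma level_odd n : Nat.odd n = true -> level (S n) = S (level n) /\ Nat.odd (S n) = false.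
Proof.
  intro E. apply Nat.odd_spec in E as (m & ->). unfold level.
  replace (2 * m + 1) with (S (2 * m)) by lia. rewrite Nat.div2_succ_double.
  replace (S (S (2 * m))) with (2 * S m) by lia. rewrite Nat.div2_double. split; auto.
  rewrite <- Nat.negb_even. replace (Nat.even (2 * S m)) with true; auto.
  symmetry. apply Nat.even_spec. exists (S m). auto.
Qed.

Lemma step_odd n W W' : Nat.odd n = true -> step n W W' ->
  exists p, region (@sgB G (level n) W) (@dirB G (level n) W) p /\ W' = bpart p.
Proof. unfold step. intros ->. auto. Qed.

Lemma step_even n W W' : Nat.odd n <> true -> step n W W' -> W' = core (level n) W.
Proof. unfold step. destruct (Nat.odd n); tauto. Qed.

Lemma inv_full : inv 0 (@full V).
Proof. split; intros; [lia | exact Logic.I]. Qed.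

Lemma step_good n W W' : good n W -> step n W W' -> good (S n) W'.
Proof.
  intros (HI & ND) St. unfold step in St. destruct (Nat.odd n) eqn:O.
  - destruct St as (p & Rp & ->). destruct (level_odd O) as (E & O').
    split; [rewrite E; apply inv_region; auto | congruence].
  - subst W'. destruct (level_even O) as (E & O').
    split; intros; rewrite E; [apply inv_core | apply nodust_core]; auto.
Qed.

Lemma step_sub n W W' x : step n W W' -> W' x -> W x.
Proof.
  unfold step. destruct (Nat.odd n).
  - intros (p & _ & ->) (Wx & _). auto.
  - intros -> (Wx & _). auto.
Qed.

Lemma valid_good l : valid l -> good (length l) (hd full l).
Proof.
  induction l as [|W l IH].
  - intros _. split; [apply inv_full | discriminate].
  - intros (Hl & St). apply (step_good (IH Hl) St).
Qed.

Definition tdof n (W : V -> Prop) (H : good n W) : TD W (torso W) :=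
  match Bool.bool_dec (Nat.odd n) true with
  | left e => tdB (proj1 H) (proj2 H e)
  | right _ => tdA (proj1 H)
  end.

(** * The rooted tree of states *)

Definition lnode := {l | valid l}.

Definition ladj (s t : lnode) : Prop :=
  (exists W, proj1_sig t = W :: proj1_sig s) \/ (exists W, proj1_sig s = W :: proj1_sig t).

Definition lroot : lnode := exist _ [] Logic.I.

Lemma lnode_eq (s t : lnode) : proj1_sig s = proj1_sig t -> s = t.
Proof. destruct s as (s & Hs), t as (t & Ht). simpl. intros ->. f_equal. apply proof_irrelevance. Qed.

Lemma ladj_sym s t : ladj s t -> ladj t s.
Proof. unfold ladj. tauto. Qed.

Lemma ladj_irrefl s : ~ ladj s s.
Proof.
  intros [(W & E) | (W & E)]; apply (f_equal (@length _)) in E; simpl in E; lia.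
Qed.

Lemma ladj_bridge (s t : lnode) W : proj1_sig t = W :: proj1_sig s ->
  bridge ladj s t (fun u => exists l, proj1_sig u = l ++ proj1_sig t).
Proof.
  intro E. split; [| split].
  - intros (l & E'). rewrite E in E'. apply (f_equal (@length _)) in E'.
    rewrite length_app in E'. simpl in E'. lia.
  - exists []. auto.
  - intros x y [(U & A) | (U & A)] N (l & Hl).
    + destruct l as [|U' l].
      * simpl in Hl. assert (y = t) by (apply lnode_eq; auto). subst y. split; auto.
        apply lnode_eq. congruence.
      * exfalso. apply N. exists l. rewrite Hl in A. injection A. auto.
    + exfalso. apply N. exists (U :: l). rewrite A, Hl. auto.
Qed.

Lemma lconnected s t : clos_refl_trans lnode ladj s t.
Proof.
  assert (K : forall l (H : valid l), clos_refl_trans lnode ladj lroot (exist _ l H)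
      /\ clos_refl_trans lnode ladj (exist _ l H) lroot).
  { induction l as [|W l IH]; intro H.
    - destruct H. split; apply rt_refl.
    - pose proof H as (Hl & _). destruct (IH Hl) as (IH1 & IH2).
      assert (A : ladj (exist _ l Hl) (exist _ (W :: l) H)) by (left; exists W; auto).
      split; [eapply rt_trans; [apply IH1 |] | eapply rt_trans; [| apply IH2]];
        apply rt_step; auto using ladj_sym. }
  destruct s as (s & Hs), t as (t & Ht). apply rt_trans with lroot; apply K.
Qed.

Lemma ltree : is_tree ladj.
Proof.
  apply bridges_tree.
  - apply ladj_sym.
  - apply ladj_irrefl.
  - constructor. exact lroot.
  - apply lconnected.
  - intros s t [(W & E) | (W & E)].
    + eexists. apply (ladj_bridge E).
    + eexists. apply bridge_sym; [apply ladj_sym |]. apply (ladj_bridge E).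
Qed.

Lemma lchild s t : child ladj lroot s t -> exists W, proj1_sig t = W :: proj1_sig s.
Proof.
  intros (A & P). pose proof A as [H | (W & E)]; auto. exfalso.
  assert (N : s <> lroot) by (intros ->; discriminate).
  destruct (on_path_bridge ladj_sym P N) as (u & Au & B).
  destruct Au as [(U & Eu) | (U & Eu)].
  - rewrite E in Eu. injection Eu as -> Eu. assert (u = t) by (apply lnode_eq; auto). subst u.
    destruct (B _ (ladj_bridge E)) as (_ & (l & Hl)). rewrite E in Hl.
    apply (f_equal (@length _)) in Hl. rewrite length_app in Hl. simpl in Hl. lia.
  - destruct (B _ (bridge_sym ladj_sym (ladj_bridge Eu))) as (B1 & _). apply NNPP in B1.
    destruct B1 as (l & Hl). rewrite Eu in Hl. destruct l; discriminate.
Qed.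

Definition lgraph (t : lnode) : V -> Prop := hd full (proj1_sig t).

Definition ltd (t : lnode) : TD (lgraph t) (torso (lgraph t)) := tdof (valid_good (proj2_sig t)).

Lemma step_torso n W W' (H : good n W) : step n W W' -> exists u : tnode (tdof H),
  (forall x, W' x <-> part u x) /\ forall x y, torso W' x y <-> torso_adj u x y.
Proof.
  intro St. unfold tdof. destruct (Bool.bool_dec (Nat.odd n) true) as [e | e].
  - apply (step_odd e) in St as (p & Rp & ->). exists (inr (exist _ p Rp)). split; [simpl; tauto |].
    apply (torso_region (proj1 H) (proj2 H e) (exist _ p Rp)).
  - apply (step_even e) in St. subst W'. exists None. split; [simpl; tauto |].
    apply torso_core.
Qed.

(** Only the values of [f] at children matter. It is injective there because the vertex set of the
    torso is the one entry by which the list of a child extends that of [t]. *)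
Lemma lchild_torso t : exists f : lnode -> tnode (ltd t),
  (forall c, child ladj lroot t c ->
     (forall x, lgraph c x <-> part (f c) x) /\
     (forall x y, torso (lgraph c) x y <-> torso_adj (f c) x y)) /\
  (forall c c', child ladj lroot t c -> child ladj lroot t c' -> f c = f c' -> c = c').
Proof.
  assert (K : forall c, exists u : tnode (ltd t), child ladj lroot t c ->
     (forall x, lgraph c x <-> part u x) /\
     (forall x y, torso (lgraph c) x y <-> torso_adj u x y)).
  { intro c. destruct (classic (child ladj lroot t c)) as [Ch | N].
    - destruct (lchild Ch) as (W & E). pose proof (proj2_sig c) as Hc. rewrite E in Hc.
      destruct Hc as (_ & St).
      destruct (step_torso (valid_good (proj2_sig t)) St) as (u & Hu).
      assert (EW : lgraph c = W) by (unfold lgraph; rewrite E; auto).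
      exists u. intros _. rewrite EW. exact Hu.
    - destruct (t_tree (ltd t)) as ([u] & _). exists u. tauto. }
  assert (F : exists f, forall c, child ladj lroot t c ->
     (forall x, lgraph c x <-> part (f c : tnode (ltd t)) x) /\
     (forall x y, torso (lgraph c) x y <-> torso_adj (f c) x y)).
  { exists (fun c => proj1_sig (constructive_indefinite_description _ (K c))).
    intro c. apply (proj2_sig (constructive_indefinite_description _ (K c))). }
  clear K. destruct F as (f & F). exists f. split; [exact F |]. intros c c' Ch Ch' E.
  destruct (F c Ch) as (Hc & _), (F c' Ch') as (Hc' & _). rewrite <- E in Hc'.
  destruct (lchild Ch) as (W & EW), (lchild Ch') as (W' & EW').
  apply lnode_eq. rewrite EW, EW'. f_equal.
  unfold lgraph in Hc, Hc'. rewrite EW in Hc. rewrite EW' in Hc'. simpl in Hc, Hc'.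
  apply pred_ext. intro x. rewrite Hc, Hc'. tauto.
Qed.

Lemma torso_full x y : torso (@full V) x y <-> adj G x y.
Proof.
  split.
  - intros (_ & _ & _ & [A | (a & b & _ & R & _)]); auto.
    destruct (reach_notin_l R). exact Logic.I.
  - intro A. split; [exact Logic.I | split; [exact Logic.I | split; auto]].
    intros ->. apply (adj_irrefl A).
Qed.

Definition end_totd : ToTD G.
Proof.
  refine (@Build_ToTD G lnode ladj ltree lroot lgraph (fun t => torso (lgraph t)) _ _ ltd lchild_torso).
  - intro x. exact Logic.I.
  - apply torso_full.
Defined.

(** * Rays and end profiles *)

Lemma list_avoid (r : nat -> V) (ls : list V) : (forall m n, r m = r n -> m = n) ->
  exists N, forall n, N <= n -> ~ In (r n) ls.
Proof.
  intro inj. induction ls as [|v ls (N & H)].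
  - exists 0. simpl. auto.
  - destruct (classic (exists m, r m = v)) as [(m & E) | Nv].
    + exists (N + S m). intros n L [E' | I].
      * rewrite <- E in E'. apply inj in E'. lia.
      * apply (H n); auto. lia.
    + exists N. intros n L [E' | I]; [eauto | apply (H n); auto].
Qed.

Lemma ray_end (r : ray G) : isend (rv r).
Proof.
  intros S F. destruct (list_finite F) as (ls & Hl).
  destruct (@list_avoid (rv r) ls (@rv_inj _ r)) as (N & H).
  assert (NS : forall n, N <= n -> ~ S (rv r n)) by (intros n L Sn; apply (H n L), Hl, Sn).
  exists (rv r N), N. intros n L. induction L as [|n L IH].
  - apply reach_refl, NS; auto.
  - apply reach_next with (rv r n); [apply IH | apply rv_adj | apply NS; lia].
Qed.

Lemma ray_equiv_tail (r r' : ray G) S v : ray_equiv r r' -> finite_set S ->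
  tail (rv r) (reach G S v) -> tail (rv r') (reach G S v).
Proof.
  intros E F T. destruct (E S F) as (w & _ & N & H).
  assert (Tw : tail (rv r) (reach G S w)) by (exists N; intros; apply H; auto).
  apply (tail_comp (v := w)); [exists N; intros; apply H; auto |].
  apply (tail_same Tw T).
Qed.

Lemma ray_equiv_refl (r : ray G) : ray_equiv r r.
Proof.
  intros S F. destruct (ray_end r F) as (v & N & H). exists v. split.
  - apply (reach_notin_l (H N (le_n N))).
  - exists N. auto.
Qed.

Lemma sep_of_is_sep_side (A B : V -> Prop) : is_sep full (adj G) A B ->
  side (setI A B) (fun x => B x /\ ~ A x).
Proof.
  intros (H1 & H2). split; [unfold setI; tauto |].
  intros x y (Bx & Ax) E N. assert (Cy : A y \/ B y) by (apply H1; exact Logic.I).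
  destruct (classic (A y)) as [Ay | Ny]; [| tauto]. exfalso.
  destruct (classic (B y)) as [By | NB]; [apply N; split; auto |].
  apply (H2 y x); auto. apply adj_sym; auto.
Qed.

(** A tail avoids the finite set [A] and [B], and [B - A] is a union of components of the rest; so
    containment of the component and of one tail in [B] amount to the same. *)
Lemma P_end_tail (w : ray G -> Prop) (r : ray G) A B : (forall r' : ray G, w r' <-> ray_equiv r r') ->
  P_end w A B <-> is_sep full (adj G) A B /\ finite_set (setI A B) /\ tail (rv r) B.
Proof.
  intro Hw. split.
  - intros (Sp & F & H). split; auto. split; auto.
    destruct (ray_end r F) as (v & T).
    assert (Nv : ~ setI A B v) by (destruct (tail_ex T) as (x & R); apply (reach_notin_l R)).
    generalize T. apply tail_mono. apply H; auto.
    intros r' W'. apply Hw in W'. apply (ray_equiv_tail W' F T).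
  - intros (Sp & F & T). split; auto. split; auto. intros v Nv H x R.
    assert (Tv : tail (rv r) (reach G (setI A B) v)).
    { apply H. apply Hw, ray_equiv_refl. }
    assert (T' : tail (rv r) (fun x => B x /\ ~ A x)).
    { generalize (tail_and T (tail_avoid (ray_end r) F)). apply tail_mono.
      unfold setI. tauto. }
    pose proof (sep_of_is_sep_side Sp) as Sd.
    apply (side_reach Sd (tail_reach_side Sd T' Tv) R).
Qed.

Definition tail_profile r (P : sepset V) :=
  forall A B, P A B <-> is_sep full (adj G) A B /\ finite_set (setI A B) /\ tail r B.

Lemma end_profile_ray P : end_profiles G P -> exists r : ray G, tail_profile (rv r) P.
Proof.
  intros (w & (r & Hw) & HP). exists r. intros A B. rewrite HP. apply P_end_tail; auto.
Qed.

Lemma tail_B_A r A B : isend r -> finite_set (setI A B) -> tail r B -> tail r (fun x => B x /\ ~ A x).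
Proof.
  intros E F T. generalize (tail_and T (tail_avoid E F)). apply tail_mono. unfold setI. tauto.
Qed.

Lemma is_sep_sep r r' A B : isend r -> isend r' -> is_sep full (adj G) A B ->
  finite_set (setI A B) -> tail r B -> ~ tail r' B -> sep (setI A B) r r'.
Proof.
  intros E E' Sp F T N. pose proof (sep_of_is_sep_side Sp) as Sd.
  apply (sep_side E E' F Sd).
  - apply tail_B_A; auto.
  - destruct (tail_side E' F Sd) as [H | H].
    + exfalso. apply N. revert H. apply tail_mono. tauto.
    + revert H. apply tail_mono. tauto.
Qed.

Lemma tail_not_other r A B : isend r -> finite_set (setI A B) -> tail r A -> ~ tail r B.
Proof.
  intros E F T T'. destruct (tail_ex2 (tail_and T T') (tail_avoid E F)) as (x & H & N). auto.
Qed.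

Lemma setI_comm (A B : V -> Prop) : setI A B = setI B A.
Proof. apply pred_ext. unfold setI. tauto. Qed.

Lemma distinct_sep r r' P Q : isend r -> isend r' -> tail_profile r P -> tail_profile r' Q ->
  ~ (forall A B, P A B <-> Q A B) -> exists S, finite_set S /\ sep S r r'.
Proof.
  intros E E' HP HQ N.
  apply not_all_ex_not in N as (A & N). apply not_all_ex_not in N as (B & N).
  rewrite (HP A B), (HQ A B) in N.
  assert (D : is_sep full (adj G) A B /\ finite_set (setI A B) /\
    ((tail r B /\ ~ tail r' B) \/ (tail r' B /\ ~ tail r B))) by tauto.
  destruct D as (Sp & F & [(T & NT) | (T & NT)]); exists (setI A B); split; auto.
  - apply is_sep_sep; auto.
  - apply sep_sym, is_sep_sep; auto.
Qed.

Lemma distinguishes_sep r r' P Q A B : isend r -> isend r' -> tail_profile r P -> tail_profile r' Q ->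
  distinguishes P Q A B -> sep (setI A B) r r'.
Proof.
  intros E E' HP HQ [(H1 & H2) | (H1 & H2)].
  - apply HP in H1 as (Sp & F & T). apply HQ in H2 as (_ & _ & T').
    apply is_sep_sep; auto. apply tail_not_other with A; auto.
  - apply HQ in H1 as (Sp & F & T). apply HP in H2 as (_ & _ & T').
    apply sep_sym, is_sep_sep; auto. apply tail_not_other with A; auto.
Qed.

(** * Induced separations of torsos *)

(** A walk of [G] induces one in the torso, since every excursion outside [W] is bridged by a torso
    edge. Separators of torsos therefore separate in [G]. *)
Lemma torso_sep_reach (W C D : V -> Prop) x y : is_sep W (torso W) C D -> W x -> C x -> ~ D x ->
  reach G (setI C D) x y -> W y -> C y /\ ~ D y.
Proof.
  intros (H1 & H2) Wx Cx Dx R.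
  assert (K : forall y z, W y -> C y /\ ~ D y -> torso W y z -> ~ setI C D z -> C z /\ ~ D z).
  { intros u z Wu (Cu & Du) T Nz. pose proof T as (_ & Wz & _).
    apply H1 in Wz. unfold setI in Nz. pose proof (H2 u z Cu Du). tauto. }
  (* Outside [W], the invariant remembers the last vertex [u] of [W] on the walk and the excursion
     since. *)
  assert (L : (W y -> C y /\ ~ D y) /\ (~ W y -> exists u a, W u /\ (C u /\ ~ D u) /\
      adj G u a /\ reach G W a y)); [| tauto].
  pattern y. apply (reach_ind (S := setI C D) (x := x)); auto; [tauto |].
  clear y R. intros y z _ _ (IH1 & IH2) A Nz. destruct (classic (W y)) as [Wy | Ny].
  - specialize (IH1 Wy). split.
    + intro Wz. apply (K y z); auto. split; auto. split; auto. split; auto.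
      intros ->. apply (adj_irrefl A).
    + intro NW. exists y, z. split; auto. split; auto. split; auto. apply reach_refl; auto.
  - destruct (IH2 Ny) as (u & a & Wu & Cu & Aa & R). split.
    + intro Wz. destruct (classic (u = z)) as [-> | Nu]; auto.
      apply (K u z); auto. split; auto. split; auto. split; auto. right. exists a, y. auto.
    + intro NW. exists u, a. split; auto. split; auto. split; auto. apply reach_next with y; auto.
Qed.

(** A walk outside [W] avoids [A] and [B], hence stays on one side, so torso edges do not cross the
    separation. *)
Lemma sep_trace (W A B : V -> Prop) : is_sep full (adj G) A B -> (forall x, setI A B x -> W x) ->
  is_sep W (torso W) (fun x => A x /\ W x) (fun x => B x /\ W x).
Proof.
  intros Sp Sub. pose proof (sep_of_is_sep_side Sp) as Sd. pose proof Sp as (H1 & H2). split.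
  - intro x. assert (A x \/ B x) by (apply H1; exact Logic.I). tauto.
  - intros x y (Ax & Wx) NB (By & Wy) NA (_ & _ & _ & [E | (a & b & E & R & E')]).
    + apply (H2 x y); tauto.
    + assert (R' : reach G (setI A B) a b) by (apply (reach_mono Sub R)).
      assert (Hb : B b /\ ~ A b).
      { apply (proj2 Sd) with y; [tauto | apply adj_sym; auto | apply (reach_notin_r R')]. }
      assert (Ha : B a /\ ~ A a) by (apply (side_reach Sd Hb); apply reach_sym; auto).
      assert (Hx : B x /\ ~ A x).
      { apply (proj2 Sd) with a; auto; [apply adj_sym; auto | unfold setI; tauto]. }
      tauto.
Qed.

Lemma fold_restrict_sub (X : ToTD G) ps : forall (P : sepset V) A' B',
  fold_left (fun Q c => restrict_sep (X := X) Q c) ps P A' B' ->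
  exists A B, P A B /\ (forall x, A' x -> A x) /\ (forall x, B' x -> B x).
Proof.
  induction ps as [|c ps IH]; intros P A' B' H.
  - exists A', B'. auto.
  - apply IH in H as (A1 & B1 & (_ & A & B & HP & HA & HB) & HA' & HB').
    exists A, B. split; auto. split; intros x Hx; [apply HA, HA', Hx | apply HB, HB', Hx].
Qed.

(** The inducing separation of [G] may have separator vertices outside the torso. Deleting its
    separator together with that of [C], [D] is still a finite deletion, and [lives] supplies a
    vertex of the torso in the remaining component of [r]. *)
Lemma indP_tail (t : lnode) r P C D m : isend r -> tail_profile r P -> lives (lgraph t) r ->
  is_sep (lgraph t) (torso (lgraph t)) C D -> has_card (setI C D) m ->
  indP (X := end_totd) P t C D ->
  exists v, tail r (reach G (setI C D) v) /\ lgraph t v /\ D v /\ ~ C v.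
Proof.
  intros E HP L (H1 & _) HF (ps & _ & Hf). apply fold_restrict_sub in Hf as (A & B & PAB & HA & HB).
  apply HP in PAB as (Sp & F & T).
  destruct (L (fun x => setI C D x \/ setI A B x)) as (v & Wv & Tv).
  { apply finite_union; auto. apply (finite_card HF). }
  exists v. split; [| split; auto].
  - revert Tv. apply tail_mono. intro x. apply reach_mono. auto.
  - pose proof (sep_of_is_sep_side Sp) as Sd.
    assert (Tv' : tail r (reach G (setI A B) v)).
    { revert Tv. apply tail_mono. intro x. apply reach_mono. auto. }
    destruct (tail_reach_side Sd (tail_B_A E F T) Tv') as (Bv & Av).
    apply H1 in Wv. assert (~ C v) by auto. tauto.
Qed.

Lemma indP_distinguishes_sep (t : lnode) r r' P Q C D m : isend r -> isend r' ->
  tail_profile r P -> tail_profile r' Q -> lives (lgraph t) r -> lives (lgraph t) r' ->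
  is_sep (lgraph t) (torso (lgraph t)) C D -> has_card (setI C D) m ->
  distinguishes (indP (X := end_totd) P t) (indP (X := end_totd) Q t) C D ->
  sep (setI C D) r r'.
Proof.
  intros E E' HP HQ L L' Sp HF Dist.
  assert (Sp' : is_sep (lgraph t) (torso (lgraph t)) D C).
  { destruct Sp as (H1 & H2). split; [intro x; rewrite H1; tauto |].
    intros x y Dx Nx Cy Ny T. apply (H2 y x); auto. apply torso_sym; auto. }
  assert (HF' : has_card (setI D C) m) by (rewrite setI_comm; auto).
  assert (K : forall q q' v v', tail q (reach G (setI C D) v) -> tail q' (reach G (setI C D) v') ->
    lgraph t v -> lgraph t v' -> D v -> ~ C v -> C v' -> ~ D v' -> sep (setI C D) q q').
  { intros q q' v v' T T' Wv Wv' Dv Cv Cv' Dv'. exists v, v'. split; auto. split; auto.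
    intro R. destruct (torso_sep_reach Sp Wv' Cv' Dv' (reach_sym R) Wv). auto. }
  destruct Dist as [(H1 & H2) | (H1 & H2)].
  - destruct (indP_tail E HP L Sp HF H1) as (v & T & Wv & Dv & Cv).
    destruct (indP_tail E' HQ L' Sp' HF' H2) as (v' & T' & Wv' & Cv' & Dv').
    rewrite setI_comm in T'. apply (K r r' v v'); auto.
  - destruct (indP_tail E' HQ L' Sp HF H1) as (v & T & Wv & Dv & Cv).
    destruct (indP_tail E HP L Sp' HF' H2) as (v' & T' & Wv' & Cv' & Dv').
    rewrite setI_comm in T'. apply sep_sym, (K r' r v v'); auto.
Qed.

Lemma chain_snoc (T : Type) (a : T -> T -> Prop) (p : list T) (x y z : T) :
  hd_error p = Some x -> last p x = y -> chain a p -> a y z -> chain a (p ++ [z]).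
Proof.
  destruct p as [|x' p]; [discriminate |]. intros E. injection E as ->. rewrite last_cons.
  revert x. induction p as [|w p IH]; intros x L C A.
  - simpl in *. subst. auto.
  - simpl in C. rewrite last_cons in L. destruct C as (C1 & C2).
    split; [exact C1 | apply (IH w); auto].
Qed.

(** The sets along the path decrease, so the separator lies in each of them and every restriction is
    a separation. The length bound shows that the appended node is new on the path. *)
Lemma trace_indP_aux l (H : valid l) : exists ps,
  is_path ladj lroot (exist _ l H) ps /\
  (forall s, In s ps -> length (proj1_sig s) <= length l) /\
  forall (P : sepset V) A B, P A B -> is_sep full (adj G) A B ->
    (forall x, setI A B x -> hd full l x) ->
    fold_left (fun Q c => restrict_sep (X := end_totd) Q c) (tl ps) P
      (fun x => A x /\ hd full l x) (fun x => B x /\ hd full l x).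
Proof.
  revert H. induction l as [|W l IH]; intro H.
  - exists [lroot]. split; [| split].
    + destruct H. split; auto. split; auto. split; simpl; auto. repeat constructor; auto.
    + intros s [<- | []]. auto.
    + intros P A B HP _ _. simpl.
      assert (K : forall D : V -> Prop, (fun x => D x /\ full x) = D).
      { intro D. apply pred_ext. unfold full. tauto. }
      rewrite !K. auto.
  - pose proof H as (Hl & St). destruct (IH Hl) as (ps & (Hh & Hlast & Hc & Hn) & Hlen & Hf).
    exists (ps ++ [exist _ (W :: l) H]). destruct ps as [|s ps]; [discriminate |].
    split; [split; [| split; [| split]] | split].
    + simpl in *. auto.
    + apply last_last.
    + apply chain_snoc with lroot (exist _ l Hl); auto.
      left. exists W. auto.
    + apply NoDup_app; auto; [repeat constructor; auto |].
      intros u Hu [<- | []]. apply Hlen in Hu. simpl in Hu. lia.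
    + intros u Hu. apply in_app_or in Hu as [Hu | [<- | []]]; [apply Hlen in Hu |]; simpl; lia.
    + intros P A B HP Sp Sub. simpl tl. rewrite fold_left_app.
      assert (Sub' : forall x, setI A B x -> hd full l x).
      { intros x Hx. apply (step_sub St). apply Sub; auto. }
      split; [apply sep_trace; auto |].
      exists (fun x => A x /\ hd full l x), (fun x => B x /\ hd full l x).
      split; [apply (Hf P A B); auto |].
      assert (Wl : forall x, W x -> hd full l x) by (intro x; apply (step_sub St)).
      split; intro x; specialize (Wl x); simpl; unfold lgraph; simpl; tauto.
Qed.

Lemma trace_indP (t : lnode) P A B : P A B -> is_sep full (adj G) A B ->
  (forall x, setI A B x -> lgraph t x) ->
  indP (X := end_totd) P t (fun x => A x /\ lgraph t x) (fun x => B x /\ lgraph t x).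
Proof.
  intros HP Sp Sub. destruct t as (l & H). destruct (trace_indP_aux H) as (ps & Hp & _ & Hf).
  exists ps. split; auto.
Qed.

(** * Efficient distinction *)

(** Until depth [1 + 2 * k] the trees passed belong to orders below [k], whose separators are too
    small to separate the ends. At that depth the dust of order [k] is gone and the tree of order
    [k] is next. *)
Lemma common_node k r r' n : eff k r r' -> n <= 1 + 2 * k ->
  exists l, valid l /\ length l = n /\ lives (hd full l) r /\ lives (hd full l) r'.
Proof.
  intros E. pose proof E as (Er & Er' & (X & HX & PX) & M).
  induction n as [|n IH]; intro L.
  - exists []. simpl. repeat split; auto; apply lives_full; auto.
  - destruct IH as (l & Hl & Len & Lr & Lr'); [lia |].
    pose proof (valid_good Hl) as (HI & ND).
    assert (K : exists W, step (length l) (hd full l) W /\ lives W r /\ lives W r').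
    { unfold step. destruct (Nat.odd (length l)) eqn:O.
      - destruct (@region_of_ends G (level (length l)) (hd full l) HI (ND eq_refl) r r' X)
          as (p & Rp & Lp & Lp'); auto.
        + apply (finite_card HX).
        + intros T P. pose proof (M _ _ (msep_card (proj2_sig T)) P) as Hk.
          apply Nat.odd_spec in O as (m & Em). unfold level in Hk. rewrite Em in Hk.
          replace (2 * m + 1) with (S (2 * m)) in Hk by lia. rewrite Nat.div2_succ_double in Hk. lia.
        + exists (bpart p). eauto.
      - exists (core (level (length l)) (hd full l)). split; auto.
        split; apply lives_core; auto. }
    destruct K as (W & St & LW & LW'). exists (W :: l). simpl. auto.
Qed.

Theorem end_totd_distinguishes P Q : end_profiles G P -> end_profiles G Q ->
  ~ (forall A B, P A B <-> Q A B) -> totd_dist_eff end_totd P Q.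
Proof.
  intros EP EQ N. destruct (end_profile_ray EP) as (ry & HP), (end_profile_ray EQ) as (ry' & HQ).
  pose proof (ray_end ry) as E. pose proof (ray_end ry') as E'.
  remember (rv ry) as r. remember (rv ry') as r'. clear Heqr Heqr' ry ry' EP EQ.
  destruct (distinct_sep E E' HP HQ N) as (X & FX & PX).
  destruct (eff_exists E E' FX PX) as (k & Ek). clear X FX PX N.
  destruct (common_node Ek (le_n _)) as (l & Hl & Len & L & L').
  pose (t := exist _ l Hl : lnode).
  destruct (opt_exists Ek) as (S & O & HS & PS).
  assert (Od : Nat.odd (length l) = true).
  { apply Nat.odd_spec. exists k. lia. }
  assert (Lk : level (length l) = k).
  { unfold level. rewrite Len. apply (Nat.div2_succ_double k). }
  set (W := hd full l) in *.
  assert (M : msep (level (length l)) W S).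
  { rewrite Lk. split; auto. exists r, r'. auto 6. }
  pose (HG := valid_good Hl : good (length l) W).
  assert (SW : forall x, S x -> W x) by (intro x; apply (msep_sub (proj1 HG) M)).
  pose proof PS as (_ & v' & _ & T' & _). pose (C := reach G S v').
  assert (LC : lcomp W S C).
  { split; [| eauto]. apply iscomp_reach. destruct (tail_ex T') as (x & R). apply (reach_notin_l R). }
  (* The sides are chosen to match the edge from [S] to the region in direction [C], see
     [edge_sides]. *)
  pose (A := fun x => ~ C x). pose (B := fun x => S x \/ C x).
  assert (NSC : forall x, C x -> ~ S x) by (intros x; apply (iscomp_notin (proj1 LC))).
  assert (AB : setI A B = S).
  { apply pred_ext. intro x. specialize (NSC x). unfold setI, A, B. tauto. }
  assert (Sp : is_sep full (adj G) A B).
  { split.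
    - intro x. unfold A, B, full. tauto.
    - unfold A, B. intros x y Ax Bx By Ay Adj. apply Bx. right.
      apply (proj2 (iscomp_side (proj1 LC))) with y; [tauto | apply adj_sym; auto | tauto]. }
  assert (Sp' : is_sep full (adj G) B A).
  { destruct Sp as (H1 & H2). split; [intro x; rewrite H1; tauto |].
    intros x y ? ? ? ? Adj. apply (H2 y x); auto. apply adj_sym; auto. }
  assert (QAB : Q A B).
  { apply HQ. split; auto. split; [rewrite AB; apply (finite_card HS) |].
    revert T'. apply tail_mono. unfold B. auto. }
  assert (PBA : P B A).
  { apply HP. split; auto. split; [rewrite setI_comm, AB; apply (finite_card HS) |].
    apply (sep_tail (sep_sym PS) T'). }
  assert (Sides : exists s u : tnode (tdof HG), tadj s u /\
    (forall x, edge_sepA s u x <-> W x /\ A x) /\ (forall x, edge_sepB s u x <-> W x /\ B x)).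
  { unfold tdof. destruct (Bool.bool_dec (Nat.odd (length l)) true) as [e | e]; [| tauto].
    pose (Sn := exist _ S M : sepn (level (length l)) W).
    assert (DC : dirB Sn C) by exact LC.
    assert (Rp : region (@sgB G (level (length l)) W) (@dirB G (level (length l)) W)
       (orient (@sgB G _ _) Sn C)) by (left; eauto).
    exists (inl Sn), (inr (exist _ _ Rp)). split; [simpl; eauto |].
    apply (edge_sides (proj1 HG) (proj2 HG e)); auto. }
  destruct Sides as (s & u & Adj & HA & HB).
  exists t, s, u. split; auto.
  assert (EA : edge_sepA (D := tdof HG) s u = fun x => A x /\ W x).
  { apply pred_ext. intro x. rewrite HA. tauto. }
  assert (EB : edge_sepB (D := tdof HG) s u = fun x => B x /\ W x).
  { apply pred_ext. intro x. rewrite HB. tauto. }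
  split.
  - assert (Eff : eff_dist W (torso W) (indP (X := end_totd) P t) (indP (X := end_totd) Q t)
      (fun x => A x /\ W x) (fun x => B x /\ W x)).
    { assert (Sub : forall x, setI A B x -> W x) by (rewrite AB; auto).
      assert (Sub' : forall x, setI B A x -> W x) by (rewrite setI_comm; auto).
      split; [apply sep_trace; auto |]. split.
      - right. split; [apply (@trace_indP t Q A B) | apply (@trace_indP t P B A)]; auto.
      - exists k. split.
        + revert HS. rewrite <- AB at 1. apply card_ext. intro x. specialize (Sub x).
          unfold setI in *. tauto.
        + intros C' D' m SpC Dist HC.
          apply (proj2 (proj2 (proj2 Ek)) _ _ HC).
          apply (@indP_distinguishes_sep t r r' P Q C' D' m); auto. }
    rewrite <- EA, <- EB in Eff. exact Eff.
  - exists A, B. split; [| split].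
    + split; auto. split; [right; auto |]. exists k. split; [rewrite AB; auto |].
      intros C' D' m _ Dist HC. apply (proj2 (proj2 (proj2 Ek)) _ _ HC).
      apply (distinguishes_sep E E' HP HQ Dist).
    + intro x. change (edge_sepA (D := tdof HG) s u x <-> A x /\ W x). rewrite EA. tauto.
    + intro x. change (edge_sepB (D := tdof HG) s u x <-> B x /\ W x). rewrite EB. tauto.
Qed.

End Construction.
(** * Canonicity *)

(** With the inverse carried along the notion is symmetric, so one implication per definition
    suffices; converses come from [iso_sym]. *)
Definition iso (G G' : Graph) (f : vert G -> vert G') (g : vert G' -> vert G) :=
  (forall x, g (f x) = x) /\ (forall y, f (g y) = y) /\
  (forall x y, adj G x y <-> adj G' (f x) (f y)).

(** The image under the isomorphism, written as a preimage under its inverse so that membership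
    unfolds by computation. *)
Definition tr (V V' : Type) (g : V' -> V) (A : V -> Prop) : V' -> Prop := fun y => A (g y).

Lemma card_tr (V V' : Type) (f : V -> V') (g : V' -> V) (A : V -> Prop) n :
  (forall x, g (f x) = x) -> (forall y, f (g y) = y) -> has_card A n -> has_card (tr g A) n.
Proof.
  intros gf fg (l & ND & L & H). exists (map f l). split; [| split].
  - apply Injective_map_NoDup; auto. intros x y E. rewrite <- (gf x), E. auto.
  - rewrite length_map. auto.
  - intro y. unfold tr. rewrite H, in_map_iff. split.
    + intro I. exists (g y). auto.
    + intros (x & <- & I). rewrite gf. auto.
Qed.

Lemma iso_sym (G G' : Graph) f g : iso (G := G) (G' := G') f g -> iso g f.
Proof.
  intros (gf & fg & H). split; auto. split; auto. intros x y. rewrite H, !fg. tauto.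
Qed.

Lemma tr_tr (G G' : Graph) f g (A : vert G -> Prop) : iso (G := G) (G' := G') f g -> tr f (tr g A) = A.
Proof. intros (gf & _). apply pred_ext. intro x. unfold tr. rewrite gf. tauto. Qed.

Lemma seq_cancel (G G' : Graph) f g (r : nat -> vert G) : iso (G := G) (G' := G') f g ->
  (fun n => g (f (r n))) = r.
Proof. intros (gf & _). apply functional_extensionality. intro n. apply gf. Qed.

Section Transfer.
Variables (G G' : Graph) (f : vert G -> vert G') (g : vert G' -> vert G).
Hypothesis HI : iso f g.
Notation V := (vert G).
Implicit Types (S T C D L W : V -> Prop) (r : nat -> V).

Definition fr r : nat -> vert G' := fun n => f (r n).

Lemma tr_f S x : tr g S (f x) <-> S x.
Proof. unfold tr. rewrite (proj1 HI). tauto. Qed.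

Lemma tr_has_card S k : has_card S k -> has_card (tr g S) k.
Proof. apply card_tr with f; apply HI. Qed.

Lemma tr_finite S : finite_set S -> finite_set (tr g S).
Proof. intros (n & H). exists n. apply tr_has_card, H. Qed.

Lemma tr_reach S x y : reach G S x y -> reach G' (tr g S) (f x) (f y).
Proof.
  intro R. pose proof (reach_notin_l R) as N. pattern y.
  apply (reach_ind (S := S) (x := x)); auto.
  - apply reach_refl. rewrite tr_f. auto.
  - intros u v _ _ R' A Nv. apply reach_next with (f u); auto; [apply HI, A | rewrite tr_f; auto].
Qed.

Lemma tr_tail r C : tail r C -> tail (fr r) (tr g C).
Proof. intros (N & H). exists N. intros n L. apply tr_f. auto. Qed.

End Transfer.

Section TransferRelations.
Variables (G G' : Graph) (f : vert G -> vert G') (g : vert G' -> vert G).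
Hypothesis HI : iso f g.
Notation V := (vert G).
Implicit Types (S T C D L W : V -> Prop) (r : nat -> V).
Notation fr := (fr f).

Lemma reach_tr S x y : reach G' (tr g S) x y -> reach G S (g x) (g y).
Proof. intro R. rewrite <- (tr_tr S HI). apply (tr_reach (iso_sym HI) R). Qed.

Lemma reach_set S x : tr g (reach G S x) = reach G' (tr g S) (f x).
Proof.
  apply pred_ext. intro y. unfold tr at 1. split; intro R.
  - apply (tr_reach HI) in R. rewrite (proj1 (proj2 HI)) in R. auto.
  - apply reach_tr in R. rewrite (proj1 HI) in R. auto.
Qed.

Lemma isend_tr r : isend r -> isend (fr r).
Proof.
  intros E S F. destruct (E (tr f S) (tr_finite (iso_sym HI) F)) as (v & T). exists (f v).
  apply (tr_tail HI) in T. rewrite reach_set, (tr_tr S (iso_sym HI)) in T. auto.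
Qed.

Lemma sep_tr S r r' : sep S r r' -> sep (tr g S) (fr r) (fr r').
Proof.
  intros (v & v' & T & T' & N). exists (f v), (f v'). rewrite <- !reach_set.
  split; [apply tr_tail; auto | split; [apply tr_tail; auto |]]. rewrite (tr_f HI). auto.
Qed.

Lemma iscomp_tr S C : iscomp S C -> iscomp (tr g S) (tr g C).
Proof.
  intros (v & N & ->). exists (f v). rewrite (tr_f HI). split; auto. apply reach_set.
Qed.

Lemma isfull_tr S C : isfull S C -> isfull (tr g S) (tr g C).
Proof.
  intros H s Ss. destruct (H (g s) Ss) as (c & Cc & A). exists (f c). rewrite (tr_f HI).
  split; auto. apply HI in A. rewrite (proj1 (proj2 HI)) in A. auto.
Qed.

Lemma nest_tr S T : nest S T -> nest (tr g S) (tr g T).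
Proof.
  intros (C & (IC & F & r & E & L) & N). exists (tr g C). split.
  - split; [apply iscomp_tr; auto | split; [apply isfull_tr; auto |]].
    exists (fr r). split; [apply isend_tr; auto | apply tr_tail; auto].
  - intros x. apply N.
Qed.

Lemma lives_tr W r : lives W r -> lives (tr g W) (fr r).
Proof.
  intros L X F. destruct (L (tr f X) (tr_finite (iso_sym HI) F)) as (v & Wv & T). exists (f v).
  rewrite (tr_f HI). split; auto.
  apply (tr_tail HI) in T. rewrite reach_set, (tr_tr X (iso_sym HI)) in T. auto.
Qed.

Lemma torso_tr W x y : torso W x y -> torso (tr g W) (f x) (f y).
Proof.
  intros (Wx & Wy & N & H). split; [apply (tr_f HI); auto | split; [apply (tr_f HI); auto | split]].
  - intro E. apply N. rewrite <- (proj1 HI x), E. apply HI.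
  - destruct H as [A | (a & b & A & R & B)]; [left; apply HI, A |].
    right. exists (f a), (f b). split; [apply HI, A | split; [apply tr_reach; auto | apply HI, B]].
Qed.

Lemma sigma_tr S T : tr g (sigma S T) = sigma (tr g S) (tr g T).
Proof.
  apply pred_ext. intro x. unfold tr at 1. split.
  - intros (t & Tt & Nt & R). exists (f t). rewrite !(tr_f HI). split; auto. split; auto.
    apply (tr_reach HI) in R. rewrite (proj1 (proj2 HI)) in R. auto.
  - intros (t & Tt & Nt & R). exists (g t). split; auto. split; auto. apply (reach_tr R).
Qed.

End TransferRelations.

Lemma sep_back (G G' : Graph) f g : iso (G := G) (G' := G') f g -> forall S (r r' : nat -> vert G),
  sep S (fr f r) (fr f r') -> sep (tr f S) r r'.
Proof.
  intros HI S r r' P. apply (sep_tr (iso_sym HI)) in P. unfold fr in P.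
  rewrite !(seq_cancel _ HI) in P. auto.
Qed.

Lemma eff_tr (G G' : Graph) f g : iso (G := G) (G' := G') f g -> forall k (r r' : nat -> vert G),
  eff k r r' -> eff k (fr f r) (fr f r').
Proof.
  intros HI k r r' (E & E' & (S & H & P) & M).
  split; [apply (isend_tr HI E) | split; [apply (isend_tr HI E') | split]].
  - exists (tr g S). split; [apply (tr_has_card HI H) | apply (sep_tr HI P)].
  - intros T j HT PT. apply (M (tr f T)); [apply (tr_has_card (iso_sym HI) HT) |].
    apply (sep_back HI PT).
Qed.

Definition carries (G G' : Graph) (g : vert G' -> vert G) (N : (vert G -> Prop) -> Prop)
  (N' : (vert G' -> Prop) -> Prop) := forall S, N S -> N' (tr g S).

Lemma cand_tr (G G' : Graph) f g N N' : iso (G := G) (G' := G') f g -> carries f N' N ->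
  forall k r r' S, cand N k r r' S -> cand N' k (fr f r) (fr f r') (tr g S).
Proof.
  intros HI HN k r r' S (H & P & Q). split; [apply (tr_has_card HI H) | split; [apply (sep_tr HI P) |]].
  intros U NU. apply HN, Q in NU. apply (nest_tr HI) in NU. rewrite (tr_tr U (iso_sym HI)) in NU. auto.
Qed.

Lemma cands_tr (G G' : Graph) f g N N' : iso (G := G) (G' := G') f g -> carries f N' N ->
  forall k S, cands N k S -> cands N' k (tr g S).
Proof.
  intros HI HN k S (r & r' & E & C). exists (fr f r), (fr f r').
  split; [apply (eff_tr HI E) | apply (cand_tr HI HN C)].
Qed.

Lemma crossnum_tr (G G' : Graph) f g N N' : iso (G := G) (G' := G') f g ->
  carries g N N' -> carries f N' N -> forall k S n, crossnum N k S n -> crossnum N' k (tr g S) n.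
Proof.
  intros HI HN HN' k S n H.
  generalize (@card_tr _ _ (tr g) (tr f) _ _ (fun A => tr_tr A HI) (fun A => tr_tr A (iso_sym HI)) H).
  apply card_ext. intro U. unfold tr at 1. split; intros (CU & NU); split.
  - apply (cands_tr HI HN') in CU. rewrite (tr_tr U (iso_sym HI)) in CU. auto.
  - intro Q. apply NU. apply (nest_tr (iso_sym HI)) in Q. rewrite (tr_tr S HI) in Q. auto.
  - apply (cands_tr (iso_sym HI) HN CU).
  - intro Q. apply NU. apply (nest_tr HI) in Q. rewrite (tr_tr U (iso_sym HI)) in Q. auto.
Qed.

Lemma opt_tr (G G' : Graph) f g N N' : iso (G := G) (G' := G') f g ->
  carries g N N' -> carries f N' N -> forall k S, opt N k S -> opt N' k (tr g S).
Proof.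
  intros HI HN HN' k S (r & r' & n & E & C & H & M). exists (fr f r), (fr f r'), n.
  split; [apply (eff_tr HI E) | split; [apply (cand_tr HI HN' C) | split]].
  - apply (crossnum_tr HI HN HN' H).
  - intros S' n' C' H'. apply (cand_tr (iso_sym HI) HN) in C'. unfold fr in C'.
    rewrite !(seq_cancel _ HI) in C'. apply (M _ _ C').
    apply (crossnum_tr (iso_sym HI) HN' HN H').
Qed.

(** All graphs and isomorphisms are quantified inside the induction because the step uses the
    hypothesis for the inverse too. *)
Lemma below_tr k : forall (G G' : Graph) f g, iso (G := G) (G' := G') f g ->
  carries g (@below G k) (@below G' k).
Proof.
  induction k as [|k IH]; intros G G' f g HI S; simpl; auto. intros [B | O].
  - left. apply (IH _ _ _ _ HI), B.
  - right. apply (@opt_tr _ _ _ _ (below k) (below k) HI); auto.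
    + apply (IH _ _ _ _ HI).
    + apply (IH _ _ _ _ (iso_sym HI)).
Qed.

Lemma opt_below_tr (G G' : Graph) f g : iso (G := G) (G' := G') f g -> forall k (S : vert G -> Prop),
  opt (below k) k S -> opt (below k) k (tr g S).
Proof.
  intros HI k S. apply (@opt_tr _ _ _ _ (below k) (below k) HI); [apply (below_tr HI) | apply (below_tr (iso_sym HI))].
Qed.

Section TransferStates.
Variables (G G' : Graph) (f : vert G -> vert G') (g : vert G' -> vert G).
Hypothesis HI : iso f g.
Variables (k : nat) (W : vert G -> Prop) (W' : vert G' -> Prop).
(** An equation instead of a substitution: [W_back] gives the same hypothesis for the inverse, so
    the maps built on it can be inverted without casts. *)
Hypothesis HW : W' = tr g W.

Lemma W_back : W = tr f W'.
Proof. rewrite HW, (tr_tr W HI). auto. Qed.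

Lemma msep_tr S : msep k W S -> msep k W' (tr g S).
Proof.
  intros (O & r & r' & E & E' & L & L' & P). rewrite HW. split; [apply (opt_below_tr HI O) |].
  exists (fr f r), (fr f r'). split; [apply (isend_tr HI E) | split; [apply (isend_tr HI E') |]].
  split; [apply (lives_tr HI L) | split; [apply (lives_tr HI L') | apply (sep_tr HI P)]].
Qed.

Lemma lcomp_tr S C : lcomp W S C -> lcomp W' (tr g S) (tr g C).
Proof.
  intros (IC & r & E & L & T). rewrite HW. split; [apply (iscomp_tr HI IC) |]. exists (fr f r).
  split; [apply (isend_tr HI E) | split; [apply (lives_tr HI L) | apply (tr_tail HI T)]].
Qed.
End TransferStates.

Section TransferMaps.
Variables (G G' : Graph) (f : vert G -> vert G') (g : vert G' -> vert G).
Hypothesis HI : iso f g.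
Variables (k : nat) (W : vert G -> Prop) (W' : vert G' -> Prop).
Hypothesis HW : W' = tr g W.

Lemma dust_tr L : dust k W L -> dust k W' (tr g L).
Proof.
  intros (S & M & IL & N). exists (tr g S). split; [apply (msep_tr HI HW M) |].
  split; [apply (iscomp_tr HI IL) |]. intro Q.
  apply (lcomp_tr (iso_sym HI) (W_back HI HW)) in Q. rewrite !(tr_tr _ HI) in Q. auto.
Qed.

Definition smap (S : sepn k W) : sepn k W' := exist _ (tr g (proj1_sig S)) (msep_tr HI HW (proj2_sig S)).

Lemma nbhd_tr (L : vert G -> Prop) y : nbhd (tr g L) y <-> nbhd L (g y).
Proof.
  unfold nbhd. split; intros [Ly | (c & Lc & A)]; auto; right.
  - exists (g c). split; auto. apply HI. rewrite !(proj1 (proj2 HI)). auto.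
  - exists (f c). rewrite (tr_f HI). split; auto. apply HI in A. rewrite (proj1 (proj2 HI)) in A. auto.
Qed.

Definition amap (t : anode k W) : anode k W' :=
  match t with
  | None => None
  | Some L => Some (exist _ (tr g (proj1_sig L)) (dust_tr (proj2_sig L)))
  end.

Lemma amap_adj s t : aadj s t -> aadj (amap s) (amap t).
Proof. destruct s, t; simpl; auto. Qed.

End TransferMaps.

Section TransferMapsProperties.
Variables (G G' : Graph) (f : vert G -> vert G') (g : vert G' -> vert G).
Hypothesis HI : iso f g.
Variables (k : nat) (W : vert G -> Prop) (W' : vert G' -> Prop).
Hypothesis HW : W' = tr g W.
Notation HIs := (iso_sym HI).
Notation HWs := (W_back HI HW).

Lemma core_tr : core k W' = tr g (core k W).
Proof.
  apply pred_ext. intro y. unfold core, tr at 1. rewrite HW. split; intros (Wy & H); split; auto.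
  - intros L D Ly. apply (H (tr g L)); auto. rewrite <- HW. apply (dust_tr HI HW D).
  - intros L D Ly. rewrite <- HW in D. apply (H (tr f L)); [apply (dust_tr HIs HWs D) |].
    unfold tr. rewrite (proj1 (proj2 HI)). auto.
Qed.

Lemma amap_part (t : anode k W) y : apart (k := k) (W := W') (amap HI HW t) y <-> apart t (g y).
Proof.
  destruct t as [(L & D)|]; simpl.
  - rewrite (nbhd_tr HI). rewrite HW. unfold tr. tauto.
  - rewrite core_tr. unfold tr. tauto.
Qed.

Lemma amap_cancel (t : anode k W) : amap HIs HWs (amap HI HW t) = t.
Proof.
  destruct t as [(L & D)|]; simpl; auto. f_equal. apply dust_sig_eq. simpl. apply (tr_tr _ HI).
Qed.

Lemma smap_cancel S : smap HIs HWs (smap HI HW S) = S :> sepn k W.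
Proof. apply sepn_eq. simpl. apply (tr_tr _ HI). Qed.

Definition pmap (p : sepn k W -> vert G -> Prop) : sepn k W' -> vert G' -> Prop :=
  fun T => tr g (p (smap HIs HWs T)).

Lemma dirB_tr (S : sepn k W) C : dirB S C -> dirB (smap HI HW S) (tr g C).
Proof. apply (lcomp_tr HI HW). Qed.

End TransferMapsProperties.

Section TransferRegions.
Variables (G G' : Graph) (f : vert G -> vert G') (g : vert G' -> vert G).
Hypothesis HI : iso f g.
Variables (k : nat) (W : vert G -> Prop) (W' : vert G' -> Prop).
Hypothesis HW : W' = tr g W.
Notation HIs := (iso_sym HI).
Notation HWs := (W_back HI HW).

Lemma smap_cancel' T : smap HI HW (smap HIs HWs T) = T :> sepn k W'.
Proof. apply sepn_eq. simpl. apply (tr_tr _ HIs). Qed.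

Lemma pmap_orient (S : sepn k W) C :
  pmap HI HW (orient (@sgB _ k W) S C) = orient (@sgB _ k W') (smap HI HW S) (tr g C).
Proof.
  apply functional_extensionality. intro T. unfold pmap, orient.
  destruct (dec (T = smap HI HW S)) as [-> | N], (dec (smap HIs HWs _ = S)) as [E | N']; auto.
  - exfalso. apply N', smap_cancel.
  - exfalso. apply N. rewrite <- E. symmetry. apply smap_cancel'.
  - unfold sgB. simpl. rewrite (sigma_tr HI), (tr_tr _ HIs). auto.
Qed.

Lemma region_tr (p : sepn k W -> vert G -> Prop) : region (@sgB _ k W) (@dirB _ k W) p ->
  region (@sgB _ k W') (@dirB _ k W') (pmap HI HW p).
Proof.
  intros [(S & C & H & ->) | F].
  - left. exists (smap HI HW S), (tr g C). split; [apply dirB_tr; auto | apply pmap_orient].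
  - right. intro T. apply F, (smap HIs HWs T).
Qed.

Lemma bpart_tr (p : sepn k W -> vert G -> Prop) y : bpart (pmap HI HW p) y <-> bpart p (g y).
Proof.
  assert (EW : W' y <-> W (g y)) by (rewrite HW; unfold tr; tauto).
  unfold bpart. split; intros (Wy & H); (split; [apply EW, Wy |]); intro T.
  - destruct (H (smap HI HW T)) as [K | K]; [left; exact K | right].
    unfold pmap in K. rewrite smap_cancel in K. exact K.
  - destruct (H (smap HIs HWs T)) as [K | K]; [left | right; exact K].
    simpl in K. unfold tr in K. rewrite (proj1 (proj2 HI)) in K. auto.
Qed.

Definition rmap (t : rnode k W) : rnode k W' :=
  match t with
  | inl T => inl (smap HI HW T)
  | inr p => inr (exist _ (pmap HI HW (proj1_sig p)) (region_tr (proj2_sig p)))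
  end.

Lemma rmap_adj s t : radj s t -> radj (rmap s) (rmap t).
Proof.
  destruct s as [S | p], t as [T | q]; simpl; auto; intros (C & H & E); exists (tr g C);
    (split; [apply dirB_tr; auto |]); rewrite E; apply pmap_orient.
Qed.

Lemma rmap_part t y : rpart (rmap t) y <-> rpart t (g y).
Proof. destruct t as [S | p]; simpl; [unfold tr; tauto | apply bpart_tr]. Qed.

End TransferRegions.

Lemma rmap_cancel (G G' : Graph) f g (HI : iso (G := G) (G' := G') f g) k W W' (HW : W' = tr g W)
  (t : rnode k W) : rmap (iso_sym HI) (W_back HI HW) (rmap HI HW t) = t.
Proof.
  destruct t as [S | (p & Hp)]; simpl; f_equal; [apply smap_cancel |].
  apply bnode_eq. simpl. apply functional_extensionality. intro T. unfold pmap.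
  rewrite (tr_tr _ HI). f_equal. apply sepn_eq. simpl. apply (tr_tr _ HI).
Qed.

Lemma img_tr (V V' : Type) (f : V -> V') (g : V' -> V) (A : V -> Prop) y :
  (forall x, g (f x) = x) -> (forall y, f (g y) = y) -> img f A y <-> A (g y).
Proof.
  intros gf fg. split.
  - intros (x & Ax & <-). rewrite gf. auto.
  - intro H. exists (g y). auto.
Qed.

Definition maps_td (V V' : Type) (f : V -> V') W ag W' ag' (X : TD W ag) (Y : TD W' ag') :=
  exists k : tnode X -> tnode Y,
    (exists ki : tnode Y -> tnode X, (forall a, ki (k a) = a) /\ (forall b, k (ki b) = b)) /\
    (forall a b, tadj a b <-> tadj (k a) (k b)) /\
    (forall u y, part (k u) y <-> img f (part u) y).

Lemma maps_tdA (G G' : Graph) f g (HI : iso (G := G) (G' := G') f g) k W W' (HW : W' = tr g W)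
  (H : inv k W) (H' : inv k W') : maps_td f (tdA H) (tdA H').
Proof.
  pose proof (iso_sym HI) as HIs.
  exists (amap (k := k) HI HW). split; [| split].
  - exists (amap (k := k) (iso_sym HI) (W_back HI HW)). split; [apply amap_cancel |].
    intros [(L & D)|]; simpl; auto. f_equal. apply dust_sig_eq. simpl. apply (tr_tr _ HIs).
  - simpl. intros s t. split; [apply amap_adj |].
    destruct s, t; simpl; auto.
  - intros u y. rewrite (img_tr _ _ (proj1 HI) (proj1 (proj2 HI))). apply (amap_part HI HW).
Qed.

Lemma maps_tdB (G G' : Graph) f g (HI : iso (G := G) (G' := G') f g) k W W' (HW : W' = tr g W)
  (H : inv k W) (H' : inv k W') (N : nodust k W) (N' : nodust k W') :
  maps_td f (tdB H N) (tdB H' N').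
Proof.
  assert (C : forall t : rnode k W, rmap (iso_sym HI) (W_back HI HW) (rmap HI HW t) = t).
  { intro t. apply rmap_cancel. }
  assert (C' : forall t : rnode k W', rmap HI HW (rmap (iso_sym HI) (W_back HI HW) t) = t).
  { intro t. generalize (rmap_cancel (iso_sym HI) (W_back HI HW) t).
    (* The node maps contain proofs, and inverting twice returns these only up to proof
       irrelevance. *)
    replace (iso_sym (iso_sym HI)) with HI by apply proof_irrelevance.
    replace (W_back (iso_sym HI) (W_back HI HW)) with HW by apply proof_irrelevance. auto. }
  exists (rmap (k := k) HI HW). split; [| split].
  - exists (rmap (k := k) (iso_sym HI) (W_back HI HW)). auto.
  - intros s t. split; [apply (@rmap_adj _ _ _ _ HI k _ _ HW) |]. intro A.
    apply (@rmap_adj _ _ _ _ (iso_sym HI) k _ _ (W_back HI HW)) in A. rewrite !C in A. exact A.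
  - intros u y. rewrite (img_tr _ _ (proj1 HI) (proj1 (proj2 HI))).
    apply (@rmap_part _ _ _ _ HI k _ _ HW).
Qed.

(** The two depths are lengths of a list and of its image under [map], which are not convertible;
    hence the equation. *)
Lemma maps_tdof (G G' : Graph) f g (HI : iso (G := G) (G' := G') f g) n n' W W'
  (H : good n W) (H' : good n' W') : n' = n -> W' = tr g W -> maps_td f (tdof H) (tdof H').
Proof.
  intros -> HW. unfold tdof. destruct (Bool.bool_dec (Nat.odd n) true) as [e | e].
  - apply (maps_tdB HI HW).
  - apply (maps_tdA HI HW).
Qed.

Lemma step_tr (G G' : Graph) f g (HI : iso (G := G) (G' := G') f g) n W W' U :
  W' = tr g W -> step n W U -> step n W' (tr g U).
Proof.
  intros HW. unfold step. destruct (Nat.odd n).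
  - intros (p & Rp & ->). exists (pmap HI HW p). split; [apply region_tr; auto |].
    apply pred_ext. intro y. rewrite (bpart_tr HI HW). unfold tr. tauto.
  - intros ->. symmetry. apply (core_tr HI _ HW).
Qed.

Lemma hd_tr (G G' : Graph) (g : vert G' -> vert G) l : hd full (map (tr g) l) = tr g (hd full l).
Proof. destruct l; auto. Qed.

Lemma valid_tr (G G' : Graph) f g (HI : iso (G := G) (G' := G') f g) l :
  valid l -> valid (map (tr g) l).
Proof.
  induction l as [|W l IH]; simpl; auto. intros (Hl & St). split; auto.
  rewrite length_map. apply (step_tr HI (hd_tr g l) St).
Qed.

Definition lmap (G G' : Graph) f g (HI : iso (G := G) (G' := G') f g) (t : lnode G) : lnode G' :=
  exist _ (map (tr g) (proj1_sig t)) (valid_tr HI (proj2_sig t)).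

Lemma lmap_cancel (G G' : Graph) f g (HI : iso (G := G) (G' := G') f g) t :
  lmap (iso_sym HI) (lmap HI t) = t.
Proof.
  apply lnode_eq. simpl. rewrite map_map. rewrite <- map_id. apply map_ext.
  intro A. apply (tr_tr _ HI).
Qed.

Lemma lmap_adj (G G' : Graph) f g (HI : iso (G := G) (G' := G') f g) s t :
  ladj s t -> ladj (lmap HI s) (lmap HI t).
Proof.
  intros [(W & E) | (W & E)]; [left | right]; exists (tr g W); simpl; rewrite E; auto.
Qed.

Theorem end_totd_canonical (G G' : Graph) (f : vert G -> vert G') :
  is_graph_iso f -> maps_totd f (end_totd G) (end_totd G').
Proof.
  intros ((g & gf & fg) & A). assert (HI : iso f g) by (split; auto).
  assert (C' : forall t, lmap HI (lmap (iso_sym HI) t) = t).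
  { intro t. generalize (lmap_cancel (iso_sym HI) t).
    replace (iso_sym (iso_sym HI)) with HI by apply proof_irrelevance. auto. }
  assert (EW : forall t, lgraph (lmap HI t) = tr g (lgraph t)).
  { intro t. unfold lgraph. simpl. apply hd_tr. }
  exists (lmap HI). split; [| split; [| split; [| split; [| split]]]].
  - exists (lmap (iso_sym HI)). split; [apply lmap_cancel | apply C'].
  - intros s t. split; [apply lmap_adj |]. intro Q. apply (lmap_adj (iso_sym HI)) in Q.
    rewrite !lmap_cancel in Q. exact Q.
  - apply lnode_eq. auto.
  - intros t y. rewrite (img_tr _ _ gf fg). simpl. rewrite EW. unfold tr. tauto.
  - intros t x y. simpl. rewrite EW. split; [apply (torso_tr HI) |]. intro T.
    apply (torso_tr (iso_sym HI)) in T. rewrite (tr_tr _ HI), !gf in T. auto.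
  - intro t. apply (maps_tdof HI); [simpl; rewrite length_map; auto | apply EW].
Qed.

Theorem theorem1p1 :
  exists F : forall G : Graph, ToTD G,
    canonical_end_construction F /\
    forall (G : Graph) (P Q : sepset (vert G)),
      end_profiles G P -> end_profiles G Q ->
      ~ (forall A B, P A B <-> Q A B) ->
      totd_dist_eff (F G) P Q.
Proof.
  exists end_totd. split.
  - intros G G' f Hf _. apply end_totd_canonical, Hf.
  - intros G P Q. apply end_totd_distinguishes.
Qed.
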